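(* The following explosive separation estimates hold. 1. For all $\alpha\in\mathbb{R}$ with $\alpha<1/2$, there exists a random velocity field $v^\alpha:[0,1]\times\mathbb{R}^2\to\mathbb{R}^2$ with law $\mathbb{P}$ such that, surely, $\|v^\alpha(t,\cdot)\|_{C^\alpha(\mathbb{R}^2)}\le 2$ for all $t\in[0,1]$ and $v^\alpha\in C^\infty_{\mathrm{loc}}((0,1]\times\mathbb{R}^2)$. The velocity field $v^\alpha$ has the property that there exists a sequence of times $T^n$ with $\lim_{n\to\infty}T^n=0$ such that for any $\frac{1}{2(1-\alpha)}<\beta\le 1$ and any deterministic $W\in C^\beta([0,1],\mathbb{R}^2)$, $$\lim_{n\to\infty}\limsup_{\delta\to0}\limsup_{|x-y|\to0}\limsup_{m\to\infty}\mathbb{P}\big(|X^{T^m,x,v^\alpha,W}_{T^n}-X^{T^m,y,v^\alpha,W}_{T^n}|<\delta\big)=0.$$ 2. For all $\rho\in(0,1/2)$, there exists a random velocity field $u^\rho:[0,1]\times\mathbb{R}^2\to\mathbb{R}^2$ with law $\mathbb{P}$ such that, surely, $\|u^\rho(t,\cdot)\|_{C^{-\rho}(\mathbb{R}^2)}\le 2$ for all $t\in[0,1]$ and $u^\rho\in L^1([0,1],C^0(\mathbb{R}^2))\cap C^\infty_{\mathrm{loc}}((0,1]\times\mathbb{R}^2)$. The velocity field $u^\rho$ has the property that there exists a sequence of times $T^n$ with $\lim_{n\to\infty}T^n=0$ such that for any deterministic $W\in C^{\frac{1+\rho/8}{2+\rho/2}}([0,1],\mathbb{R}^2)$, $$\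lim_{n\to\infty}\limsup_{\delta\to0}\limsup_{|x-y|\to0}\limsup_{m\to\infty}\mathbb{P}\big(|X^{T^m,x,u^\rho,W}_{T^n}-X^{T^m,y,u^\rho,W}_{T^n}|<\delta\big)=0.$$
   Context: Norms. For $\alpha\in[0,1)$, $\|f\|_{C^\alpha(\mathbb{R}^d)}$ is the usual Hölder norm ($C^0$ has the sup norm). For $\rho\in(0,1]$, $\|f\|_{C^{-\rho}(\mathbb{R}^d)}:=\inf_{\nabla\cdot g=f}\|g\|_{C^{1-\rho}(\mathbb{R}^d)}$. For $s<-1$, recursively, $\|f\|_{C^s(\mathbb{R}^d)}:=\inf_{\nabla\cdot g=f}\|g\|_{C^{1+s}(\mathbb{R}^d)}$. Solutions. For $u\in C^\infty_{\mathrm{loc}}((0,T]\times\mathbb{R}^d)$, $W\in C^0((0,T],\mathbb{R}^d)$, $s>0$ and $y\in\mathbb{R}^d$, $t\mapsto X^{s,y,u,W}_t$, $t\ge s$, denotes the unique classical solution of $dX_t=u(t,X_t)\,dt+dW_t$, $X_s=y$, i.e. $X_t=y+\int_s^t u(r,X_r)\,dr+W_t-W_s$. The times $T^n$ are positive. The $\limsup_{|x-y|\to0}$ is over pairs of distinct points $x\ne y$ in $\mathbb{R}^2$, i.e. $\lim_{r\to0}\sup_{0<|x-y|<r}$. For fixed $n$, $m\to\infty$ is taken with $T^m\le T^n$. *)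

(* Defs.v *)
From HB Require Import structures.
From mathcomp Require Import all_boot all_order all_algebra.
From mathcomp Require Import all_classical all_reals all_analysis.

Set Implicit Arguments.
Unset Strict Implicit.
Unset Printing Implicit Defensive.

Import Order.TTheory GRing.Theory Num.Theory.
Import numFieldNormedType.Exports.

Local Open Scope classical_set_scope.
Local Open Scope ring_scope.

(* The library norm on ['rV[R]_2] is the max norm; the Euclidean one is used
   wherever the value of a norm matters. *)
Definition tnorm (R : realType) (I : finType) (a : I -> R) : R :=
  Num.sqrt (\sum_i a i ^+ 2).

Definition enorm (R : realType) (x : 'rV[R]_2) : R := tnorm (x 0).

(* Meant for open [U] and finite-dimensional [V], where continuity of all
   iterated directional derivatives up to order [k] characterizes [C^k]. *)
Fixpoint Ck (R : realType) (V W : normedModType R) (k : nat) (U : set V)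
    (f : V -> W) : Prop :=
  (forall x, U x -> {for x, continuous f}) /\
  (if k is k'.+1 then
     forall v : V, (forall x, U x -> derivable f x v) /\ Ck k' U ('D_v f)
   else True).

Definition smooth_on (R : realType) (V W : normedModType R) (U : set V)
    (f : V -> W) : Prop := forall k, Ck k U f.

(* [C^oo_loc((0,1] x R^2)]; as usual on a set which is not open, smoothness up
   to [t = 1] means being the restriction of a function which is smooth on an
   open neighbourhood, here [(0,oo) x R^2]. There is no uniformity in [x]. *)
Definition smooth_loc (R : realType) (u : R -> 'rV[R]_2 -> 'rV[R]_2) : Prop :=
  exists F : R^o * 'rV[R]_2 -> 'rV[R]_2,
    smooth_on [set p : R^o * 'rV[R]_2 | (0 : R) < p.1] F /\
    forall t x, 0 < t <= 1 -> F (t, x) = u t x.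

Section HolderNorm.
Variables (R : realType) (I : finType).
Implicit Types (f : 'rV[R]_2 -> I -> R) (a : R).

Definition sup_norm f : \bar R :=
  ereal_sup [set (tnorm (f x))%:E | x in [set: 'rV[R]_2]].

Definition holder_seminorm a f : \bar R :=
  ereal_sup [set (tnorm (fun i => f p.1 i - f p.2 i)
                    / enorm (p.1 - p.2) `^ a)%:E
            | p in [set p : 'rV[R]_2 * 'rV[R]_2 | p.1 != p.2]].

(* [+oo] encodes [f] not being in [C^0]. *)
Definition C0_norm f : \bar R :=
  if `[< forall i, continuous (fun x => f x i : R^o) >] then sup_norm f
  else +oo%E.

Definition holder_norm a f : \bar R :=
  if a == 0 then C0_norm f else (sup_norm f + holder_seminorm a f)%E.

End HolderNorm.

Definition test_function (R : realType) (phi : 'rV[R]_2 -> R^o) : Prop :=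
  smooth_on setT phi /\
  exists M : R, forall x, M < enorm x -> phi x = 0.

Definition pair_row (R : realType) (p : R * R) : 'rV[R]_2 :=
  \row_(i < 2) if i == 0 then p.1 else p.2.

Definition lebesgue2 (R : realType) :=
  (@lebesgue_measure R \x @lebesgue_measure R)%E.

(* Functionals are only ever evaluated at test functions. Linearity and
   continuity are not recorded: below, any functional of finite norm coincides
   on test functions with an iterated divergence of continuous functions. *)
Definition functional (R : realType) : Type := ('rV[R]_2 -> R^o) -> R.

Definition locally_integrable (R : realType) (f : 'rV[R]_2 -> R) : Prop :=
  forall phi, test_function phi ->
    (@lebesgue2 R).-integrable setT
      (fun p => (f (pair_row p) * phi (pair_row p))%:E).

Definition of_fun (R : realType) (f : 'rV[R]_2 -> R) : functional R :=
  fun phi => \int[@lebesgue2 R]_p (f (pair_row p) * phi (pair_row p)).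

Definition is_divergence (R : realType) (I : finType)
    (g : I * 'I_2 -> functional R) (T : I -> functional R) : Prop :=
  forall i phi, test_function phi ->
    T i phi = - \sum_(j < 2) g (i, j) ('D_(delta_mx 0 j) phi).

(* [neg_norm k a] is the norm of [C^(a - k)], for [a] in [[0,1)]. At [k = 0]
   a functional is identified with the function which represents it; functions
   that are not locally integrable have infinite norm and do not contribute. *)
Fixpoint neg_norm (R : realType) (k : nat) (a : R) (I : finType)
    (T : I -> functional R) : \bar R :=
  match k with
  | 0 => ereal_inf [set holder_norm a f
         | f in [set f : 'rV[R]_2 -> I -> R | forall i phi,
                   test_function phi -> T i phi = of_fun (f^~ i) phi]]
  | k'.+1 => ereal_inf [set neg_norm k' a g
         | g in [set g : I * 'I_2 -> functional R | is_divergence g T]]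
  end.

(* The norm of [C^s(R^2)], [s < 1], of a vector field; for [s < 0] the number
   of divergences is the [k] such that [s + k] is in [[0,1)]. *)
Definition Cs_norm (R : realType) (s : R) (f : 'rV[R]_2 -> 'rV[R]_2) : \bar R :=
  if 0 <= s then holder_norm s (fun x => f x 0)
  else if `[< forall i, locally_integrable (fun x => f x 0 i) >] then
    neg_norm `|Num.floor s|%N (s - (Num.floor s)%:~R)
      (fun i => of_fun (fun x => f x 0 i))
  else +oo%E.

Definition simple_C0 (R : realType) (s : R -> 'rV[R]_2 -> 'rV[R]_2) : Prop :=
  [/\ finite_set (range s),
      forall f, @measurable _ (measurableTypeR R) (s @^-1` [set f])
    & forall t, (Cs_norm 0 (s t) < +oo)%E].

Definition L1_C0 (R : realType) (u : R -> 'rV[R]_2 -> 'rV[R]_2) : Prop :=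
  (exists s : nat -> R -> 'rV[R]_2 -> 'rV[R]_2,
     (forall n, simple_C0 (s n)) /\
     {ae @lebesgue_measure R, forall t, 0 <= t <= 1 ->
        Cs_norm 0 (fun x => u t x - s n t x) @[n --> \oo] --> 0%E}) /\
  (\int[@lebesgue_measure R]_(t in `[0%R, 1%R]) Cs_norm 0 (u t) < +oo)%E.

Section Flow.
Variables (R : realType).
Variables (u : R -> 'rV[R]_2 -> 'rV[R]_2) (W : R -> 'rV[R]_2).

Definition is_solution (s : R) (y : 'rV[R]_2) (X : R -> 'rV[R]_2) : Prop :=
  {within `[s, 1], continuous X} /\
  forall t, s <= t <= 1 ->
    X t = y + (\row_(i < 2) \int[@lebesgue_measure R]_(r in `[s, t])
                              (u r (X r) 0 i))
          + (W t - W s).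

(* [X^{s,y,u,W}_t]; meaningful for [s <= t <= 1] when [well_posed u] holds. *)
Definition flow (s : R) (y : 'rV[R]_2) (t : R) : 'rV[R]_2 :=
  xget (fun=> 0) [set X | is_solution s y X] t.

End Flow.

Definition well_posed (R : realType) (u : R -> 'rV[R]_2 -> 'rV[R]_2) : Prop :=
  forall (W : R -> 'rV[R]_2) (s : R) (y : 'rV[R]_2),
    {within `]0, 1], continuous W} -> 0 < s <= 1 ->
    (exists X, is_solution u W s y X) /\
    (forall X Y, is_solution u W s y X -> is_solution u W s y Y ->
       forall t, s <= t <= 1 -> X t = Y t).

(* For [b = 1] this is Lipschitz continuity. *)
Definition holder_path (R : realType) (b : R) (W : R -> 'rV[R]_2) : Prop :=
  exists C : R, forall s t, 0 <= s <= 1 -> 0 <= t <= 1 ->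
    enorm (W t - W s) <= C * `|t - s| `^ b.

Definition random_field (R : realType) (d : measure_display)
    (Omega : measurableType d) (v : Omega -> R -> 'rV[R]_2 -> 'rV[R]_2) : Prop :=
  forall t x i, 0 <= t <= 1 -> measurable_fun setT (fun w => v w t x 0 i).

(* Limits along [near_diagonal] are limits as [|x - y| -> 0] with [x != y]. *)
Definition near_diagonal (R : realType) : set_system ('rV[R]_2 * 'rV[R]_2) :=
  filter_from [set r : R | 0 < r]
    (fun r => [set p | 0 < enorm (p.1 - p.2) < r]).

(* If [v] is a [random_field] with smooth and well-posed samples, the events
   are measurable for [T m <= T n] (the flow is a limit of Euler schemes);
   the finitely many other [m] do not affect the innermost limsup. *)
Definition explosive_separation (R : realType) (d : measure_display)
    (Omega : measurableType d) (P : probability Omega R)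
    (v : Omega -> R -> 'rV[R]_2 -> 'rV[R]_2) (T : nat -> R)
    (W : R -> 'rV[R]_2) : Prop :=
  limf_esup (fun delta : R =>
    limf_esup (fun p : 'rV[R]_2 * 'rV[R]_2 =>
      limn_esup (fun m =>
        P [set w | enorm (flow (v w) W (T m) p.1 (T n)
                          - flow (v w) W (T m) p.2 (T n)) < delta]))
      (@near_diagonal R))
    0^'+ @[n --> \oo] --> 0%E.

Definition vanishing_times (R : realType) (T : nat -> R) : Prop :=
  (forall n, 0 < T n <= 1) /\ T @ \oo --> 0.

(* Main.v *)
Require Import Defs.
From mathcomp Require Import all_boot all_order all_algebra.
From mathcomp Require Import all_classical all_reals all_analysis.
From mathcomp Require Import measurable_realfun.
From mathcomp Require Import zify ring lra.
Set Implicit Arguments.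
Unset Strict Implicit.
Unset Printing Implicit Defensive.
Import Order.TTheory GRing.Theory Num.Theory.
Import numFieldNormedType.Exports.
Local Open Scope classical_set_scope.
Local Open Scope ring_scope.

(** The velocity field is a random alternating shear.  Time is cut into the dyadic
    blocks [[2^-(k+1), 2^-k]], and block [k] works at the length scale
    [ell k = 2^-(k^2)].  During block [k] the field points along one coordinate
    axis and depends on the other coordinate only; the two axes are exchanged from
    one block to the next.  The block is cut into a large number of short pulses.
    A pulse is a smooth bump in time multiplied by a cosine in space of frequency
    comparable to [1 / ell k], and it carries a random sign.  All signs are
    independent: they are the binary digits of a uniform point of the unit interval
    ([unif01_digits_le]).

    The norm.  A plane wave of amplitude [c] and frequency [lam] has a norm of order
    [c lam^s] in [C^s].  For [0 <= s < 1] this is interpolation between the bound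
    and the Lipschitz bound of the cosine.  For [s < 0] it follows because the wave
    is [lam^-1] times the divergence of a wave with shifted phase
    ([of_fun_wave_parts], [Cs_norm_shear_wave]).  So the amplitude of block [k] is
    taken of order [(ell k)^s].  Pulses vanish near the ends of their time slots and
    slots accumulate at time zero only, so that the field is smooth at positive
    times ([field_local]).

    The flow.  Under a shear the coordinate transverse to it follows the driving
    path, and the other one is then given by an integral.  Hence solutions on a
    block are explicit, and they concatenate ([well_posed_shears]).  Two solutions
    driven by the same path keep their transverse separation during a block, while
    their separation along the shear receives a signed sum of one step for each
    pulse ([flow_block_diff]).

    The steps.  Suppose that the transverse separation lies between [ell k] and [2].
    Pulses are so short that the path moves by much less than [ell k] while a pulse
    lasts; for a [beta]-Hoelder path and a duration [(ell k)^sigma] this is the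
    condition [sigma beta > 1].  So the step is large as soon as the two cosines
    differ at the start of the pulse.  A fixed separation may be a multiple of the
    wave length, but among about [k^2] well chosen frequencies one is good
    ([freq_good]), and so is one of the two phases.  A definite proportion of the
    steps is therefore large ([large_steps_count]), whatever the separation is.

    The gain.  By the Littlewood-Offord bound ([littlewood_offord]), a signed sum
    with [2 n] large steps falls in an interval of the length of a few steps with
    probability at most a constant over the square root of [n], independently of the
    initial separation along the shear.  The number of pulses is chosen to make the
    sum exceed the next, much larger, scale [ell (k - 1)], except with a small
    probability; by Chebyshev's inequality it also stays below [2^-k], so that all
    separations remain at most [2] ([block_failureP]).  In block [k - 1] the
    coordinate which has just been separated is the transverse one, and the argument
    applies again.  Failures from block [n] on sum up to at most [2 * 2^-n]
    ([avg_not_separated]), uniformly in the fine block where one starts.  Two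
    distinct points are at distance at least [ell m] in some coordinate for all
    large [m] ([eventually_separated]), hence with probability at least
    [1 - 2 * 2^-n] they are at distance at least [ell (n - 1)] at time [2^-n],
    however close they were initially ([explosive_of_schedule]).

    The parameters.  Let [a] be the order of the norm, so that the amplitude is
    about [2^(- a k^2)], the duration about [2^(- sigma k^2)] and a step about
    [2^(- (a + sigma) k^2)].  The sum over [2^(theta k^2)] pulses has standard
    deviation about [ell k] when [theta = 2 sigma - 2 + 2 a], and factors of the form
    [2^(c k)] make it larger than [ell (k - 1)].  Pulses fit in the block when
    [theta <= sigma].  For the first part [a = alpha] and
    [theta = sigma = 2 - 2 alpha], which gives the condition
    [beta > 1 / (2 (1 - alpha))].  For the second part [a = - rho] and
    [sigma = 2 + rho / 2]: then [sigma] exceeds [theta] by enough to make the time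
    integral of the sup norm finite, although amplitudes tend to infinity
    ([L1_C0_field]). *)

(** * Averages over fair bits *)

Section FairBits.
Variable R : realType.
Implicit Types (phi psi : seq bool -> R) (b : seq bool).

(** Expectation of a function of [n] independent fair bits.  Bits are consumed one
    at a time, so that conditioning on an initial or a final segment of the bits is
    an identity between iterated averages ([avg_cat], [avgC]). *)
Fixpoint avg n phi : R :=
  if n is n'.+1 then
    (avg n' (fun b => phi (true :: b)) + avg n' (fun b => phi (false :: b))) / 2
  else phi [::].

Lemma le_avg n phi psi :
  (forall b, size b = n -> phi b <= psi b) -> avg n phi <= avg n psi.
Proof.
elim: n phi psi => [|n IH] phi psi h /=; first exact: h.
rewrite ler_pM2r ?invr_gt0// lerD// IH// => b sb; by apply: h; rewrite /= sb.
Qed.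

Lemma eq_avg n phi psi :
  (forall b, size b = n -> phi b = psi b) -> avg n phi = avg n psi.
Proof.
by move=> h; apply/eqP; rewrite eq_le !le_avg// => b sb; rewrite h.
Qed.

Lemma avg_cst n (c : R) : avg n (fun=> c) = c.
Proof. by elim: n => //= n ->; field. Qed.

Lemma avgD n phi psi :
  avg n (fun b => phi b + psi b) = avg n phi + avg n psi.
Proof. by elim: n phi psi => //= n IH phi psi; rewrite !IH; field. Qed.

Lemma avgZ n (c : R) phi : avg n (fun b => c * phi b) = c * avg n phi.
Proof. by elim: n phi => //= n IH phi; rewrite !IH; field. Qed.

Lemma avg_cat m n phi :
  avg (m + n) phi = avg m (fun a => avg n (fun b => phi (a ++ b))).
Proof. by elim: m phi => //= m IH phi; rewrite !IH. Qed.

Lemma avgC m n (phi : seq bool -> seq bool -> R) :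
  avg m (fun a => avg n (phi a)) = avg n (fun b => avg m (phi^~ b)).
Proof.
elim: m phi => //= m IH phi; rewrite (IH (fun a => phi (true :: a))).
rewrite (IH (fun a => phi (false :: a))) -avgD mulrC -avgZ.
by apply: eq_avg => b _; rewrite mulrC.
Qed.

Definition bit_sign (c : bool) : R := if c then 1 else -1.

Definition signed_sum n (d : nat -> R) b : R :=
  \sum_(j < n) bit_sign (nth false b j) * d j.

Lemma signed_sum_cons n d c b :
  signed_sum n.+1 d (c :: b) = bit_sign c * d 0 + signed_sum n (d \o S) b.
Proof. by rewrite /signed_sum big_ord_recl. Qed.

(** Cross terms average to zero, by the independence of the signs. *)
Lemma avg_sqr_signed_sum n d (c : R) :
  avg n (fun b => (c + signed_sum n d b) ^+ 2)
  = c ^+ 2 + \sum_(j < n) d j ^+ 2.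
Proof.
elim: n d c => [|n IH] d c /=; first by rewrite /signed_sum !big_ord0 !addr0.
rewrite (eq_avg (psi := fun b => ((c + d 0) + signed_sum n (d \o S) b) ^+ 2)).
  rewrite IH (eq_avg (psi := fun b => ((c - d 0) + signed_sum n (d \o S) b) ^+ 2)).
    rewrite IH big_ord_recl (_ : \sum_(i < n) d (lift (@ord0 n) i) ^+ 2
      = \sum_(i < n) (d \o S) i ^+ 2); last exact: eq_bigr.
    by field.
  by move=> b _; rewrite signed_sum_cons /= mulN1r addrA.
by move=> b _; rewrite signed_sum_cons /= mul1r addrA.
Qed.

Lemma avg_chebyshev n d (r : R) : 0 < r ->
  avg n (fun b => (r < `|signed_sum n d b|)%R%:R)
  <= (\sum_(j < n) d j ^+ 2) / r ^+ 2.
Proof.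
move=> r0.
have := avg_sqr_signed_sum n d 0; rewrite expr0n /= add0r => <-.
rewrite mulrC -avgZ; apply: le_avg => b _; rewrite add0r.
have r2 : 0 < r ^+ 2 by rewrite exprn_gt0.
case: ltP => h /=; last by rewrite mulr_ge0 ?invr_ge0 ?sqr_ge0.
rewrite mulrC ler_pdivlMr// mul1r -[leRHS]real_normK ?num_real//.
by rewrite ler_pXn2r ?nnegrE ?(ltW r0) ?(ltW h).
Qed.

End FairBits.

(** * The Littlewood-Offord bound *)

Section LittlewoodOfford.
Variable R : realType.
Implicit Types (F : seq R).

Definition separated (w : R) F := pairwise (fun x y => x + w <= y) F.

Definition hits (a w : R) F := count (fun x => a <= x < a + w) F.

Lemma separated_hits_le1 (a w : R) F : separated w F -> (hits a w F <= 1)%N.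
Proof.
elim: F => //= x F IH /andP[/allP xF /IH hF].
rewrite /hits/=; case: (boolP (a <= x < a + w)) => // /andP[ax xa].
rewrite (_ : count _ F = 0)%N//; apply/eqP; rewrite -leqn0 leqNgt -has_count.
apply/hasPn => y /xF xy; apply/negP => /andP[_ ya].
by move: (le_lt_trans xy ya); rewrite ltrD2r ltNge ax.
Qed.

Lemma separated_shift (w c : R) F :
  separated w [seq x + c | x <- F] = separated w F.
Proof.
elim: F => //= x F ->; rewrite all_map; congr (_ && _).
by apply: eq_all => y /=; rewrite addrAC lerD2r.
Qed.

Definition large_steps n (d : R) (ds : nat -> R) : nat :=
  (\sum_(j < n) (d <= `|ds j|)%R)%N.

Lemma large_stepsS n (d : R) ds :
  large_steps n.+1 d ds = ((d <= `|ds 0%N|)%R + large_steps n d (ds \o S))%N.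
Proof. by rewrite /large_steps big_ord_recl. Qed.

(** Pascal's rule, in the form in which the blocks of sizes [r + 2] and [r] of the
    middle of a row add up to the block of size [r + 1] of the next row. *)
Lemma central_block_Pascal g e r :
  (\sum_(e <= i < e + r.+2) 'C(g, i) + \sum_(e.+1 <= i < e.+1 + r) 'C(g, i)
   = \sum_(e.+1 <= i < e.+1 + r.+1) 'C(g.+1, i))%N.
Proof.
rewrite addSn (addSn e r.+1) !big_add1 /= -(addn1 r.+1) addnA addn1.
rewrite big_nat_recr ?leq_addr//= [in RHS](eq_bigr (fun i => 'C(g, i.+1) + 'C(g, i))%N).
  rewrite big_split /= addnS [in RHS]big_nat_recr ?leq_addr//=; lia.
by move=> i _; rewrite binS.
Qed.

Lemma full_block g : (\sum_(0 <= i < g.+1) 'C(g, i) = 2 ^ g)%N.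
Proof.
rewrite big_mkord -[2%N]/(1 + 1)%N expnDn; apply: eq_bigr => i _.
by rewrite !exp1n !muln1.
Qed.

(** Kleitman's argument, for the expected number of points of a separated family
    which a random translation puts in an interval.  Shifting a family of size [r] by
    [t] and by [-t], where [2 t] is at least the separation, produces [2 r] points.
    Since the first point shifted down is separated from all points shifted up, they
    regroup into separated families of sizes [r + 1] and [r - 1], with one large step
    less.  The bound is the sum of the [size F] central binomial coefficients of
    order [g], and [e] is the index at which this sum starts. *)
Lemma separated_avg_hits n (d a : R) ds F g e : 0 < d ->
  separated (2 * d) F -> (g <= large_steps n d ds)%N ->
  (2 * e + size F = g.+1)%N ->
  avg n (fun b => (hits a (2 * d) [seq x + signed_sum n ds b | x <- F])%:R)
  <= (\sum_(e <= i < e + size F) 'C(g, i))%:R / 2 ^+ g :> R.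
Proof.
move=> d0; elim: n ds F g e => [|n IH] ds F g e sF gn eF.
  have g0 : g = 0%N by move: gn; rewrite /large_steps big_ord0; lia.
  have [e0 F1] : e = 0%N /\ size F = 1%N by lia.
  rewrite g0 e0 F1 big_nat1 bin0 expr0 divr1 ler_nat.
  by rewrite separated_hits_le1// separated_shift.
have [e0|e0] := posnP e.
  (* The sum runs over a full row, so that the bound is one; a separated family
     never has more than one point in the interval. *)
  have -> : size F = g.+1 by lia.
  rewrite e0 add0n full_block natrX divff ?expf_neq0 ?pnatr_eq0//.
  rewrite -[leRHS](avg_cst n.+1); apply: le_avg => b _.
  by rewrite lern1 separated_hits_le1// separated_shift.
case: e e0 eF => // e _ eF.
have stepE c : avg n (fun b => (hits a (2 * d)
     [seq x + signed_sum n.+1 ds (c :: b) | x <- F])%:R)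
   = avg n (fun b => (hits a (2 * d) [seq x + signed_sum n (ds \o S) b
                        | x <- [seq x + bit_sign R c * ds 0%N | x <- F]])%:R) :> R.
  apply: eq_avg => b _; rewrite -map_comp; congr (hits _ _ _)%:R.
  by apply: eq_map => x /=; rewrite signed_sum_cons addrA.
rewrite /= !stepE /= mul1r mulN1r => {stepE}.
set N := (\sum_(_ <= i < _) _)%N.
move: gn; rewrite large_stepsS; case: leP => [dl|_] gn; last first.
  (* A small step is not counted: both signs leave a shifted family to which the
     induction hypothesis applies with the same [g]. *)
  have hN c : avg n (fun b => (hits a (2 * d) [seq x + signed_sum n (ds \o S) b
                        | x <- [seq x + c | x <- F]])%:R) <= N%:R / 2 ^+ g :> R.
    rewrite /N -(size_map (fun x => x + c) F); apply: IH => //.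
    - by rewrite separated_shift.
    - by rewrite size_map.
  by rewrite ler_pdivrMr// mulr_natr mulr2n lerD.
have key t : 2 * d <= t + t ->
    avg n (fun b => (hits a (2 * d) [seq x + signed_sum n (ds \o S) b
       | x <- [seq x + t | x <- F]])%:R)
    + avg n (fun b => (hits a (2 * d) [seq x + signed_sum n (ds \o S) b
       | x <- [seq x - t | x <- F]])%:R) <= N%:R / 2 ^+ g * 2 :> R.
  move=> dt; rewrite /N; case: F sF eF {N} => [|x F] sF eF.
    by rewrite /hits /= !avg_cst addr0 !mulr_ge0 ?invr_ge0 ?exprn_ge0.
  case: g gn eF => [|g] gn eF; first by move: eF => /=; lia.
  rewrite -avgD (eq_avg (psi := fun b =>
      (hits a (2 * d) [seq y + signed_sum n (ds \o S) b
         | y <- (x - t) :: [seq y + t | y <- x :: F]])%:R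
      + (hits a (2 * d) [seq y + signed_sum n (ds \o S) b
         | y <- [seq y - t | y <- F]])%:R)); last first.
    move=> b _; rewrite -!natrD; congr _%:R; rewrite /hits /=. by rewrite addnCA addnA.
  rewrite avgD (_ : _ * 2 = (\sum_(e <= i < e + (size F).+2) 'C(g, i))%:R / 2 ^+ g
      + (\sum_(e.+1 <= i < e.+1 + size F) 'C(g, i))%:R / 2 ^+ g); last first.
    rewrite -mulrDl -natrD central_block_Pascal /= exprS; field.
    by rewrite expf_neq0.
  apply: lerD.
    rewrite -[(size F).+2]/(size ((x - t) :: x :: F)).
    have -> : size ((x - t) :: x :: F) = size ((x - t) :: [seq y + t | y <- x :: F]).
      by rewrite /= size_map.
    apply: IH => //=; last by rewrite size_map; move: eF => /=; lia.
    case/andP: sF => xF sF; rewrite -/(separated _ _) all_map separated_shift.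
    apply/andP; split.
      apply/andP; split; first by rewrite addrAC lerBlDr -!addrA lerD2l.
      apply/allP => y /(allP xF) /= xy.
      have d2 : 0 < 2 * d by rewrite mulr_gt0.
      by move: dt d2 xy; lra.
    apply/andP; split; last exact: sF.
    apply/allP => _ /mapP[y /(allP xF) /= xy ->].
    by rewrite addrAC lerD2r.
  rewrite -(size_map (fun x => x - t) F); apply: IH => //=.
    by case/andP: sF => _; rewrite separated_shift.
  by rewrite size_map; move: eF => /=; lia.
rewrite ler_pdivrMr//.
have [ds0|ds0] := lerP 0 (ds 0%N); first by apply: key; move: dl; rewrite ger0_norm// ; lra.
rewrite addrC -{2}[ds 0%N]opprK; apply: key.
by move: dl; rewrite ltr0_norm//; lra.
Qed.

(** A form of the bound of order [4^n / sqrt n] which has an elementary induction. *)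
Lemma central_binomial_le n : ('C(2 * n, n) ^ 2 * (2 * n + 1) <= 16 ^ n)%N.
Proof.
elim: n => [//|n IH].
have h1 : ('C(2 * n.+1, n.+1) * n.+1 = 'C(2 * n, n) * (2 * (2 * n + 1)))%N.
  have := mul_bin_diag (2 * n.+1) n; have := mul_bin_down (2 * n).+1 n.
  have -> : ((2 * n.+1).-1 = (2 * n).+1)%N by lia.
  have -> : ((2 * n).+1 - n = n.+1)%N by lia.
  by rewrite -pred_Sn => h2 h3; nia.
rewrite -(leq_pmul2r (m := n.+1 ^ 2)) ?expn_gt0//.
have -> : ('C(2 * n.+1, n.+1) ^ 2 * (2 * n.+1 + 1) * n.+1 ^ 2
  = ('C(2 * n.+1, n.+1) * n.+1) ^ 2 * (2 * n + 3))%N by rewrite expnMn; lia.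
rewrite h1 (expnS 16) !expnMn.
have -> : ('C(2 * n, n) ^ 2 * (2 ^ 2 * (2 * n + 1) ^ 2) * (2 * n + 3)
  = ('C(2 * n, n) ^ 2 * (2 * n + 1)) * (4 * ((2 * n + 1) * (2 * n + 3))))%N by lia.
apply: (leq_trans (leq_mul IH (leqnn _))).
rewrite (mulnC 16) -mulnA leq_mul2l; apply/orP; right.
by rewrite -!mulnn; lia.
Qed.

(** The family in Kleitman's argument is here a single point, for which the bound is
    the central binomial coefficient divided by [4^n]. *)
Lemma littlewood_offord N (d a c : R) ds n : 0 < d ->
  (2 * n <= large_steps N d ds)%N ->
  avg N (fun b => (a <= c + signed_sum N ds b < a + 2 * d)%R%:R)
  <= (Num.sqrt (2 * n + 1)%:R)^-1 :> R.
Proof.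
move=> d0 nN.
apply: (@le_trans _ _ ('C(2 * n, n)%:R / 2 ^+ (2 * n))).
  have := @separated_avg_hits N d a ds [:: c] (2 * n) n d0 isT nN _.
  rewrite /= !addn1 big_nat1 => /(_ erefl); apply: le_trans.
  by apply: le_avg => b _; rewrite /hits /= addn0.
rewrite -[leRHS]mul1r ler_pdivrMr ?exprn_gt0// mulrAC ler_pdivlMr ?sqrtr_gt0 ?ltr0n ?addn1// mul1r.
rewrite -(ler_pXn2r (n := 2)) ?nnegrE ?mulr_ge0 ?exprn_ge0 ?sqrtr_ge0//.
have -> : (2 ^+ (2 * n)) ^+ 2 = (16 ^ n)%:R :> R.
  by rewrite -exprM -natrX -[16%N]/(2 ^ 4)%N -expnM; congr (2 ^ _)%:R; lia.
rewrite exprMn sqr_sqrtr// -natrX -natrM ler_nat.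
by rewrite -[X in (_ * X)%N]addn1 central_binomial_le.
Qed.

Lemma littlewood_offord_windows N (d a c : R) ds n k : 0 < d ->
  (2 * n <= large_steps N d ds)%N ->
  avg N (fun b => (a <= c + signed_sum N ds b < a + k%:R * (2 * d))%R%:R)
  <= k%:R / Num.sqrt (2 * n + 1)%:R :> R.
Proof.
move=> d0 nN; elim: k a => [|k IH] a.
  rewrite mul0r addr0 mul0r -[leRHS](avg_cst N 0); apply: le_avg => b _.
  by rewrite ltNge; case: (a <= _).
rewrite -(natr1 k) [leRHS]mulrDl mul1r [leRHS]addrC.
apply: (le_trans _ (lerD (littlewood_offord a c d0 nN) (IH (a + 2 * d)))).
rewrite -avgD; apply: le_avg => b _; rewrite -natrD ler_nat.
set x := c + _; have -> : a + (k%:R + 1) * (2 * d) = a + 2 * d + k%:R * (2 * d) by ring.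
case: (boolP (a <= x)) => //= _; case: (ltP x (a + 2 * d)) => /=; by case: (x < _).
Qed.
End LittlewoodOfford.

(** * Independent bits from binary digits *)

Section DyadicDigits.
Variable R : realType.
Implicit Types (w : R) (Q : pred (seq bool)).

Definition unif01 : probability (measurableTypeR R) R := uniform_prob (@ltr01 R).

Definition digit (j : nat) (w : R) : bool := odd (Num.truncn (2 ^+ j.+1 * w)).

Definition digits (i n : nat) (w : R) : seq bool := [seq digit j w | j <- iota i n].

Lemma measurable_truncn_le (c d : R) n : 0 < c ->
  measurable [set w : measurableTypeR R | (Num.truncn (c * w + d) <= n)%N].
Proof.
move=> c0; rewrite (_ : [set _ | _] = `]-oo, ((n.+1%:R - d) / c)[%classic).
  exact: measurable_itv.
by apply/seteqP; split => w /=; rewrite in_itv/= truncn_le_nat ltr_pdivlMr// mulrC ltrBrDr.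
Qed.

Lemma measurable_truncn (c d : R) (Q : pred nat) : 0 < c ->
  measurable [set w : measurableTypeR R | Q (Num.truncn (c * w + d))].
Proof.
move=> c0.
have meq n : measurable [set w : measurableTypeR R | Num.truncn (c * w + d) = n].
  case: n => [|n].
    rewrite (_ : [set _ | _] = [set w | (Num.truncn (c * w + d) <= 0)%N]).
      exact: measurable_truncn_le.
    by apply/seteqP; split => w /=; rewrite leqn0 => /eqP.
  rewrite (_ : [set _ | _] = [set w | (Num.truncn (c * w + d) <= n.+1)%N]
      `\` [set w | (Num.truncn (c * w + d) <= n)%N]).
    by apply: measurableD; exact: measurable_truncn_le.
  apply/seteqP; split => w /=; first by move=> ->; rewrite leqnn ltnn.
  by move=> [h1 /negP h2]; apply/eqP; rewrite eqn_leq h1 ltnNge.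
rewrite (_ : [set _ | _] =
    \bigcup_(n in [set n | Q n]) [set w | Num.truncn (c * w + d) = n]).
  exact: bigcup_measurable.
by apply/seteqP; split => w /=; [move=> Qw; exists (Num.truncn (c * w + d))|
  move=> [n /= Qn ->]].
Qed.

Lemma measurable_digit j : measurable [set w : measurableTypeR R | digit j w].
Proof.
rewrite (_ : [set _ | _] = [set w | odd (Num.truncn (2 ^+ j.+1 * w + 0))]).
  by apply: measurable_truncn; rewrite exprn_gt0.
by apply/seteqP; split => w /=; rewrite addr0.
Qed.

Lemma set_bool T (b : bool) : [set _ : T | b] = if b then setT else set0.
Proof. by case: b; apply/seteqP; split => x. Qed.

Lemma measurable_digits i n Q :
  measurable [set w : measurableTypeR R | Q (digits i n w)].
Proof.
elim: n i Q => [|n IH] i Q.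
  by rewrite /digits/= set_bool; case: ifP => _; [exact: measurableT|exact: measurable0].
rewrite (_ : [set _ | _] =
  ([set w | digit i w] `&` [set w | Q (true :: digits i.+1 n w)])
  `|` (~` [set w | digit i w] `&` [set w | Q (false :: digits i.+1 n w)])).
  apply: measurableU; apply: measurableI.
  - exact: measurable_digit.
  - exact: (IH i.+1 (fun b => Q (true :: b))).
  - by apply: measurableC; exact: measurable_digit.
  - exact: (IH i.+1 (fun b => Q (false :: b))).
apply/seteqP; split => w /=; rewrite /digits/=; case: (digit i w) => //=; by [left|right|case=> -[]].
Qed.

Lemma unif01_itv_le (a b : R) : a <= b -> (unif01 `[a, b[%classic <= (b - a)%:E)%E.
Proof.
move=> ab; rewrite /unif01 /= /uniform_prob.
apply: (@le_trans _ _ (\int[lebesgue_measure]_(x in `[a, b[) (cst 1%:E x))%E).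
  apply: ge0_le_integral => //=.
  - by move=> x _; rewrite lee_fin uniform_pdf_ge0.
  - by apply/measurable_EFinP/measurable_funTS; exact: measurable_uniform_pdf.
  - move=> x _; rewrite lee_fin /uniform_pdf subr0 invr1; by case: ifP.
rewrite integral_cst//= mul1e lebesgue_measure_itv /= lte_fin.
by case: ltP => // ba; rewrite lee_fin subr_ge0.
Qed.

(** A dyadic interval is halved by the next digit, so that on it the following
    digits are independent fair bits. *)
Lemma unif01_digits_itv_le i n Q (m : nat) :
  (unif01 (`[(m%:R / 2 ^+ i)%R, (m.+1%:R / 2 ^+ i)%R[%classic
           `&` [set w | Q (digits i n w)])%classic
   <= ((2 ^+ i)^-1 * avg n (fun b => (Q b)%:R))%:E)%E.
Proof.
elim: n i m Q => [|n IH] i m Q.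
  rewrite /digits /= set_bool; case: ifP => _; last by rewrite setI0 measure0 mulr0.
  rewrite setIT mulr1; apply: (le_trans (unif01_itv_le _)).
    by rewrite ler_pM2r ?invr_gt0 ?exprn_gt0// ler_nat.
  by rewrite lee_fin -mulrBl -natrB// subSnn mul1r.
pose B c : set R := `[(m.*2 + nat_of_bool c)%:R / 2 ^+ i.+1,
    (m.*2 + nat_of_bool c).+1%:R / 2 ^+ i.+1[ `&` [set w | Q (c :: digits i.+1 n w)].
have mB c : measurable (B c : set (measurableTypeR R)).
  apply: measurableI; first exact: measurable_itv.
  exact: (measurable_digits i.+1 n (fun b => Q (c :: b))).
apply: (@le_trans _ _ (unif01 (B true `|` B false)%classic)).
  apply: le_measure; rewrite ?inE.
  - by apply: measurableI; [exact: measurable_itv|exact: measurable_digits].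
  - exact: measurableU.
  have inB w (c : bool) : (m.*2 + c)%:R <= 2 ^+ i.+1 * w < (m.*2 + c).+1%:R ->
      Q (digits i n.+1 w) -> B c w.
    move=> wc; rewrite /digits /= (_ : digit i w = c); last first.
      by rewrite /digit (truncn_def wc) oddD odd_double oddb.
    move=> Qw; split => //=; rewrite in_itv/=.
    by rewrite ler_pdivrMr ?exprn_gt0// ltr_pdivlMr ?exprn_gt0// mulrC.
  move=> w [] /=; rewrite in_itv/= => /andP[].
  rewrite ler_pdivrMr ?exprn_gt0// ltr_pdivlMr ?exprn_gt0// (mulrC w) => w1 w2 Qw.
  have e1 : m.*2%:R = 2 * m%:R :> R by rewrite -mul2n natrM.
  have e2 : 2 ^+ i.+1 * w = 2 * (2 ^+ i * w) by rewrite exprS mulrA.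
  have e3 : m.+1%:R = m%:R + 1 :> R by rewrite natr1.
  have [h|h] := leP ((m.*2 + true)%:R) (2 ^+ i.+1 * w).
    left; apply: inB => //; rewrite h /=; move: h w2; rewrite e2 e3 -addnS natrD e1 -natr1; lra.
  right; apply: inB => //; rewrite !addn0; move: h; rewrite addn1 e2 e1 => -> ; rewrite andbT.
  lra.
apply: (le_trans (measureU2 _ (mB true) (mB false))).
apply: (le_trans (leeD (IH i.+1 (m.*2 + true)%N (fun b => Q (true :: b)))
  (IH i.+1 (m.*2 + false)%N (fun b => Q (false :: b))))).
rewrite -EFinD lee_fin /= exprS invfM; lra.
Qed.

(** This is the interval [[0, 1[] of the halving above; the endpoint [1] is a null
    set. *)
Lemma unif01_digits_le n Q :
  (unif01 [set w | Q (digits 0 n w)] <= (avg n (fun b => (Q b)%:R))%:E)%E.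
Proof.
have m01 : measurable (`[0, 1[%classic : set (measurableTypeR R)) by exact: measurable_itv.
apply: (@le_trans _ _ (unif01 ((`[(0%:R / 2 ^+ 0)%R, (1%:R / 2 ^+ 0)%R[%classic
    `&` [set w | Q (digits 0 n w)]) `|` ~` `[0%R, 1%R[%classic)%classic)).
  apply: le_measure; rewrite ?inE.
  - exact: measurable_digits.
  - apply: measurableU; last exact: measurableC.
    by apply: measurableI; [exact: measurable_itv|exact: measurable_digits].
  move=> w Qw; case: (pselect (`[0, 1[%classic w)) => h; last by right.
  by left; split => //; rewrite expr0 !divr1.
apply: (le_trans (measureU2 _ _ (measurableC m01))).
  by apply: measurableI; [exact: measurable_itv|exact: measurable_digits].
rewrite [X in (_ + X)%E](_ : _ = 0%E) ?adde0.
  apply: (le_trans (unif01_digits_itv_le 0 n Q 0)).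
  by rewrite expr0 invr1 mul1r.
apply/eqP; rewrite -measure_le0 /unif01 /= /uniform_prob integral_uniform_pdf.
rewrite (_ : _ `&` _ = [set 1]) ?integral_set1//.
apply/seteqP; split => x /=; rewrite !in_itv/=.
  move=> [/negP]; rewrite negb_and -ltNge -leNgt => /orP[|] x0 /andP[]; first lra.
  by move=> _ x1; apply/eqP; rewrite eq_le x1.
by move=> ->; rewrite ltxx andbF ler01 lexx; split.
Qed.

End DyadicDigits.

(** * A smooth bump *)

Section OneVariable.
Variable R : realType.
Implicit Types (f g : R -> R) (t x : R).

(** Class [C^k] on the line, with the derivatives given as functions: the chain and
    product rules produce them, and no derivability has to be carried along. *)
Fixpoint Ck_real (k : nat) f : Prop :=
  if k is k'.+1 then
    exists f', (forall x, is_derive x (1 : R) f (f' x)) /\ Ck_real k' f'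
  else continuous f.

Lemma is_derive_continuous f (f' : R) x : is_derive x (1 : R) f f' -> {for x, continuous f}.
Proof.
by move=> [df _]; apply: differentiable_continuous; apply/derivable1_diffP.
Qed.

Lemma Ck_real_continuous k f : Ck_real k f -> continuous f.
Proof. by case: k => // k [f' [df _]] x; apply: is_derive_continuous (df x). Qed.

Lemma Ck_realW k f : Ck_real k.+1 f -> Ck_real k f.
Proof.
elim: k f => [|k IH] f; first exact: Ck_real_continuous.
by move=> [f' [df /IH]]; exists f'.
Qed.

Lemma Ck_realD k f g : Ck_real k f -> Ck_real k g -> Ck_real k (fun x => f x + g x).
Proof.
elim: k f g => [|k IH] f g /=.
  by move=> cf cg x; apply: cvgD; [exact: cf|exact: cg].
move=> [f' [df cf]] [g' [dg cg]]; exists (fun x => f' x + g' x); split; last exact: IH.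
by move=> x; apply: is_deriveD.
Qed.

Lemma Ck_real_cst k (c : R) : Ck_real k (fun=> c).
Proof.
elim: k c => [|k IH] c /=; first by move=> x; exact: cvg_cst.
by exists (fun=> 0); split; [move=> x; exact: is_derive_cst|exact: IH].
Qed.

Lemma Ck_realM k f g : Ck_real k f -> Ck_real k g -> Ck_real k (fun x => f x * g x).
Proof.
elim: k f g => [|k IH] f g.
  by move=> cf cg x; apply: cvgM; [exact: cf|exact: cg].
move=> cf cg; move: (cf) (cg) => [f' [df cf']] [g' [dg cg']].
exists (fun x => f x * g' x + g x * f' x); split; last first.
  by apply: Ck_realD; apply: IH => //; exact: Ck_realW.
by move=> x; apply: is_deriveM.
Qed.

Lemma Ck_real_affine k f (a b : R) : Ck_real k f -> Ck_real k (fun x => f (a * x + b)).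
Proof.
have da x : is_derive x (1 : R) (fun x => a * x + b) a.
  have := @is_deriveD _ _ _ (fun x => a * x) (cst b) x 1 a 0 _ (is_derive_cst _ _ _).
  by rewrite addr0; apply; rewrite -[X in is_derive _ _ _ X]mulr1;
    exact: is_deriveZ.
elim: k f => [|k IH] f /=.
  move=> cf x; apply: (@continuous_comp _ _ _ (fun x => a * x + b) f x); last exact: cf.
  exact: is_derive_continuous (da x).
move=> [f' [df cf]]; exists (fun x => f' (a * x + b) * a); split.
  by move=> x; apply: (@is_derive1_comp _ f (fun x => a * x + b)).
by apply: Ck_realM; [exact: IH|exact: Ck_real_cst].
Qed.

(** All derivatives of the flat function [expR (- t^-1)] are combinations of
    these, so smoothness at the origin is proved once for the whole family. *)
Definition flat (n : nat) t : R := if 0 < t then (t ^+ n)^-1 * expR (- t^-1) else 0.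

Lemma flat_le n t : `|flat n t| <= n.+1`!%:R * `|t|.
Proof.
rewrite /flat; case: ltP => t0; last by rewrite normr0 mulr_ge0.
rewrite ger0_norm ?mulr_ge0 ?invr_ge0 ?exprn_ge0 ?expR_ge0 ?(ltW t0)//.
rewrite gtr0_norm// expRN -invfM.
rewrite -[leRHS]invrK lef_pV2 ?posrE ?mulr_gt0 ?invr_gt0 ?exprn_gt0 ?expR_gt0//;
  last by rewrite mulr_gt0 // ltr0n fact_gt0.
have ti : 0 <= t^-1 by rewrite invr_ge0 ltW.
have := expR_ge1Dxn n ti => h.
have h2 : (t^-1) ^+ n.+1 / n.+1`!%:R <= expR t^-1 by apply: le_trans h; rewrite lerDr.
have tn : 0 < t ^+ n by rewrite exprn_gt0.
rewrite -ler_pdivrMl//; apply: le_trans h2.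
rewrite le_eqVlt; apply/orP; left; apply/eqP; rewrite exprVn exprS; field.
by rewrite expf_neq0 ?gt_eqF//= pnatr_eq0 -lt0n fact_gt0.
Qed.

Lemma is_derive_flat n t :
  is_derive t (1 : R) (flat n) (- n%:R * flat n.+1 t + flat n.+2 t).
Proof.
have [t0|t0|->] := ltgtP t 0.
- apply: (near_eq_is_derive (f := cst 0)).
    near=> s; rewrite /flat ltNge ltW//=.
    by near: s; exact: lt_nbhsl.
  by rewrite /flat ltNge (ltW t0)/= mulr0 addr0; exact: is_derive_cst.
- have t0' : t != 0 by rewrite gt_eqF.
  apply: (@near_eq_is_derive R R^o R^o (fun s : R => (s ^+ n)^-1 * expR (- s^-1))).
    near=> s; rewrite /flat; suff -> : 0 < s by [].
    by near: s; exact: lt_nbhsr.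
  have d1 : is_derive t (1:R) (fun s => (s ^+ n)^-1) (- n%:R * (t ^+ n.+1)^-1).
    have dn : is_derive t (1 : R) (fun s : R => s ^+ n) (n%:R * t ^+ n.-1).
      apply: DeriveDef; first exact: exprn_derivable.
      by rewrite exp_derive /GRing.scale /= mulr1.
    have tn : t ^+ n != 0 by rewrite expf_neq0.
    apply: (is_derive_eq (@is_deriveV _ (fun s : R => s ^+ n) t _ 1 tn dn)); rewrite /GRing.scale /=.
    case: n dn tn => [|m] _ _; first by rewrite !mul0r/= !mulr0 oppr0 mul0r.
    by rewrite /= !exprS; field; rewrite t0' expf_neq0.
  have d2 : is_derive t (1 : R) (fun s : R => expR (- s^-1)) (expR (- t^-1) * (t ^+ 2)^-1).
    have di : is_derive t (1 : R) (fun s : R => - s^-1) ((t ^+ 2)^-1).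
      have := is_deriveN (@is_deriveV _ id t _ 1 t0' (is_derive_id t (1 : R))).
      by rewrite /GRing.scale /= mulr1 opprK.
    exact: (@is_derive1_comp _ expR (fun s : R => - s^-1)).
  apply: (is_derive_eq (is_deriveM d1 d2)); rewrite /GRing.scale /= /flat t0.
  by rewrite !exprS expr0; field; rewrite t0' expf_neq0.
- have flat0 m : flat m 0 = 0 by rewrite /flat ltxx.
  rewrite !flat0 mulr0 addr0.
  have lim0 : (fun h => h^-1 *: ((flat n \o shift 0) (h *: (1 : R)) - flat n 0)) @ 0^' --> (0 : R).
    apply/cvgrPdist_le => e e0; near=> h.
    have h0 : h != 0 by near: h; exact: nbhs_dnbhs_neq.
    rewrite sub0r normrN /= flat0 subr0 addr0 /GRing.scale /= mulr1.
    have -> : h^-1 * flat n h = flat n.+1 h.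
      by rewrite /flat; case: ifP => _; rewrite ?mulr0// exprS invfM mulrA.
    apply: (le_trans (flat_le _ _)); rewrite -ler_pdivlMl ?ltr0n ?fact_gt0//.
    near: h; apply: dnbhs0_le; rewrite mulr_gt0 ?invr_gt0 ?ltr0n ?fact_gt0//.
  apply: DeriveDef; first by apply/cvg_ex; exists 0.
  exact/cvg_lim.
Unshelve. all: by end_near. Qed.

Lemma Ck_real_flat k n : Ck_real k (flat n).
Proof.
elim: k n => [|k IH] n /=; first by move=> x; apply: is_derive_continuous (is_derive_flat n x).
exists (fun t => - n%:R * flat n.+1 t + flat n.+2 t); split; first exact: is_derive_flat.
by apply: Ck_realD => //; apply: Ck_realM => //; exact: Ck_real_cst.
Qed.

(** The support is away from the ends of the unit interval, so that consecutive pulses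
    are separated by quiet times and each is smooth across the ends of its slot. *)
Definition bump t : R := flat 0 (t - 1 / 4) * flat 0 (3 / 4 - t).

Lemma Ck_real_bump k : Ck_real k bump.
Proof.
apply: Ck_realM.
  by under [X in Ck_real _ X]eq_fun do rewrite -[X in X - _]mul1r; apply: Ck_real_affine; exact: Ck_real_flat.
under [X in Ck_real _ X]eq_fun do rewrite addrC -mulN1r; apply: Ck_real_affine; exact: Ck_real_flat.
Qed.

Lemma flat0_01 t : 0 <= flat 0 t <= 1.
Proof.
rewrite /flat; case: ltP => t0; last by rewrite lexx ler01.
by rewrite expr0 invr1 mul1r expR_ge0 expR_le1 oppr_le0 invr_ge0 ltW.
Qed.

Lemma bump_ge0 t : 0 <= bump t.
Proof. by apply: mulr_ge0; case/andP: (flat0_01 (t - 1 / 4)); case/andP: (flat0_01 (3 / 4 - t)). Qed.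

Lemma bump_le1 t : bump t <= 1.
Proof.
by apply: mulr_ile1; case/andP: (flat0_01 (t - 1 / 4)); case/andP: (flat0_01 (3 / 4 - t)).
Qed.

Lemma bump_out t : t <= 1 / 4 \/ 3 / 4 <= t -> bump t = 0.
Proof.
rewrite /bump /flat => -[h|h]; first by rewrite subr_gt0 ltNge h mul0r.
by rewrite mulrC subr_gt0 ltNge h mul0r.
Qed.

Lemma bump_ge t : 3 / 8 <= t <= 5 / 8 -> expR (- 16) <= bump t.
Proof.
have h x : 1 / 8 <= x -> expR (- 8) <= flat 0 x.
  move=> hx; rewrite /flat (lt_le_trans _ hx) ?divr_gt0// expr0 invr1 mul1r.
  rewrite ler_expR lerN2 -[leRHS]invrK lef_pV2 ?posrE ?invr_gt0//.
    by move: hx; rewrite mul1r.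
  by rewrite (lt_le_trans _ hx) ?divr_gt0.
move=> /andP[h1 h2]; rewrite (_ : - 16 = - 8 + - 8); last by lra.
by rewrite expRD ler_pM ?expR_ge0// h//; lra.
Qed.

End OneVariable.

(** * Smoothness of pulsed waves *)

Section DirectionalCalculus.
Variables (R : realType) (V W : normedModType R).
Implicit Types (f g : V -> W) (U : set V).

(** Smoothness may be checked on a model of the function near each point; the field is
    only locally given by a formula. *)
Lemma Ck_local k U f :
  (forall x, U x -> exists g U', [/\ open U', U' x, {in U', f =1 g} & Ck k U' g]) ->
  Ck k U f.
Proof.
elim: k U f => [|k IH] U f loc.
  split=> // x Ux; have [g [U' [oU' U'x fg [cg _]]]] := loc x Ux.
  suff : f @ x --> f x by []; rewrite (fg x (mem_set U'x)).
  apply: cvg_trans (cg x U'x); apply: near_eq_cvg.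
  by near=> y; apply/esym/fg/mem_set; near: y; exact: open_nbhs_nbhs.
split=> [x Ux|v].
  have [g [U' [oU' U'x fg [cg _]]]] := loc x Ux.
  suff : f @ x --> f x by []; rewrite (fg x (mem_set U'x)).
  apply: cvg_trans (cg x U'x); apply: near_eq_cvg.
  by near=> y; apply/esym/fg/mem_set; near: y; exact: open_nbhs_nbhs.
split=> [x Ux|].
  have [g [U' [oU' U'x fg [_ /(_ v)[dg _]]]]] := loc x Ux.
  apply: (@near_eq_derivable R V W g f) (dg _ U'x).
  by near=> y; apply/esym/fg/mem_set; near: y; exact: open_nbhs_nbhs.
apply: IH => x Ux; have [g [U' [oU' U'x fg [_ /(_ v)[_ cg]]]]] := loc x Ux.
exists ('D_v g), U'; split => // y /set_mem U'y.
by apply: near_eq_derive; near=> z; apply/fg/mem_set; near: z; exact: open_nbhs_nbhs.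
Unshelve. all: by end_near. Qed.

Lemma eq_in_Ck k U f g : open U -> {in U, f =1 g} -> Ck k U g -> Ck k U f.
Proof. by move=> oU fg cg; apply: Ck_local => x Ux; exists g, U. Qed.

Lemma CkD k U f g : open U -> Ck k U f -> Ck k U g -> Ck k U (fun x => f x + g x).
Proof.
elim: k f g => [|k IH] f g oU.
  move=> [cf _] [cg _]; split => // x Ux; apply: cvgD; [exact: cf|exact: cg].
move=> [cf df] [cg dg]; split.
  by move=> x Ux; apply: cvgD; [exact: cf|exact: cg].
move=> v; have [df1 df2] := df v; have [dg1 dg2] := dg v; split.
  by move=> x Ux; apply: derivableD; [exact: df1|exact: dg1].
apply: (eq_in_Ck oU _ (IH _ _ oU df2 dg2)) => x /set_mem Ux.
by apply: deriveD; [exact: df1|exact: dg1].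
Qed.

(** This reduces a directional derivative to a derivative at the origin in one
    variable, for the functions of interest, which have a constant direction. *)
Lemma is_derive_lineZ (c : V -> R) (w : W) (p v : V) (d : R) :
  is_derive (0 : R) (1 : R) (fun h : R => c (h *: v + p)) d ->
  is_derive p v (fun q => c q *: w) (d *: w).
Proof.
move=> [/cvg_ex[/= l dl] dE].
have {dE} ld : l = d by rewrite -dE; apply/esym/cvg_lim.
rewrite {}ld in dl.
have lim0 : (fun h => h^-1 *: (((fun q => c q *: w) \o shift p) (h *: v) - c p *: w)) @ 0^' --> d *: w.
  apply: cvg_trans (cvgZr_tmp (a := w) dl).
  apply: near_eq_cvg; near=> h => /=.
  rewrite -scalerBl scalerA; congr (_ * (_ - _) *: _) => /=.
    by rewrite /GRing.scale /= mulr1 addr0.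
  by rewrite scale0r add0r.
by apply: DeriveDef; [apply/cvg_ex; exists (d *: w)|exact/cvg_lim].
Unshelve. all: by end_near. Qed.

End DirectionalCalculus.

Section PulsedWave.
Variable R : realType.
Local Notation plane := 'rV[R]_2.
Implicit Types (theta : R -> R) (lam phi : R) (e : 'I_2) (w : plane).

Definition pulsed_wave theta lam phi e w (p : R^o * plane) : plane :=
  (theta p.1 * cos (lam * p.2 0 e + phi)) *: w.

(** Derivatives of pulsed waves are sums of pulsed waves, with one derivative on the
    pulse or a phase shifted by a quarter turn: hence smoothness by induction. *)
Lemma is_derive_pulsed_wave theta (theta' : R) lam phi e w (p v : R^o * plane) :
  is_derive p.1 (1 : R) theta theta' ->
  is_derive p v (pulsed_wave theta lam phi e w)
    (pulsed_wave (fun=> v.1 * theta') lam phi e w p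
     + pulsed_wave (fun t => - (lam * v.2 0 e) * theta t) lam (phi - pi / 2) e w p).
Proof.
move=> dt; rewrite /pulsed_wave -scalerDl; apply: is_derive_lineZ.
have da (a b : R) : is_derive (0 : R) (1 : R) (fun h : R => h * a + b) a.
  have := @is_deriveD _ _ _ (fun x : R => x * a) (cst b) 0 1 a 0 _ (is_derive_cst _ _ _).
  rewrite addr0; apply; under eq_fun do rewrite mulrC.
  by rewrite -[X in is_derive _ _ _ X]mulr1; exact: is_deriveZ.
have dth : is_derive (0 : R) (1 : R) (fun h : R => theta (h * v.1 + p.1)) (theta' * v.1).
  apply: (@is_derive1_comp _ theta (fun h : R => h * v.1 + p.1)).
  by rewrite mul0r add0r.
have dc : is_derive (0 : R) (1 : R) (fun h : R => cos (h * (lam * v.2 0 e) + (lam * p.2 0 e + phi)))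
   (- sin (lam * p.2 0 e + phi) * (lam * v.2 0 e)).
  apply: (@is_derive1_comp _ cos (fun h : R => h * (lam * v.2 0 e) + (lam * p.2 0 e + phi))).
  by rewrite mul0r add0r; exact: is_derive_cos.
have := is_deriveM dth dc; rewrite !mul0r !add0r => h.
rewrite (_ : (fun _ => _) = (fun h : R => theta (h * v.1 + p.1))
  * (fun h : R => cos (h * (lam * v.2 0 e) + (lam * p.2 0 e + phi)))); last first.
  apply/funext => k /=; rewrite !mxE (_ : lam * _ + phi = k * (lam * v.2 0 e) + (lam * p.2 0 e + phi))//; ring.
apply: (is_derive_eq h); rewrite /GRing.scale /= addrA cosBpihalf; ring.
Qed.

Lemma continuous_pulsed_wave theta lam phi e w :
  continuous theta -> continuous (pulsed_wave theta lam phi e w).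
Proof.
move=> ct p; apply: cvgZr_tmp; apply: cvgM.
  apply: (@continuous_comp _ _ _ fst theta p); last exact: ct.
  exact: cvg_fst.
apply: (@continuous_comp _ _ _ (fun p : R^o * plane => lam * p.2 0 e + phi) (@cos R) p);
  last exact: continuous_cos.
apply: cvgD; last exact: cvg_cst.
apply: cvgMl_tmp.
apply: (@continuous_comp _ _ _ (@snd R^o plane) (fun x : plane => x 0 e) p).
  exact: cvg_snd.
exact: coord_continuous.
Qed.

Lemma Ck_pulsed_wave k theta lam phi e w (U : set (R^o * plane)) : open U ->
  Ck_real k theta -> Ck k U (pulsed_wave theta lam phi e w).
Proof.
move=> oU; elim: k theta phi => [|k IH] theta phi.
  by move=> ct; split => // x _; exact: continuous_pulsed_wave.
move=> ct; split; first by move=> x _; apply: continuous_pulsed_wave; exact: Ck_real_continuous ct.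
move=> v; have [theta' [dt ct']] := ct; split.
  by move=> x _; case: (is_derive_pulsed_wave lam phi e w v (dt x.1)).
apply: (@eq_in_Ck _ _ _ k U _ (fun p => pulsed_wave (fun t => v.1 * theta' t) lam phi e w p
     + pulsed_wave (fun t => - (lam * v.2 0 e) * theta t) lam (phi - pi / 2) e w p)) => //.
  by move=> p _; case: (is_derive_pulsed_wave lam phi e w v (dt p.1)).
apply: CkD => //; apply: IH; (apply: Ck_realM; first exact: Ck_real_cst); [exact: ct'|exact: Ck_realW].
Qed.

End PulsedWave.

(** * Integrals over the plane *)

Section PlaneIntegrals.
Variable R : realType.
Local Notation plane := 'rV[R]_2.
Implicit Types (h : plane -> R).

Lemma pair_rowE (p : R * R) :
  pair_row p = p.1 *: delta_mx 0 0 + p.2 *: delta_mx 0 1.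
Proof.
apply/rowP => i; rewrite !mxE eqxx /=.
by case: i => -[|[|//]] i2 /=; rewrite ?mulr1 ?mulr0 ?addr0 ?add0r.
Qed.

Lemma continuous_pair_row1 (y : R) : continuous (fun x : R^o => pair_row (x, y) : plane).
Proof.
move=> x; rewrite (_ : (fun x => _) = fun x => x *: delta_mx 0 0 + y *: delta_mx 0 1).
  by apply: cvgD; apply: cvgZr_tmp; [exact: cvg_id|exact: cvg_cst].
by apply/funext => q; exact: pair_rowE.
Qed.

Lemma continuous_pair_row2 (x : R) : continuous (fun y : R^o => pair_row (x, y) : plane).
Proof.
move=> y; rewrite (_ : (fun y => _) = fun y => x *: delta_mx 0 0 + y *: delta_mx 0 1).
  by apply: cvgD; apply: cvgZr_tmp; [exact: cvg_cst|exact: cvg_id].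
by apply/funext => q; exact: pair_rowE.
Qed.

(** The first coordinate is rounded to a finer and finer grid, which exhibits
    a continuous function as a limit of functions that are measurable for the
    product structure. *)
Lemma measurable_pair_row h : continuous h ->
  measurable_fun [set: measurableTypeR R * measurableTypeR R] (h \o @pair_row R).
Proof.
move=> ch.
pose grid n (x : R) : R := (Num.truncn (n.+1%:R * x + n.+1%:R * n%:R))%:R / n.+1%:R - n%:R.
apply: (@measurable_fun_cvg _ _ _ setT (fun n p => h (pair_row (grid n p.1, p.2)))).
  move=> n _ /= B mB; rewrite setTI.
  rewrite (_ : _ @^-1` B = \bigcup_k
    ([set x | Num.truncn (n.+1%:R * x + n.+1%:R * n%:R) = k] `*`
     [set y | B (h (pair_row (k%:R / n.+1%:R - n%:R, y)))])).
    apply: bigcupT_measurable => k; apply: measurableX.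
      rewrite (_ : [set _ | _] = [set x | (Num.truncn (n.+1%:R * x + n.+1%:R * n%:R) == k)]).
        by apply: (measurable_truncn _ (fun m => m == k)).
      by apply/seteqP; split => x /= /eqP.
    rewrite -[X in measurable X]setTI.
    apply: continuous_measurable_fun => // y.
    apply: (@continuous_comp _ _ _ (fun y : R^o => pair_row (_, y) : plane) h); last exact: ch.
    exact: continuous_pair_row2.
  apply/seteqP; split => [[x y] /= Bh|[x y] [k _ [/= <-]]] //.
  by exists (Num.truncn (n.+1%:R * x + n.+1%:R * n%:R)).
move=> [x y] _ /=.
apply: (@cvg_comp _ _ _ (fun n => pair_row (grid n x, y)) h _ (nbhs (pair_row (x, y)))); last exact: ch.
apply: (@cvg_comp _ _ _ (fun n => grid n x) (fun z : R^o => pair_row (z, y)) _ (nbhs (x : R^o))); last first.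
  exact: continuous_pair_row1.
apply/cvgrPdist_le => e e0; near=> n.
have n0 : 0 < n.+1%:R :> R by [].
have z0 : 0 <= n.+1%:R * x + n.+1%:R * n%:R.
  rewrite -mulrDr mulr_ge0// -lerBlDl sub0r; apply: (le_trans (ler_norm _)); rewrite normrN.
  near: n; exact: nbhs_infty_ger.
have /andP[t1 t2] := truncn_itv z0.
rewrite /grid; set k := (Num.truncn _)%:R in t1 *.
have t2' : n.+1%:R * x + n.+1%:R * n%:R < k + 1 by rewrite natr1.
have -> : x - (k / n.+1%:R - n%:R) = (n.+1%:R * x + n.+1%:R * n%:R - k) / n.+1%:R.
  by field; rewrite gt_eqF.
rewrite ger0_norm ?divr_ge0 ?subr_ge0// ler_pdivrMr//.
apply: (@le_trans _ _ 1); first by lra.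
rewrite mulrC -ler_pdivrMr// div1r -natr1.
apply: (@le_trans _ _ n%:R); last by rewrite lerDl.
near: n; exact: nbhs_infty_ger.
Unshelve. all: by end_near. Qed.

Definition supported_in (M : R) h := forall (x : plane) i, M < `|x 0 i| -> h x = 0.

Lemma compactly_supported_bounded M h : continuous h -> supported_in M h ->
  exists C : R, 0 <= C /\ forall x, `|h x| <= C.
Proof.
move=> ch sh; pose K := [set x : plane | forall i, x ord0 i \in `[(- `|M|), `|M|]].
have cK : compact K.
  apply: (@rV_compact _ _ (fun=> `[(- `|M|), `|M|]%classic)).
  by move=> _; apply: segment_compact.
have K0 : K !=set0 by exists 0 => i; rewrite mxE in_itv/= oppr_le0 normr_ge0.
have cn : {within K, continuous (fun x => `|h x| : R)}.
  apply: continuous_subspaceT => x.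
  exact: (@continuous_comp _ _ _ h (fun z : R => `|z|) x (ch x) (@norm_continuous _ _ _)).
have [c _ cmax] := EVT_max_rV K0 cK cn.
exists `|h c|; split => // x.
have [/asboolP Kx|/asboolPn/existsNP[i /negP]] := boolP `[< forall i, x ord0 i \in `[(- `|M|), `|M|] >].
  by apply: cmax; exact: mem_set.
rewrite in_itv/= -ler_norml -ltNge => xi.
by rewrite (sh x i) ?normr0//; apply: le_lt_trans xi; exact: ler_norm.
Qed.

Lemma integrable_pair_row M h : continuous h -> supported_in M h ->
  (@lebesgue2 R).-integrable setT (fun p => (h (pair_row p))%:E).
Proof.
move=> ch sh; have [C [C0 hC]] := compactly_supported_bounded ch sh.
pose K := `[(- `|M|), `|M|]%classic : set R.
have mK : measurable (K `*` K : set (measurableTypeR R * measurableTypeR R)).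
  by apply: measurableX; exact: measurable_itv.
apply: (@le_integrable _ _ _ (@lebesgue_measure R \x @lebesgue_measure R)%E setT measurableT (EFin \o (h \o @pair_row R)) (fun p => (C * \1_(K `*` K) p)%:E)) => //.
- by apply/measurable_EFinP; exact: measurable_pair_row.
- move=> [x y] _; rewrite [in leRHS]/= !abse_EFin lee_fin (ger0_norm (x := C * _)) ?mulr_ge0//=.
  have [Kxy|nKxy] := pselect ((K `*` K) (x, y)).
    by rewrite indicE mem_set// mulr1 hC.
  rewrite indicE memNset// mulr0 (_ : h _ = 0) ?normr0//.
  have [Kx|nKx] := pselect (K x).
    have nKy : ~ K y by move=> Ky; apply: nKxy.
    apply: (sh _ 1); rewrite mxE /=; move/negP: nKy; rewrite in_itv/= -ler_norml -ltNge.
    by apply: le_lt_trans; exact: ler_norm.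
  apply: (sh _ 0); rewrite mxE /=; move/negP: nKx; rewrite in_itv/= -ler_norml -ltNge.
  by apply: le_lt_trans; exact: ler_norm.
- under eq_fun do rewrite EFinM.
  apply: integrableZl => //; apply/integrableP; split; first exact/measurable_EFinP.
  under eq_integral do rewrite gee0_abs ?lee_fin//.
  rewrite integral_indic// setIT.
  rewrite /= product_measure1E//; try exact: measurable_itv.
  have KE : @lebesgue_measure R K \is a fin_num.
    by rewrite /K lebesgue_measure_itv /=; case: ifP.
  by apply: lte_mul_pinfty => //; rewrite -ge0_fin_numE.
Qed.

Lemma integral_derivative0 (G g : R -> R) (M : R) : continuous g ->
  (forall t, is_derive t (1 : R) G (g t)) ->
  (forall t, M < `|t| -> G t = 0) -> (forall t, M < `|t| -> g t = 0) ->
  (\int[@lebesgue_measure R]_t (g t)%:E = 0)%E.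
Proof.
move=> cg dG G0 g0; pose K := `|M| + 1.
have K0 : 0 < K by rewrite ltr_wpDl.
have KK : - K < K by rewrite ltrNl (lt_trans _ K0)// oppr_lt0.
have MK : M < K by rewrite (le_lt_trans (ler_norm _))// ltrDl.
rewrite (_ : integral _ _ _ = \int[lebesgue_measure]_(x in `[(- K)%R, K]) (g x)%:E)%E.
  have cG : continuous G by move=> t; apply: is_derive_continuous (dG t).
  rewrite (@continuous_FTC2 _ g G)//.
  - by rewrite !G0 ?normrN ?gtr0_norm// subee.
  - exact: continuous_subspaceT.
  - split.
    + by move=> t _; case: (dG t).
    + by apply: cvg_at_right_filter; exact: cG.
    + by apply: cvg_at_left_filter; exact: cG.
  - by move=> t _; rewrite derive1E; case: (dG t).
rewrite [RHS]integral_mkcond; apply: eq_integral => t _; rewrite patchE.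
case: ifPn => //; rewrite notin_setE /= in_itv/= => /negP; rewrite -ler_norml -ltNge => Kt.
by rewrite g0// (lt_trans MK).
Qed.

Lemma cvg_coord (e : 'I_2) (x : plane) : (y : plane) 0 e @[y --> x] --> (x 0 e : R).
Proof. exact: coord_continuous. Qed.

Lemma pair_row_line (e : 'I_2) (t y : R) (p := if e == 0 then (t, y) else (y, t)) (h0 : R) :
  h0 *: delta_mx 0 e + pair_row p
  = pair_row (if e == 0 then (h0 + t, y) else (y, h0 + t)) :> plane.
Proof.
apply/rowP => i; rewrite /p {p} !mxE eqxx/=.
by case: e => -[|[|//]] e2; case: i => -[|[|//]] i2 /=;
  rewrite ?mulr1 ?mulr0 ?addr0 ?add0r.
Qed.

(** By Fubini the integral is first taken along [e], where it vanishes by the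
    fundamental theorem of calculus. *)
Lemma Rintegral_partial0 (e : 'I_2) M H h : continuous h ->
  (forall x, is_derive x (delta_mx 0 e) H (h x)) ->
  supported_in M H -> supported_in M h ->
  \int[@lebesgue2 R]_p (h (pair_row p)) = 0.
Proof.
move=> ch dH sH sh.
have ih := integrable_pair_row ch sh.
have line t y : is_derive t (1 : R)
    (fun s => H (pair_row (if e == 0 then (s, y) else (y, s))))
    (h (pair_row (if e == 0 then (t, y) else (y, t)))).
  have [d1 d2] := dH (pair_row (if e == 0 then (t, y) else (y, t))).
  move: d1 d2; rewrite /derivable /derive /= => d1 d2.
  have E : (fun s : R => s^-1 *: (((fun s => H (pair_row (if e == 0 then (s, y) else (y, s))))
      \o shift t) (s *: (1 : R)) - H (pair_row (if e == 0 then (t, y) else (y, t)))))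
     = (fun s : R => s^-1 *: (H (s *: delta_mx 0 e + pair_row (if e == 0 then (t, y) else (y, t)))
          - H (pair_row (if e == 0 then (t, y) else (y, t))))).
    by apply/funext => s /=; rewrite pair_row_line /GRing.scale /= mulr1.
  by apply: DeriveDef; rewrite /derivable /derive E.
have sup (f : plane -> R) (y t : R) : supported_in M f -> M < `|t| ->
    f (pair_row (if e == 0 then (t, y) else (y, t))) = 0.
  move=> sf Mt; apply: (sf _ e); rewrite mxE.
  by case: (e =P 0).
have inner y : (\int[@lebesgue_measure R]_t
    (h (pair_row (if e == 0 then (t, y) else (y, t))))%:E = 0)%E.
  apply: (@integral_derivative0 (fun s => H (pair_row (if e == 0 then (s, y) else (y, s)))) _ M).
  - move=> t; case: (e == 0).
      apply: (@continuous_comp _ _ _ (fun x : R^o => pair_row (x, y) : plane) h); last exact: ch.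
      exact: continuous_pair_row1.
    apply: (@continuous_comp _ _ _ (fun x : R^o => pair_row (y, x) : plane) h); last exact: ch.
    exact: continuous_pair_row2.
  - by move=> t Mt; apply: sup.
  - by move=> t Mt; apply: sup.
rewrite /Rintegral; suff -> : (\int[@lebesgue2 R]_p (h (pair_row p))%:E = 0)%E by [].
have [e0|e1] := eqVneq e 0.
  rewrite -(integral21_prod_meas1 ih); under eq_integral do rewrite /fubini_G.
  by apply: integral0_eq => y _; have := inner y; rewrite e0 eqxx.
rewrite -(integral12_prod_meas1 ih); under eq_integral do rewrite /fubini_F.
by apply: integral0_eq => y _; have := inner y; rewrite (negbTE e1).
Qed.

End PlaneIntegrals.

(** * Norms of plane waves *)

Section WaveNorms.
Variable R : realType.
Local Notation plane := 'rV[R]_2.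
Implicit Types (lam phi : R) (e : 'I_2).

Lemma cos_lipschitz (x y : R) : `|cos x - cos y| <= `|x - y|.
Proof.
wlog xy : x y / x <= y => [h|].
  by have [/h//|/ltW/h] := leP x y; rewrite distrC (distrC y).
have [|z _ E] := @MVT_segment R cos (fun t => - sin t) x y xy (fun t _ => is_derive_cos t).
  by apply: continuous_subspaceT => t; exact: continuous_cos.
rewrite distrC E normrM normrN (distrC x) ler_piMl//.
by rewrite ler_norml sin_geN1 sin_le1.
Qed.

Lemma tnorm_ge0 (I : finType) (a : I -> R) : 0 <= tnorm a.
Proof. exact: sqrtr_ge0. Qed.

Lemma tnormZ (I : finType) (a : I -> R) (k : R) : tnorm (fun i => a i * k) = tnorm a * `|k|.
Proof.
rewrite /tnorm -[in RHS](sqrtr_sqr k) -sqrtrM ?sumr_ge0//; last by move=> i _; rewrite sqr_ge0.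
by congr Num.sqrt; rewrite mulr_suml; apply: eq_bigr => i _; rewrite exprMn.
Qed.

Lemma enorm_coord (x : plane) e : `|x 0 e| <= enorm x.
Proof.
rewrite /enorm /tnorm -sqrtr_sqr ler_wsqrtr// (bigD1 e)//= lerDl sumr_ge0// => i _.
exact: sqr_ge0.
Qed.

Lemma enorm_gt0 (x : plane) : x != 0 -> 0 < enorm x.
Proof.
move=> x0; have [i xi] : exists i, x 0 i != 0.
  apply/existsP; apply: contraR x0; rewrite negb_exists => /forallP h.
  by apply/eqP/rowP => i; rewrite mxE; apply/eqP; have := h i; rewrite negbK.
by apply: lt_le_trans (enorm_coord x i); rewrite normr_gt0.
Qed.

(** Interpolation: with [d] the phase difference, the increment is at most [d] and at
    most [2], hence at most [2 d^a]. *)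
Lemma wave_holder_increment (lam phi a : R) e (x y : plane) : 0 <= lam -> 0 <= a < 1 ->
  `|cos (lam * x 0 e + phi) - cos (lam * y 0 e + phi)|
  <= 2 * lam `^ a * enorm (x - y) `^ a.
Proof.
move=> l0 /andP[a0 a1].
have e0 : 0 <= enorm (x - y) by exact: tnorm_ge0.
rewrite -mulrA -powRM//.
apply: (@le_trans _ _ (2 * `|lam * (x 0 e - y 0 e)| `^ a)); last first.
  rewrite ler_pM2l//; apply: ge0_ler_powR; rewrite ?nnegrE ?mulr_ge0//.
  rewrite normrM ger0_norm// ler_wpM2l//.
  by have := enorm_coord (x - y) e; rewrite !mxE.
set d := `|lam * _|.
have d0 : 0 <= d by exact: normr_ge0.
have [d1|d1] := lerP d 1.
  apply: (@le_trans _ _ d).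
    apply: (le_trans (cos_lipschitz _ _)).
    by rewrite (_ : _ - _ = lam * (x 0 e - y 0 e)) //; ring.
  move: d0; rewrite le_eqVlt => /predU1P[<-|d0]; first by rewrite mulr_ge0// powR_ge0.
  apply: (@le_trans _ _ (d `^ a)); first by apply: ger1_powR; rewrite ?d0 ?d1// ltW.
  by rewrite ler_peMl ?powR_ge0// ler1n.
apply: (@le_trans _ _ 2).
  apply: (le_trans (ler_normB _ _)); rewrite (_ : 2 = 1 + 1)//.
  by apply: lerD; rewrite ler_norml cos_geN1 cos_le1.
rewrite ler_peMr// -[leLHS](powRr0 d); apply: ler_powR => //; exact: ltW.
Qed.

Definition wave (I : finType) (c : I -> R) lam phi e (x : plane) (i : I) : R :=
  c i * cos (lam * x 0 e + phi).

Lemma continuous_wave_phase lam phi e : continuous (fun x : plane => cos (lam * x 0 e + phi) : R^o).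
Proof.
move=> x.
apply: (@continuous_comp _ _ _ (fun x : plane => lam * x 0 e + phi) (@cos R) x);
  last exact: continuous_cos.
have h1 : (fun y : plane => lam * y 0 e) @ x --> lam * x 0 e.
  exact: (cvgMl_tmp (@cvg_coord R e x)).
exact: (cvgD h1 (cvg_cst phi)).
Qed.

Lemma holder_norm_wave (I : finType) (c : I -> R) lam phi e (a : R) :
  0 <= lam -> 0 <= a < 1 ->
  (holder_norm a (wave c lam phi e) <= (tnorm c * (1 + 2 * lam `^ a))%:E)%E.
Proof.
move=> l0 a01; have c0 := tnorm_ge0 c.
have sup_le : (sup_norm (wave c lam phi e) <= (tnorm c)%:E)%E.
  apply: ge_ereal_sup => _ [x _ <-]; rewrite lee_fin tnormZ ler_piMr//.
  by rewrite ler_norml cos_geN1 cos_le1.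
have semi_le : (holder_seminorm a (wave c lam phi e) <= (tnorm c * (2 * lam `^ a))%:E)%E.
  apply: ge_ereal_sup => _ [[x y] /= xy <-]; rewrite lee_fin.
  have -> : tnorm (fun i => wave c lam phi e x i - wave c lam phi e y i)
      = tnorm c * `|cos (lam * x 0 e + phi) - cos (lam * y 0 e + phi)|.
    by rewrite -tnormZ /wave; congr tnorm; apply/funext => i; rewrite mulrBr.
  rewrite ler_pdivrMr ?powR_gt0 ?enorm_gt0 ?subr_eq0//.
  by rewrite -mulrA ler_wpM2l// wave_holder_increment.
rewrite /holder_norm; case: ifP => _.
  rewrite /C0_norm; case: ifPn => [_|/negP[]].
    apply: (le_trans sup_le); rewrite lee_fin ler_peMr// lerDl mulr_ge0// powR_ge0.
    done.
  apply/asboolP => i x; rewrite /wave.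
  exact: (cvgMl_tmp (a := c i) (@continuous_wave_phase lam phi e x)).
apply: (le_trans (leeD sup_le semi_le)).
by rewrite -EFinD lee_fin mulrDr mulr1.
Qed.

Lemma test_function_supported (f : plane -> R^o) : test_function f ->
  continuous f /\ exists M, supported_in M f.
Proof.
move=> [sf [M Mf]]; split; first by move=> x; case: (sf 0%N) => cf _; exact: cf.
exists M => x i Mx; apply: Mf; exact: lt_le_trans Mx (enorm_coord x i).
Qed.

Lemma supported_in_derive (f : plane -> R^o) (v : plane) M :
  supported_in M f -> supported_in M ('D_v f).
Proof.
move=> sf x i Mx; rewrite (@near_eq_derive _ _ _ f (cst 0)) ?derive_cst//.
have cx : continuous (fun y : plane => `|y 0 i|).
  by move=> y; exact: (cvg_norm (@cvg_coord R i y)).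
near=> y; apply: (sf y i); near: y.
exact: (cx x _ (lt_nbhsr Mx)).
Unshelve. all: by end_near. Qed.

Lemma test_function_derive (f : plane -> R^o) (v : plane) : test_function f ->
  (forall x, is_derive x v f ('D_v f x)) /\ continuous ('D_v f).
Proof.
move=> [sf _]; have [_ /(_ v)[df [cf _]]] := sf 1%N; split => x.
  by apply: derivableP; exact: df.
exact: cf.
Qed.

Lemma is_derive_wave (c lam phi : R) e (x : plane) :
  is_derive x (delta_mx 0 e) (fun x : plane => c * cos (lam * x 0 e + (phi - pi / 2)) : R^o)
    (c * lam * cos (lam * x 0 e + phi)).
Proof.
have dc : is_derive (0 : R) (1 : R) (fun h : R => c * sin (h * lam + (lam * x 0 e + phi)))
   (c * (cos (lam * x 0 e + phi) * lam)).
  apply: is_deriveZ.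
  apply: (@is_derive1_comp _ (@sin R) (fun h : R => h * lam + (lam * x 0 e + phi))).
    by rewrite mul0r add0r; exact: is_derive_sin.
  have := @is_deriveD _ _ _ (fun x : R => x * lam) (cst (lam * x 0 e + phi)) 0 1 lam 0 _ (is_derive_cst _ _ _).
  rewrite addr0; apply; under eq_fun do rewrite mulrC.
  by rewrite -[X in is_derive _ _ _ X]mulr1; exact: is_deriveZ.
have := @is_derive_lineZ R _ R^o (fun x : plane => c * cos (lam * x 0 e + (phi - pi / 2)))
  1 x (delta_mx 0 e) (c * (cos (lam * x 0 e + phi) * lam)).
rewrite /GRing.scale /= mulr1 => h.
have -> : c * lam * cos (lam * x 0 e + phi) = c * (cos (lam * x 0 e + phi) * lam) by ring.
rewrite [X in is_derive _ _ X _](_ : _ = (fun q : plane =>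
    c * cos (lam * q 0 e + (phi - pi / 2)) * 1)); last first.
  by apply/funext => q; rewrite mulr1.
apply: h.
rewrite (_ : (fun h : R => _) = (fun h : R => c * sin (h * lam + (lam * x 0 e + phi))))//.
apply/funext => h; rewrite !mxE !eqxx /= mulr1 addrA cosBpihalf; congr (_ * sin _); ring.
Qed.

(** Integration by parts turns a wave into [lam^-1] times the divergence of a
    wave with shifted phase: each negative order gains a factor [lam^-1]. *)
Lemma of_fun_wave_parts (c lam phi : R) e (f : plane -> R^o) : lam != 0 ->
  test_function f ->
  of_fun (fun x : plane => c * cos (lam * x 0 e + phi)) f
  = - of_fun (fun x : plane => c / lam * cos (lam * x 0 e + (phi - pi / 2)))
        ('D_(delta_mx 0 e) f).
Proof.
move=> l0 tf; have [cf [M sf]] := test_function_supported tf.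
have [df cdf] := test_function_derive (delta_mx 0 e) tf.
have sdf := supported_in_derive (delta_mx 0 e) sf.
pose h1 (x : plane) := c * cos (lam * x 0 e + phi) * f x.
pose h2 (x : plane) := c / lam * cos (lam * x 0 e + (phi - pi / 2)) * 'D_(delta_mx 0 e) f x.
have cw (k psi : R) : continuous (fun x : plane => k * cos (lam * x 0 e + psi) : R).
  by move=> x; exact: (cvgMl_tmp (a := k) (@continuous_wave_phase lam psi e x)).
have ch1 : continuous h1 by move=> x; exact: (cvgM (@cw c phi x) (cf x)).
have ch2 : continuous h2 by move=> x; exact: (cvgM (@cw _ _ x) (cdf x)).
have sh1 : supported_in M h1 by move=> x i Mx; rewrite /h1 (sf _ _ Mx) mulr0.
have sh2 : supported_in M h2 by move=> x i Mx; rewrite /h2 (sdf _ _ Mx) mulr0.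
apply/eqP; rewrite -addr_eq0 /of_fun; apply/eqP.
have := RintegralD measurableT (integrable_pair_row ch1 sh1) (integrable_pair_row ch2 sh2).
rewrite /= => <-.
have := @Rintegral_partial0 R e M
  (fun x : plane => c / lam * cos (lam * x 0 e + (phi - pi / 2)) * f x)
  (fun x : plane => h1 x + h2 x); apply.
- by move=> x; exact: (cvgD (ch1 x) (ch2 x)).
- move=> x.
  apply: (is_derive_eq (is_deriveM (is_derive_wave (c / lam) lam phi e x) (df x))).
  rewrite /h1 /h2 /GRing.scale /= divfK// addrC; congr (_ + _); exact: mulrC.
- by move=> x i Mx; rewrite (sf _ _ Mx) mulr0.
- by move=> x i Mx; rewrite (sh1 x i Mx) (sh2 x i Mx) addr0.
Qed.

(** A divergence is over vector fields with one more index.  The wave is the divergence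
    of the field whose only nonzero component is along [e], so that the Euclidean norm
    of the coefficients is divided by [lam] and by nothing else. *)
Lemma neg_norm_wave k (I : finType) (c : I -> R) lam phi e (a : R) :
  0 < lam -> 0 <= a < 1 ->
  (neg_norm k a (fun i => of_fun (fun x => wave c lam phi e x i))
   <= (tnorm c / lam ^+ k * (1 + 2 * lam `^ a))%:E)%E.
Proof.
move=> l0 a01; elim: k I c phi => [|k IH] I c phi /=.
  rewrite expr0 divr1; apply: le_trans (holder_norm_wave c phi e (ltW l0) a01).
  by apply: ereal_inf_lbound; exists (wave c lam phi e).
pose c' (ij : I * 'I_2) : R := if ij.2 == e then c ij.1 / lam else 0.
have c'E : tnorm c' = tnorm c / lam.
  rewrite -[in RHS](gtr0_norm l0) -normfV -tnormZ /tnorm; congr Num.sqrt.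
  transitivity (\sum_i \sum_j c' (i, j) ^+ 2).
    by rewrite pair_big /=; apply: eq_bigr => -[].
  apply: eq_bigr => i _; rewrite (bigD1 e)//= /c' /= eqxx big1 ?addr0// => j je.
  by rewrite (negbTE je) expr0n.
have := IH _ c' (phi - pi / 2); rewrite c'E -[_ / lam / _]mulrA -invfM -exprS.
apply: le_trans; apply: ereal_inf_lbound.
exists (fun ij => of_fun (fun x => wave c' lam (phi - pi / 2) e x ij)) => //.
move=> i f tf /=; rewrite (@of_fun_wave_parts (c i) _ phi e f (lt0r_neq0 l0) tf).
congr (- _); rewrite (bigD1 e)//= big1 ?addr0.
  by rewrite /wave /c' /= eqxx.
move=> j je; rewrite /of_fun /wave /c' /= (negbTE je).
by rewrite (eq_Rintegral _ (g := cst 0)) ?Rintegral_cst ?mul0r// => x _; rewrite !mul0r.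
Qed.

Lemma locally_integrable_wave (c lam phi : R) e :
  Defs.locally_integrable (fun x : plane => c * cos (lam * x 0 e + phi)).
Proof.
move=> f tf; have [cf [M sf]] := test_function_supported tf.
apply: (@integrable_pair_row R M (fun x : plane => c * cos (lam * x 0 e + phi) * f x)).
  move=> x; apply: cvgM (cf x).
  exact: (cvgMl_tmp (a := c) (@continuous_wave_phase lam phi e x)).
by move=> x i Mx; rewrite (sf _ _ Mx) mulr0.
Qed.

Definition shear_wave (c lam phi : R) e e' (x : plane) : plane :=
  (c * cos (lam * x 0 e + phi)) *: delta_mx 0 e'.

Lemma shear_wave_coord c lam phi e e' (x : plane) i :
  shear_wave c lam phi e e' x 0 i = wave (fun i => c * (i == e')%:R) lam phi e x i.
Proof. by rewrite /shear_wave /wave !mxE eqxx /= mulrAC. Qed.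

Lemma tnorm_delta (c : R) (e' : 'I_2) : tnorm (fun i => c * (i == e')%:R) = `|c|.
Proof.
rewrite /tnorm (bigD1 e')//= eqxx mulr1 big1 ?addr0 ?sqrtr_sqr// => i ie.
by rewrite (negbTE ie) mulr0 expr0n.
Qed.

(** The sizes [lam^a] at the fractional order and [lam^-k] for [k] integrations by
    parts multiply to [lam^s]; the constant [3] absorbs the sup norm as [lam >= 1]. *)
Lemma Cs_norm_shear_wave (s c lam phi : R) e e' : s < 1 -> 1 <= lam ->
  (Cs_norm s (shear_wave c lam phi e e') <= (3 * `|c| * lam `^ s)%:E)%E.
Proof.
move=> s1 l1; have l0 : 0 < lam by exact: lt_le_trans l1.
have fE i : (fun x => shear_wave c lam phi e e' x 0 i)
    = (fun x => wave (fun i => c * (i == e')%:R) lam phi e x i).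
  by apply/funext => x; exact: shear_wave_coord.
have fin k (a : R) : 0 <= a -> s = a - k%:R ->
    tnorm (fun i => c * (i == e')%:R) / lam ^+ k * (1 + 2 * lam `^ a)
    <= 3 * `|c| * lam `^ s.
  move=> a0 sE; rewrite tnorm_delta.
  have -> : lam `^ s = lam `^ a / lam ^+ k.
    by rewrite sE powRB ?powR_mulrn ?(ltW l0)// (gt_eqF l0) implybT.
  have la : 1 <= lam `^ a by rewrite -[leLHS](powRr0 lam) ler_powR.
  have ck : 0 <= `|c| / lam ^+ k by rewrite divr_ge0// exprn_ge0// ltW.
  have -> : 3 * `|c| * (lam `^ a / lam ^+ k) = `|c| / lam ^+ k * (3 * lam `^ a) by ring.
  by rewrite ler_wpM2l//; lra.
rewrite /Cs_norm; case: ifPn => [s0|]; last rewrite -ltNge => s0.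
  have -> : (fun x => shear_wave c lam phi e e' x 0)
      = wave (fun i => c * (i == e')%:R) lam phi e.
    by apply/funext => x; apply/funext => i; exact: shear_wave_coord.
  apply: (le_trans (holder_norm_wave _ _ _ (ltW l0) _)); first by rewrite s0.
  by rewrite lee_fin; have := fin 0%N s s0; rewrite subr0 expr0 divr1; apply.
case: asboolP => [_|[]]; last first.
  by move=> i; rewrite fE; exact: locally_integrable_wave.
rewrite (_ : (fun i => of_fun _) =
  fun i => of_fun (fun x => wave (fun i => c * (i == e')%:R) lam phi e x i)); last first.
  by apply/funext => i; rewrite fE.
have fl0 : Num.floor s < 0 by rewrite floor_lt0.
have flE : (Num.floor s)%:~R = - (`|Num.floor s|%N)%:R :> R.
  by rewrite -[X in X%:~R]opprK -(ltz0_abs fl0) mulrNz.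
have a01 : 0 <= s - (Num.floor s)%:~R < 1.
  by rewrite subr_ge0 floor_le ltrBlDr addrC -intrD1 floorD1_gt.
apply: (le_trans (neg_norm_wave _ _ _ _ l0 a01)).
rewrite lee_fin; apply: fin; first by case/andP: a01.
by rewrite flE opprK addrK.
Qed.

End WaveNorms.

(** * The random field *)

Section Schedule.
Variable R : realType.

(** The number of pulses of a block: each of [nf] frequencies is used in [2 * nr]
    pairs, and a pair consists of a cosine and a sine. *)
Definition pulses (nf nr : nat) : nat := (2 * (nf * (2 * nr)))%N.

Record schedule := Schedule {
  amp : nat -> R;
  dur : nat -> R;
  nfreq : nat -> nat;
  nrep : nat -> nat;
  amp_ge0 : forall k, 0 <= amp k;
  dur_gt0 : forall k, 0 < dur k;
  pulses_fit : forall k,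
    (pulses (nfreq k) (nrep k))%:R * dur k <= (2 ^+ k.+1)^-1 }.

Variable S : schedule.
Local Notation plane := 'rV[R]_2.
Implicit Types (b : nat -> bool) (k j : nat) (t : R).

Definition ell k : R := (2 ^+ (k ^ 2))^-1.
Definition block_time k : R := (2 ^+ k)^-1.

Definition npulse k : nat := pulses (nfreq S k) (nrep S k).

(** The differences with the base frequency are dyadic: at a separation [h > 0] with
    [2^i <= h / ell k < 2^(i + 1)], the phases of the base frequency and of number
    [i + 1] differ by an angle in the second quadrant. *)
Definition freq k (i : nat) : R :=
  (if i is i'.+1 then 1 + pi / 2 / 2 ^+ i' else 1) / ell k.

Definition pulse_freq k j : R := freq k (j./2 %% nfreq S k).

(** Cosines and sines alternate: two angles which are far apart on the circle have
    different cosines or different sines. *)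
Definition pulse_phase j : R := if odd j then - (pi / 2) else 0.

(** The shear of block [k] is transverse to [axis k] and moves [axis k.+1], which is
    the transverse axis of block [k - 1], the next one in time. *)
Definition axis k : 'I_2 := if odd k then 1 else 0.

Definition pulse_start k j : R := block_time k.+1 + j%:R * dur S k.

Definition in_pulse k j t : Prop :=
  (j < npulse k)%N /\ pulse_start k j < t < pulse_start k j + dur S k.

Definition offset k : nat := (\sum_(i < k) npulse i)%N.

Definition pulse_amp b k j t : R :=
  amp S k * bit_sign R (b (offset k + j)%N) * bump ((t - pulse_start k j) / dur S k).

Definition pulse b k j t : plane -> plane :=
  shear_wave (pulse_amp b k j t) (pulse_freq k j) (pulse_phase j)
    (axis k) (axis k.+1).

(** At any time at most one pulse is active ([in_pulse_unique]). *)
Definition field b t : plane -> plane :=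
  let kj := xget (0%N, 0%N) [set kj | in_pulse kj.1 kj.2 t] in
  if `[< in_pulse kj.1 kj.2 t >] then pulse b kj.1 kj.2 t else fun=> 0.

Lemma block_time_gt0 k : 0 < block_time k. Proof. by rewrite invr_gt0 exprn_gt0. Qed.

Lemma block_timeS k : block_time k = block_time k.+1 + block_time k.+1.
Proof. by rewrite /block_time exprS; field; rewrite expf_neq0. Qed.

Lemma block_time_le k k' : (k <= k')%N -> block_time k' <= block_time k.
Proof. by move=> kk; rewrite /block_time lef_pV2 ?posrE ?exprn_gt0// ler_eXn2l// ltr1n. Qed.

Lemma ell_gt0 k : 0 < ell k. Proof. by rewrite invr_gt0 exprn_gt0. Qed.

Lemma ell_le1 k : ell k <= 1.
Proof. by rewrite invf_le1 ?exprn_gt0// exprn_ege1// ler1n. Qed.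

Lemma freq_bounds k i : (ell k)^-1 <= freq k i <= 3 / ell k.
Proof.
have e0 : 0 < (ell k)^-1 by rewrite invr_gt0 ell_gt0.
rewrite -{1}[(ell k)^-1]mul1r /freq !ler_pM2r//; case: i => [|i]; first by rewrite lexx ler1n.
have i0 : 0 < 2 ^+ i :> R by rewrite exprn_gt0.
have /andP[p1 p2] := @pihalf_02 R.
rewrite lerDl divr_ge0 ?(ltW i0) ?(ltW p1)//=.
suff : pi / 2 / 2 ^+ i <= (2 : R) by lra.
apply: (le_trans _ (ltW p2)); rewrite ler_pdivrMr// ler_peMr ?(ltW p1)//.
by rewrite exprn_ege1// ler1n.
Qed.

Lemma pulse_freq_ge1 k j : 1 <= pulse_freq k j.
Proof.
by case/andP: (freq_bounds k (j./2 %% nfreq S k)) => + _; apply: le_trans;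
  rewrite invf_ge1 ?ell_gt0 ?ell_le1.
Qed.

Lemma natSl n (x : R) : n%:R * x + x = n.+1%:R * x.
Proof. by rewrite -natr1 mulrDl mul1r. Qed.

Lemma in_pulse_block k j t : in_pulse k j t -> block_time k.+1 < t < block_time k.
Proof.
move=> [jk /andP[t1 t2]]; rewrite (le_lt_trans _ t1)/=; last first.
  by rewrite lerDl mulr_ge0// ltW// dur_gt0.
apply: (lt_le_trans t2); rewrite /pulse_start [leRHS]block_timeS -addrA lerD2l.
apply: le_trans (pulses_fit S k); rewrite natSl -/(npulse k).
by rewrite ler_pM2r ?dur_gt0// ler_nat.
Qed.

Lemma block_unique k k' t : block_time k.+1 < t < block_time k -> block_time k'.+1 < t < block_time k' -> k = k'.
Proof.
move=> /andP[a b] /andP[c d]; apply/eqP; rewrite eqn_leq; apply/andP; split.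
  rewrite leqNgt; apply/negP => /block_time_le h; have := lt_trans (lt_le_trans b h) c; by rewrite ltxx.
rewrite leqNgt; apply/negP => /block_time_le h; have := lt_trans (lt_le_trans d h) a; by rewrite ltxx.
Qed.

Lemma in_pulse_unique k j k' j' t : in_pulse k j t -> in_pulse k' j' t -> (k, j) = (k', j').
Proof.
move=> h h'; have E := block_unique (in_pulse_block h) (in_pulse_block h').
rewrite -E in h' *; move: h h' => [_ /andP[a b]] [_ /andP[c d]].
congr pair; apply/eqP; rewrite eqn_leq; apply/andP; split; rewrite leqNgt; apply/negP => jj.
  have := lt_trans a d; rewrite /pulse_start -addrA ltrD2l natSl ltr_pM2r ?dur_gt0// ltr_nat.
  by rewrite ltnS leqNgt jj.
have := lt_trans c b; rewrite /pulse_start -addrA ltrD2l natSl ltr_pM2r ?dur_gt0// ltr_nat.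
by rewrite ltnS leqNgt jj.
Qed.

Lemma field_pulse b k j t : in_pulse k j t -> field b t = pulse b k j t.
Proof.
move=> h; rewrite /field; case: xgetP => [[k' j'] /= _ h'|/(_ (k, j))//].
by rewrite asboolT//; case: (in_pulse_unique h h') => -> ->.
Qed.

Lemma field0 b t : (forall k j, ~ in_pulse k j t) -> field b t = fun=> 0.
Proof. by move=> h; rewrite /field asboolF. Qed.

Lemma fieldP b t :
  (exists k j, in_pulse k j t /\ field b t = pulse b k j t)
  \/ ((forall k j, ~ in_pulse k j t) /\ field b t = fun=> 0).
Proof.
case: (pselect (exists k j, in_pulse k j t)) => [[k [j h]]|h].
  by left; exists k, j; split => //; exact: field_pulse.
have h' k j : ~ in_pulse k j t by move=> hk; apply: h; exists k, j.
by right; split => //; exact: field0.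
Qed.

Lemma shear_wave0 lam phi e e' : shear_wave 0 lam phi e e' = (fun=> 0 : plane).
Proof. by apply/funext => x; rewrite /shear_wave mul0r scale0r. Qed.

(** A description of the field at a fixed time which covers quiet times by taking
    [c = 0]. *)
Lemma field_shear b t : exists c k lam phi,
  [/\ field b t = shear_wave c lam phi (axis k) (axis k.+1), `|c| <= amp S k,
      (ell k)^-1 <= lam <= 3 / ell k & (block_time k.+1 < t < block_time k \/ c = 0)].
Proof.
case: (fieldP b t) => [[k [j [h ->]]]|[_ ->]].
  exists (pulse_amp b k j t), k, (pulse_freq k j), (pulse_phase j); split => //.
  - rewrite /pulse_amp 2!normrM (ger0_norm (amp_ge0 S k)) (ger0_norm (bump_ge0 _)).
    rewrite (_ : `|bit_sign _ _| = 1) ?mulr1 ?ler_piMr ?amp_ge0 ?bump_le1//.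
    by rewrite /bit_sign; case: (b _); rewrite ?normrN normr1.
  - exact: freq_bounds.
  - by left; exact: in_pulse_block h.
exists 0, 0%N, (freq 0 0), 0; split; [by rewrite shear_wave0| |exact: freq_bounds|by right].
by rewrite normr0 amp_ge0.
Qed.

Lemma Cs_norm_field (a : R) b t : a < 1 ->
  (forall k lam, (ell k)^-1 <= lam <= 3 / ell k -> 3 * amp S k * lam `^ a <= 2) ->
  (Cs_norm a (field b t) <= 2%:E)%E.
Proof.
move=> a1 hA; have [c [k [lam [phi [-> cA lam_k _]]]]] := field_shear b t.
have l1 : 1 <= lam.
  by case/andP: lam_k => + _; apply: le_trans; rewrite invf_ge1 ?ell_gt0 ?ell_le1.
apply: (le_trans (Cs_norm_shear_wave _ _ _ _ a1 l1)); rewrite lee_fin.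
apply: le_trans (hA k lam lam_k).
by rewrite -!mulrA ler_pM2l// ler_wpM2r// powR_ge0.
Qed.

Lemma field_block b k t : block_time k.+1 <= t <= block_time k ->
  exists c lam phi, field b t = shear_wave c lam phi (axis k) (axis k.+1).
Proof.
move=> /andP[t1 t2]; case: (fieldP b t) => [[k' [j [h ->]]]|[_ ->]]; last first.
  by exists 0, 0, 0; rewrite shear_wave0.
have /andP[h1 h2] := in_pulse_block h.
suff -> : k = k' by exists (pulse_amp b k' j t), (pulse_freq k' j), (pulse_phase j).
apply/eqP; rewrite eqn_leq; apply/andP; split; rewrite leqNgt; apply/negP => /block_time_le h3.
  by have := le_lt_trans (le_trans t2 h3) h1; rewrite ltxx.
by have := lt_le_trans h2 (le_trans h3 t1); rewrite ltxx.
Qed.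

Lemma Ck_real_pulse_amp n b k j : Ck_real n (pulse_amp b k j).
Proof.
apply: Ck_realM; first exact: Ck_real_cst.
rewrite (_ : (fun _ => _) = (fun t => bump ((dur S k)^-1 * t + - (pulse_start k j / dur S k)))).
  by apply: Ck_real_affine; exact: Ck_real_bump.
by apply/funext => t; congr bump; rewrite mulrBl mulrC.
Qed.

Lemma pulse_amp0 b k j t : ~ (1 / 4 < (t - pulse_start k j) / dur S k < 3 / 4) ->
  pulse_amp b k j t = 0.
Proof.
move=> /negP; rewrite negb_and -!leNgt => /orP h.
by rewrite /pulse_amp bump_out ?mulr0.
Qed.

Lemma block_time_cvg0 (e : R) : 0 < e -> exists K, block_time K < e.
Proof.
move=> e0; pose K := Num.truncn (e^-1); exists K.
rewrite /block_time -[ltRHS]invrK ltf_pV2 ?posrE ?invr_gt0 ?exprn_gt0//.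
apply: (lt_le_trans (truncnS_gt _)); rewrite -natrX ler_nat; exact: ltn_expl.
Qed.

Lemma dur_min K : exists2 r : R, 0 < r & forall k, (k <= K)%N -> r <= dur S k.
Proof.
elim: K => [|K [r r0 IH]].
  by exists (dur S 0); [exact: dur_gt0|move=> k; rewrite leqn0 => /eqP ->].
exists (Num.min r (dur S K.+1)); first by rewrite lt_min r0 dur_gt0.
move=> k; rewrite leq_eqVlt => /predU1P[->|kK]; first by rewrite ge_min lexx orbT.
by rewrite ge_min IH.
Qed.

(** Pulses vanish near the ends of their time slots and the slots accumulate
    only at time zero, so at positive times the field is locally one pulse. *)
Lemma field_local b t0 : 0 < t0 ->
  exists theta lam phi e e' r,
    [/\ 0 < r, 1 <= lam, forall n, Ck_real n theta &
        forall t, `|t - t0| < r -> field b t = shear_wave (theta t) lam phi e e'].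
Proof.
move=> t00; case: (fieldP b t0) => [[k [j [[jk /andP[h1 h2]] _]]]|[h0 _]].
  exists (pulse_amp b k j), (pulse_freq k j), (pulse_phase j), (axis k), (axis k.+1).
  exists (Num.min (t0 - pulse_start k j) (pulse_start k j + dur S k - t0)); split.
  - by rewrite lt_min !subr_gt0 h1.
  - exact: pulse_freq_ge1.
  - by move=> n; exact: Ck_real_pulse_amp.
  move=> t; rewrite lt_min !ltr_norml => /andP[/andP[a _] /andP[_ d]].
  by apply: field_pulse; split => //; apply/andP; split; lra.
have [K hK] := block_time_cvg0 (divr_gt0 t00 (ltr0n R 2)).
have [r r0 hr] := dur_min K.
exists (fun=> 0), 1, 0, 0, 0, (Num.min (t0 / 2) (r / 4)); split.
- by rewrite lt_min !divr_gt0.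
- exact: lexx.
- by move=> n; exact: Ck_real_cst.
move=> t; rewrite lt_min => /andP[a c]; rewrite shear_wave0.
case: (fieldP b t) => [[k [j [h ->]]]|[_ ->]//].
rewrite /pulse pulse_amp0 ?shear_wave0//; apply/negP; apply/negP => /andP[g1 g2].
have /andP[k1 k2] := in_pulse_block h.
have d0 := dur_gt0 S k.
have kK : (k <= K)%N.
  rewrite leqNgt; apply/negP => Kk; have := block_time_le (ltnW Kk).
  by move: a; rewrite ltr_norml => /andP[a _] tk; lra.
have rk := hr k kK.
move: g1 g2; rewrite ltr_pdivlMr// ltr_pdivrMr// => g1 g2.
have : ~ in_pulse k j t0 by exact: h0.
apply; split; first by case: h.
by move: c; rewrite ltr_norml => /andP[c1 c2]; apply/andP; split; lra.
Qed.

Lemma field_continuous b (t0 : R) (x0 : plane) : 0 < t0 ->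
  {for (t0, x0), continuous (fun p : R^o * plane => field b p.1 p.2)}.
Proof.
move=> /(field_local b)[theta [lam [phi [e [e' [r [r0 _ ct hf]]]]]]].
have := @continuous_pulsed_wave R theta lam phi e (delta_mx 0 e') (Ck_real_continuous (ct 0%N)) (t0, x0).
rewrite /prop_for /continuous_at /= (hf t0) ?subrr ?normr0//; apply: cvg_trans.
have /cvgrPdistC_lt/(_ r r0) near_t0 : (fst : R^o * plane -> R^o) @ (t0, x0) --> (t0 : R^o).
  exact: cvg_fst.
apply: near_eq_cvg; near=> p => /=; rewrite hf//.
by near: p.
Unshelve. all: by end_near. Qed.

End Schedule.

(** * Smoothness, measurability and integrability in time *)

Section FieldRegularity.
Variables (R : realType) (S : schedule R).
Local Notation plane := 'rV[R]_2.
Implicit Types (b : nat -> bool) (t : R).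

Lemma smooth_loc_field b : smooth_loc (field S b).
Proof.
exists (fun p => field S b p.1 p.2); split => // k; apply: Ck_local => -[t0 x0] /= t00.
have [theta [lam [phi [e [e' [r [r0 _ ct hf]]]]]]] := field_local S b t00.
exists (pulsed_wave theta lam phi e (delta_mx 0 e')), [set p | `|p.1 - t0| < r].
have oU : open [set p : R^o * plane | `|p.1 - t0| < r].
  apply: (@open_comp _ _ (fun p : R^o * plane => `|p.1 - t0| : R) [set y | y < r]);
    last exact: open_lt.
  move=> p _.
  have h1 : (fun p : R^o * plane => p.1 - t0 : R^o) @ p --> (p.1 - t0 : R^o).
    exact: (cvgB (cvg_fst : _ --> (p.1 : R^o)) (cvg_cst (t0 : R^o))).
  exact: (cvg_norm h1).
split => //; first by rewrite /= subrr normr0.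
  by move=> p /set_mem /= pr; rewrite hf.
by apply: Ck_pulsed_wave.
Qed.

Lemma random_field_field : random_field (fun w : measurableTypeR R => field S (fun n => digit n w)).
Proof.
move=> t x i _.
case: (pselect (exists k j, in_pulse S k j t)) => [[k [j h]]|h]; last first.
  rewrite (_ : (fun w => _) = cst 0); first exact: measurable_cst.
  apply/funext => w; rewrite field0 ?mxE// => k j hk; apply: h; by exists k, j.
pose v c := shear_wave (amp S k * bit_sign R c * bump ((t - pulse_start S k j) / dur S k))
   (pulse_freq S k j) (pulse_phase R j) (axis k) (axis k.+1) x 0 i.
rewrite (_ : (fun w => _) = (fun w => if digit (offset S k + j) w then v true else v false)).
  apply: measurable_fun_ifT; [|exact: measurable_cst|exact: measurable_cst].
  by apply: (measurable_fun_bool true); rewrite setTI; exact: measurable_digit.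
apply/funext => w; rewrite (field_pulse _ h) /pulse /pulse_amp /v; by case: digit.
Qed.

Lemma Cs_norm0_shear_wave (c lam phi : R) e e' : 1 <= lam ->
  (Cs_norm 0 (shear_wave c lam phi e e') <= (3 * `|c|)%:E)%E.
Proof.
by move=> l1; have := Cs_norm_shear_wave c phi e e' (@ltr01 R) l1; rewrite powRr0 mulr1.
Qed.

Lemma Cs_norm0_ge0 (f : plane -> plane) : (0 <= Cs_norm 0 f)%E.
Proof.
rewrite /Cs_norm lexx /holder_norm eqxx /C0_norm; case: ifP => // _.
apply: ereal_sup_ge; exists (tnorm (f 0 0))%:E; last by rewrite lee_fin tnorm_ge0.
by exists 0.
Qed.

(** The cap at [2^n] leaves finitely many values at arbitrary times, as a simple
    function needs. *)
Definition sampled_field b (n : nat) t : plane -> plane :=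
  field S b ((minn (Num.truncn (2 ^+ n * t)) (2 ^ n))%:R / 2 ^+ n).

Lemma simple_sampled_field b n : simple_C0 (sampled_field b n).
Proof.
split.
- apply: (@sub_finite_set _ _ ((fun m => field S b (m%:R / 2 ^+ n)) @` `I_(2 ^ n).+1)).
    move=> _ [t _ <-]; exists (minn (Num.truncn (2 ^+ n * t)) (2 ^ n)) => //=.
    by rewrite ltnS geq_minr.
  exact: (finite_image _ (finite_II _)).
- move=> f; rewrite (_ : _ @^-1` _ = [set t : measurableTypeR R |
     (fun m => `[< field S b ((minn m (2 ^ n))%:R / 2 ^+ n) = f >])
       (Num.truncn (2 ^+ n * t + 0))]).
    by apply: (@measurable_truncn R (2 ^+ n) 0 (fun m =>
      `[< field S b ((minn m (2 ^ n))%:R / 2 ^+ n) = f >])); rewrite exprn_gt0.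
  by apply/seteqP; split => t /=; rewrite addr0 => /asboolP.
move=> t; rewrite /sampled_field.
have [c [k [lam [phi [-> cA /andP[lam_k _] _]]]]] := field_shear S b
  ((minn (Num.truncn (2 ^+ n * t)) (2 ^ n))%:R / 2 ^+ n).
apply: (le_lt_trans (Cs_norm0_shear_wave _ _ _ _ _)); last exact: ltry.
by apply: le_trans lam_k; rewrite invf_ge1 ?ell_gt0 ?ell_le1.
Qed.

Lemma field_at0 b : field S b 0 = fun=> 0.
Proof.
apply: field0 => k j /in_pulse_block /andP[h _].
by have := lt_trans (block_time_gt0 R k.+1) h; rewrite ltxx.
Qed.

Lemma cvg_dyadic_grid t : 0 <= t <= 1 ->
  ((minn (Num.truncn (2 ^+ n * t)) (2 ^ n))%:R / 2 ^+ n : R) @[n --> \oo] --> t.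
Proof.
move=> /andP[t0 t1]; apply/cvgrPdist_le => e e0.
have [K hK] := block_time_cvg0 e0; near=> n.
have Kn : (K <= n)%N by near: n; exact: nbhs_infty_ge.
have p0 : 0 < 2 ^+ n :> R by rewrite exprn_gt0.
have x0 : 0 <= 2 ^+ n * t by rewrite mulr_ge0// ltW.
have /andP[a1 a2] := truncn_itv x0.
have le2 : (Num.truncn (2 ^+ n * t) <= 2 ^ n)%N.
  rewrite -(ler_nat R); apply: (le_trans a1); rewrite natrX ler_piMr//; exact: ltW.
rewrite (minn_idPl le2); set m := (Num.truncn _)%:R in a1 *.
have -> : t - m / 2 ^+ n = (2 ^+ n * t - m) / 2 ^+ n by field; rewrite gt_eqF.
rewrite ger0_norm ?divr_ge0 ?subr_ge0 ?(ltW p0)//.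
apply: (@le_trans _ _ (block_time R n)).
  rewrite /block_time -[leRHS]mul1r ler_pM2r ?invr_gt0// lerBlDl natr1 ltW//.
exact: le_trans (block_time_le R Kn) (ltW hK).
Unshelve. all: by end_near. Qed.

(** Near a positive time the field is a fixed wave with an amplitude that depends
    continuously on time, so that the difference is a wave of small amplitude. *)
Lemma sampled_field_cvg b t : 0 <= t <= 1 ->
  Cs_norm 0 (fun x => field S b t x - sampled_field b n t x) @[n --> \oo] --> 0%E.
Proof.
move=> t01; have [->|t0] := eqVneq t 0.
  apply: cvg_near_cst; near=> n; rewrite /sampled_field mulr0 truncn0 min0n mul0r field_at0.
  apply/eqP; rewrite eq_le Cs_norm0_ge0 andbT.
  rewrite (_ : (fun x => _) = shear_wave (0 : R) 1 0 0 0); last first.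
    by rewrite shear_wave0; apply/funext => x; rewrite subr0.
  by apply: (le_trans (Cs_norm0_shear_wave _ _ _ _ (lexx 1))); rewrite normr0 mulr0.
have tpos : 0 < t by rewrite lt_neqAle eq_sym t0; case/andP: t01.
have [theta [lam [phi [e [e' [r [r0 l1 ct hf]]]]]]] := field_local S b tpos.
pose g n : R := (minn (Num.truncn (2 ^+ n * t)) (2 ^ n))%:R / 2 ^+ n.
have gt : g n @[n --> \oo] --> t by exact: cvg_dyadic_grid.
have lim : (3 * `|theta t - theta (g n)|) @[n --> \oo] --> (0 : R).
  have -> : 0 = 3 * `|theta t - theta t| :> R by rewrite subrr normr0 mulr0.
  have h : theta (g n) @[n --> \oo] --> theta t.
    by apply: continuous_cvg => //; exact: (Ck_real_continuous (ct 0%N)).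
  exact: (cvgMl_tmp (cvg_norm (cvgB (cvg_cst (theta t)) h))).
apply: (@squeeze_cvge _ _ _ _ (cst 0%E) _ (fun n => (3 * `|theta t - theta (g n)|)%:E)).
- near=> n; rewrite Cs_norm0_ge0 /=.
  rewrite (_ : (fun x => _) = shear_wave (theta t - theta (g n)) lam phi e e').
    exact: Cs_norm0_shear_wave.
  apply/funext => x; rewrite /sampled_field (hf t) ?subrr ?normr0//.
  rewrite hf; first by rewrite /shear_wave -scalerBl -mulrBl.
  by near: n; move/cvgrPdistC_lt : gt => /(_ _ r0).
- exact: cvg_cst.
- by apply: cvg_EFin => //; near=> n.
Unshelve. all: by end_near. Qed.

(** The integral of a nonnegative function is a supremum over the simple functions
    below it, and so it is monotone over arbitrary functions; the norm of the field as a
    function of time is compared in this way with a measurable series. *)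
Lemma ge0_le_integral_any (D : set (measurableTypeR R)) (f g : R -> \bar R) :
  (forall x, 0 <= f x)%E -> (forall x, f x <= g x)%E ->
  (\int[@lebesgue_measure R]_(x in D) f x <= \int[@lebesgue_measure R]_(x in D) g x)%E.
Proof.
move=> f0 fg; have g0 x : (0 <= g x)%E by exact: le_trans (f0 x) (fg x).
rewrite !ge0_integralE//; apply: le_ereal_sup => _ [h hf <-]; exists h => // x.
apply: (le_trans (hf x)); rewrite !patchE; by case: ifP.
Qed.

(** The norm is dominated by a series of step functions, one for each block, supported
    by the active part of the block, whose integrals sum to at most [C]. *)
Lemma L1_C0_field b (C : R) : 0 <= C ->
  (forall k, 3 * amp S k * ((npulse S k)%:R * dur S k) <= C / (2 ^ k.+1)%:R) ->
  L1_C0 (field S b).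
Proof.
move=> C0 hC; split.
  exists (sampled_field b); split; first exact: simple_sampled_field.
  by apply: aeW => t; exact: sampled_field_cvg.
pose I k : set (measurableTypeR R) := `]block_time R k.+1, (block_time R k.+1 + (npulse S k)%:R * dur S k)[%classic.
have mI k : measurable (I k) by exact: measurable_itv.
pose g k (t : measurableTypeR R) : \bar R := (3 * amp S k * \1_(I k) t)%:E.
have g0 k t : (0 <= g k t)%E by rewrite lee_fin !mulr_ge0 ?amp_ge0.
have mg k : measurable_fun setT (g k).
  by apply/measurable_EFinP; apply: measurable_funM.
apply: (@le_lt_trans _ _ (\int[@lebesgue_measure R]_(t in `[0%R, 1%R]) (\sum_(k <oo) g k t))%E).
  apply: ge0_le_integral_any => t; first exact: Cs_norm0_ge0.
  case: (fieldP S b t) => [[k [j [h fE]]]|[_ ->]]; last first.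
    rewrite -(shear_wave0 1 0 0 0).
    apply: (le_trans (Cs_norm0_shear_wave _ _ _ _ (lexx 1))).
    by rewrite normr0 mulr0; exact: nneseries_ge0.
  have It : I k t.
    rewrite /I /= in_itv /=; case: (in_pulse_block h) => /andP[-> _] /=.
    case: h => jk /andP[_ h2]; apply: (lt_le_trans h2).
    by rewrite /pulse_start -addrA lerD2l natSl ler_pM2r ?dur_gt0// ler_nat.
  apply: (@le_trans _ _ (g k t)).
    rewrite fE; apply: (le_trans (Cs_norm0_shear_wave _ _ _ _ _)).
      exact: pulse_freq_ge1.
    rewrite /g indicE mem_set// mulr1 lee_fin ler_pM2l//.
    rewrite /pulse_amp 2!normrM (ger0_norm (amp_ge0 S k)) (ger0_norm (bump_ge0 _)).
    rewrite (_ : `|bit_sign _ _| = 1) ?mulr1 ?ler_piMr ?amp_ge0 ?bump_le1//.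
    by rewrite /bit_sign; case: (b _); rewrite ?normrN normr1.
  rewrite (@nneseriesD1 _ (fun k => g k t) k xpredT)//.
  by rewrite leeDl// nneseries_ge0.
rewrite integral_nneseries//; last by move=> k; exact: measurable_funTS.
apply: (@le_lt_trans _ _ (\sum_(k <oo) (C / (2 ^ k.+1)%:R)%:E)%E); last first.
  by apply: (le_lt_trans (epsilon_trick0 _ C0)); exact: ltry.
apply: lee_nneseries => [k _ _|k _]; first by apply: integral_ge0.
apply: (@le_trans _ _ (\int[@lebesgue_measure R]_t g k t)%E).
  by apply: ge0_subset_integral => //.
rewrite /g; under eq_integral do rewrite EFinM.
rewrite ge0_integralZl//; last by rewrite lee_fin mulr_ge0 ?amp_ge0.
  rewrite integral_indic// setIT.
  apply: (@le_trans _ _ ((3 * amp S k)%:E * @lebesgue_measure R (I k))%E) => //.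
  rewrite /I lebesgue_measure_itv /= lte_fin.
  case: ifP => _; last by rewrite mule0 lee_fin divr_ge0.
  rewrite -EFinD -EFinM lee_fin addrAC subrr add0r; exact: hC.
exact/measurable_EFinP.
Qed.

End FieldRegularity.

(** * Flows of shears *)

Section ShearFlow.
Variable R : realType.
Local Notation plane := 'rV[R]_2.
Local Notation mu := (@lebesgue_measure R).
Implicit Types (u : R -> plane -> plane) (W X Y : R -> plane) (s c t T : R) (y : plane).

Lemma integrable_within (f : R -> R) s t : {within `[s, t], continuous f} ->
  mu.-integrable `[s, t] (EFin \o f).
Proof.
by move=> cf; apply: continuous_compact_integrable => //; exact: segment_compact.
Qed.

Lemma Rintegral_split (f : R -> R) s c t : s <= c <= t ->
  {within `[s, t], continuous f} ->
  \int[mu]_(r in `[s, t]) f r = \int[mu]_(r in `[s, c]) f r + \int[mu]_(r in `[c, t]) f r.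
Proof.
move=> /andP[sc ct] /integrable_within fi.
have := @Rintegral_itvB R f (BLeft s) (BRight t) c fi.
rewrite !bnd_simp => /(_ sc ct) /eqP; rewrite subr_eq addrC => /eqP ->.
congr (_ + _); apply: Rintegral_itv_obnd_cbnd.
apply: integrableS fi => //; apply: subset_itv; rewrite ?bnd_simp//.
Qed.

(** Solutions up to time [T]; [is_solution] is the case [T = 1]. *)
Definition solves u W s y T X : Prop :=
  {within `[s, T], continuous X} /\
  forall t, s <= t <= T ->
    X t = y + (\row_(i < 2) \int[mu]_(r in `[s, t]) (u r (X r) 0 i)) + (W t - W s).

Definition jointly_continuous u : Prop := forall t0 x0, 0 < t0 ->
  {for (t0, x0), continuous (fun p : R^o * plane => u p.1 p.2)}.

Lemma within_coord (A : set R) X (i : 'I_2) : {within A, continuous X} ->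
  {within A, continuous (fun r => X r 0 i)}.
Proof.
move=> /subspace_continuousP cX; apply/subspace_continuousP => r Ar.
exact: (cvg_comp _ _ (cX r Ar) (@coord_continuous _ _ _ 0 i (X r))).
Qed.

Lemma within_field u X s T (i : 'I_2) : jointly_continuous u -> 0 < s ->
  {within `[s, T], continuous X} ->
  {within `[s, T], continuous (fun r => u r (X r) 0 i)}.
Proof.
move=> cu s0 cX; apply: (within_coord (X := fun r => u r (X r))).
move/subspace_continuousP : cX => cX; apply/subspace_continuousP => r sr.
have r0 : 0 < r by apply: lt_le_trans s0 _; move: sr; rewrite /= in_itv/= => /andP[].
have h1 : (fun q : R => (q : R^o)) @ within `[s, T] (nbhs r) --> (r : R^o).
  by move=> A nA; apply: filterS nA => q Aq _.
have h : (fun q => (q : R^o, X q)) @ within `[s, T] (nbhs r) --> (r : R^o, X r).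
  exact: (cvg_pair h1 (cX r sr)).
exact: (cvg_comp _ _ h (cu r (X r) r0)).
Qed.

Lemma solves_start u W s y T X : s <= T -> solves u W s y T X -> X s = y.
Proof.
move=> sT [_ /(_ s)]; rewrite lexx sT => /(_ isT) ->.
rewrite subrr addr0; apply/rowP => i; rewrite !mxE set_itv1 Rintegral_set1 addr0 //.
Qed.

Lemma sub_itvcc s t s' t' : s <= s' -> t' <= t -> `[s', t']%classic `<=` (`[s, t]%classic : set R).
Proof. by move=> ss tt; apply: subset_itv; rewrite bnd_simp. Qed.

Lemma solves_shorten u W s y c T X : c <= T -> solves u W s y T X -> solves u W s y c X.
Proof.
move=> cT [cX hX]; split.
  by apply: continuous_subspaceW cX; exact: sub_itvcc.
by move=> t /andP[st tc]; apply: hX; rewrite st (le_trans tc).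
Qed.

Lemma solves_restart u W s y c T X : jointly_continuous u -> 0 < s -> s <= c <= T ->
  solves u W s y T X -> solves u W c (X c) T X.
Proof.
move=> cu s0 /andP[sc cT] [cX hX]; split.
  by apply: continuous_subspaceW cX; exact: sub_itvcc.
move=> t /andP[ct tT]; rewrite (hX t) ?(le_trans sc)//= (hX c) ?sc//.
have ci i : {within `[s, t], continuous (fun r => u r (X r) 0 i)}.
  by apply: within_field => //; apply: continuous_subspaceW cX; exact: sub_itvcc.
apply/rowP => i; rewrite !mxE (Rintegral_split (c := c) _ (ci i)) ?sc//; ring.
Qed.

Lemma solves_glue u W s y c T X Y : jointly_continuous u -> 0 < s -> s <= c <= T ->
  solves u W s y c X -> solves u W c (X c) T Y ->
  solves u W s y T (fun t => if t <= c then X t else Y t).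
Proof.
move=> cu s0 /andP[sc cT] solX solY; set Z := fun t => _.
have [cX hX] := solX; have [cY hY] := solY.
have Yc := solves_start cT solY.
have ZX t : t <= c -> Z t = X t by rewrite /Z => ->.
have ZY t : c <= t -> Z t = Y t.
  rewrite /Z le_eqVlt => /predU1P[<-|ct]; first by rewrite lexx Yc.
  by rewrite leNgt ct.
have cZ1 : {within `[s, c], continuous Z}.
  apply: subspace_eq_continuous cX => t; rewrite inE /= in_itv/= => /andP[_ tc].
  exact/esym/ZX.
have cZ2 : {within `[c, T], continuous Z}.
  apply: subspace_eq_continuous cY => t; rewrite inE /=  in_itv/= => /andP[ct _].
  exact/esym/ZY.
have cZ : {within `[s, T], continuous Z}.
  rewrite (_ : `[s, T]%classic = `[s, c] `|` `[c, T]).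
    by apply: withinU_continuous => //; exact: itv_closed.
  apply/seteqP; split => t /=; rewrite !in_itv/=.
    move=> /andP[st tT]; case: (leP t c) => tc; [left|right]; first by rewrite st.
    by rewrite (ltW tc).
  by move=> [/andP[st tc]|/andP[ct tT]]; rewrite ?st ?tT ?(le_trans tc)// (le_trans sc ct).
have int1 t i : t <= c ->
    \int[mu]_(r in `[s, t]) (u r (Z r) 0 i) = \int[mu]_(r in `[s, t]) (u r (X r) 0 i).
  move=> tc; apply: eq_Rintegral => r; rewrite inE /= in_itv/= => /andP[_ rt].
  by rewrite ZX// (le_trans rt).
split => // t /andP[st tT]; have [tc|ct] := leP t c.
  rewrite (ZX _ tc) hX ?st//; congr (_ + _ + _).
  by apply/rowP => i; rewrite !mxE int1.
rewrite (ZY _ (ltW ct)) hY ?(ltW ct)// (hX c) ?sc ?lexx//.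
have ci i : {within `[s, t], continuous (fun r => u r (Z r) 0 i)}.
  by apply: within_field => //; apply: continuous_subspaceW cZ; exact: sub_itvcc.
apply/rowP => i; rewrite !mxE (Rintegral_split (c := c) _ (ci i)) ?sc ?(ltW ct)// int1//.
rewrite (_ : \int[mu]_(r in `[c, t]) (u r (Z r) 0 i) = \int[mu]_(r in `[c, t]) (u r (Y r) 0 i)).
  ring.
apply: eq_Rintegral => r; rewrite inE /= in_itv/= => /andP[cr _].
by rewrite ZY.
Qed.

Definition shear_on u (e : 'I_2) s T : Prop := forall t, s <= t <= T ->
  (forall x : plane, u t x 0 e = 0) /\
  (forall x x' : plane, x 0 e = x' 0 e -> u t x = u t x').

Definition drift W s y t : plane := y + (W t - W s).

(** The velocity only sees the coordinate transverse to it, and this coordinate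
    follows the drift; hence the drift may replace the solution in the velocity. *)
Definition shear_path u W s y t : plane :=
  drift W s y t + \row_(i < 2) \int[mu]_(r in `[s, t]) (u r (drift W s y r) 0 i).

Lemma solves_shear_path u W (e : 'I_2) s T y X : shear_on u e s T ->
  solves u W s y T X -> forall t, s <= t <= T -> X t = shear_path u W s y t.
Proof.
move=> sh [cX hX] t /andP[st tT].
have same r : s <= r <= T -> X r 0 e = drift W s y r 0 e.
  move=> /andP[sr rT]; rewrite hX ?sr// !mxE.
  rewrite (eq_Rintegral _ (g := cst 0)) ?Rintegral_cst ?mul0r ?addr0//.
  move=> q; rewrite inE /= in_itv/= => /andP[sq qr].
  have qT : s <= q <= T by rewrite sq (le_trans qr).
  by have [-> _] := sh q qT.
rewrite hX ?st// /shear_path /drift addrAC; congr (_ + _).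
apply/rowP => i; rewrite !mxE; apply: eq_Rintegral => r.
rewrite inE /= in_itv/= => /andP[sr rt].
have srT : s <= r <= T by rewrite sr (le_trans rt).
by have [_ /(_ _ _ (same r srT)) ->] := sh r srT.
Qed.

Lemma shear_path_solves u W (e : 'I_2) s T y : jointly_continuous u -> 0 < s -> s <= T ->
  {within `[s, T], continuous W} -> shear_on u e s T ->
  solves u W s y T (shear_path u W s y).
Proof.
move=> cu s0 sT cW sh.
have cB : {within `[s, T], continuous (drift W s y)}.
  move/subspace_continuousP : cW => cW; apply/subspace_continuousP => r sr.
  exact: (cvgD (cvg_cst y) (cvgB (cW r sr) (cvg_cst (W s)))).
have ci i := within_field (i := i) cu s0 cB.
have cI : {within `[s, T], continuous (fun t =>
    \row_(i < 2) \int[mu]_(r in `[s, t]) (u r (drift W s y r) 0 i) : plane)}.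
  have h i := parameterized_integral_continuous sT (integrable_within (ci i)).
  rewrite (_ : (fun t => _) = fun t =>
      (\int[mu]_(r in `[s, t]) (u r (drift W s y r) 0 0)) *: delta_mx 0 0
    + (\int[mu]_(r in `[s, t]) (u r (drift W s y r) 0 1)) *: delta_mx 0 1); last first.
    apply/funext => t; apply: (etrans (row_sum_delta _)); rewrite big_ord_recl big_ord1 !mxE.
    by rewrite (_ : lift _ _ = 1) //; apply: val_inj.
  apply/subspace_continuousP => r sr.
  have h' i := (subspace_continuousP _ _).1 (h i) r sr.
  exact: (cvgD (cvgZr_tmp (h' 0)) (cvgZr_tmp (h' 1))).
split.
  move/subspace_continuousP : cB => cB; move/subspace_continuousP : cI => cI.
  apply/subspace_continuousP => r sr; exact: (cvgD (cB r sr) (cI r sr)).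
move=> t /andP[st tT]; rewrite [LHS]/shear_path /drift [RHS]addrAC; congr (_ + _).
apply/rowP => i; rewrite !mxE; apply: eq_Rintegral => r.
rewrite inE /= in_itv/= => /andP[sr rt].
have srT : s <= r <= T by rewrite sr (le_trans rt).
have [_ /(_ (drift W s y r) (shear_path u W s y r)) ->//] := sh r srT.
rewrite /shear_path [RHS]mxE [X in _ = _ + X]mxE.
rewrite (eq_Rintegral _ (g := cst 0)) ?Rintegral_cst ?mul0r ?addr0//.
move=> q; rewrite inE /= in_itv/= => /andP[sq qr].
have qT : s <= q <= T by rewrite sq (le_trans qr) // (le_trans rt).
by have [-> _] := sh q qT.
Qed.

(** A field which is a shear on each dyadic time block is well posed: solutions
    are explicit on each block, and they concatenate. *)
Lemma well_posed_shears u (e : nat -> 'I_2) : jointly_continuous u ->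
  (forall k, shear_on u (e k) (2 ^+ k.+1)^-1 (2 ^+ k)^-1) -> well_posed u.
Proof.
move=> cu sh W s y cW /andP[s0 s1].
have [K sK] : exists K, (2 ^+ K)^-1 <= s.
  exists (Num.truncn s^-1); rewrite -[leRHS]invrK lef_pV2 ?posrE ?invr_gt0 ?exprn_gt0//.
  apply: (le_trans (ltW (truncnS_gt _))); rewrite -natrX ler_nat; exact: ltn_expl.
elim: K s y s0 s1 sK => [|K IH] s y s0 s1 sK.
  have -> : s = 1 by apply/eqP; rewrite eq_le s1 -[leLHS]invr1 -[X in X^-1](expr0 2).
  split.
    exists (fun=> y); split; first by rewrite set_itv1; exact: continuous_subspace1.
    move=> t /andP[t1 t2]; have -> : t = 1 by apply/eqP; rewrite eq_le t1 t2.
    rewrite subrr addr0; apply/rowP => i; rewrite !mxE set_itv1 Rintegral_set1 addr0 //.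
  move=> X Y [_ hX] [_ hY] t /andP[t1 t2]; have -> : t = 1 by apply/eqP; rewrite eq_le t1 t2.
  rewrite hX ?lexx// hY ?lexx//; congr (_ + _ + _).
  by apply/rowP => i; rewrite !mxE set_itv1 !Rintegral_set1.
have [sK'|sK'] := leP (2 ^+ K)^-1 s; first exact: IH.
set c := (2 ^+ K)^-1 in sK' IH.
have c0 : 0 < c by rewrite invr_gt0 exprn_gt0.
have c1 : c <= 1 by rewrite invf_le1 ?exprn_gt0// exprn_ege1// ler1n.
have scT : s <= c <= 1 by rewrite (ltW sK').
have shs : shear_on u (e K) s c.
  by move=> t /andP[st tc]; apply: (sh K); rewrite (le_trans sK st).
split.
  have cWs : {within `[s, c], continuous W}.
    apply: continuous_subspaceW cW => r /=; rewrite !in_itv/= => /andP[sr rc].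
    by rewrite (lt_le_trans s0 sr) (le_trans rc).
  have sol := shear_path_solves y cu s0 (ltW sK') cWs shs.
  have [[Y solY] _] := IH c (shear_path u W s y c) c0 c1 (lexx _).
  by exists (fun t => if t <= c then shear_path u W s y t else Y t); apply: solves_glue solY.
move=> X Y solX solY t /andP[st t1].
have XE := solves_shear_path shs (solves_shorten c1 solX).
have YE := solves_shear_path shs (solves_shorten c1 solY).
have [tc|ct] := leP t c; first by rewrite XE ?YE// st.
have rX := solves_restart cu s0 scT solX.
have rY := solves_restart cu s0 scT solY.
have XYc : X c = Y c by rewrite XE ?YE// lexx (ltW sK').
rewrite -XYc in rY.
by have [_ uniq] := IH c (X c) c0 c1 (lexx _); apply: uniq => //; rewrite (ltW ct).
Qed.

Lemma flow_solves u W s y : well_posed u -> {within `]0, 1], continuous W} -> 0 < s <= 1 ->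
  is_solution u W s y (flow u W s y).
Proof.
move=> wp cW s01; have [[X sX] _] := wp W s y cW s01.
rewrite /flow; have := @xgetPex _ (fun=> 0) [set X | is_solution u W s y X].
by move=> h; have /= := h (ex_intro _ X sX).
Qed.

Lemma flow_trans u W s y c t : jointly_continuous u -> well_posed u ->
  {within `]0, 1], continuous W} ->
  0 < s -> s <= c -> c <= t <= 1 -> flow u W s y t = flow u W c (flow u W s y c) t.
Proof.
move=> cu wp cW s0 sc /andP[ct t1].
have c1 : c <= 1 by exact: le_trans t1.
have s01 : 0 < s <= 1 by rewrite s0 (le_trans sc).
have c01 : 0 < c <= 1 by rewrite (lt_le_trans s0 sc).
have sol := flow_solves y wp cW s01.
have sol2 : solves u W c (flow u W s y c) 1 (flow u W s y).
  by apply: solves_restart sol => //; rewrite sc.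
have [_ uniq] := wp W c (flow u W s y c) cW c01.
apply: uniq => //; last by rewrite ct.
exact: flow_solves.
Qed.

Lemma flow_shear u W (e : 'I_2) s y t : well_posed u ->
  {within `]0, 1], continuous W} -> 0 < s -> s <= t <= 1 -> shear_on u e s t ->
  flow u W s y t = shear_path u W s y t.
Proof.
move=> wp cW s0 /andP[st t1] sh.
have sol := flow_solves y wp cW (_ : 0 < s <= 1).
apply: (solves_shear_path sh (solves_shorten t1 (sol _))); last by rewrite st lexx.
by rewrite s0 (le_trans st).
Qed.

End ShearFlow.

(** * Displacement during a block *)

Section Trigonometry.
Variable R : realType.

Lemma cos_norm (x : R) : cos `|x| = cos x.
Proof. by have [x0|x0] := ger0P x => //; rewrite cosN. Qed.

Lemma cos_sin_increment (a a' : R) :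
  (cos a - cos a') ^+ 2 + (sin a - sin a') ^+ 2 = 2 - 2 * cos (a - a').
Proof.
rewrite cosB; have := cos2Dsin2 a; have := cos2Dsin2 a'; nra.
Qed.

(** If two phases nearly agree with zero modulo a full turn, so does their
    difference, which is impossible when that difference is in the second
    quadrant. *)
Lemma cos_phases (th ph : R) : pi / 2 <= ph <= pi ->
  1 / 2 <= 2 - 2 * cos th \/ 1 / 2 <= 2 - 2 * cos (th + ph).
Proof.
move=> /andP[p1 p2].
have cph : cos ph <= 0.
  rewrite -[ph](subrK (pi / 2)) cosDpihalf oppr_le0 sin_ge0_pi//.
  rewrite subr_ge0 p1 /= lerBlDr; apply: (le_trans p2).
  by rewrite lerDl divr_ge0// pi_ge0.
have [h1|h1] := leP (1 / 2) (2 - 2 * cos th); first by left.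
have [h2|h2] := leP (1 / 2) (2 - 2 * cos (th + ph)); first by right.
have E : cos ph = cos (th + ph) * cos th + sin (th + ph) * sin th.
  by rewrite -cosB addrAC subrr add0r.
have e1 := cos2Dsin2 th; have e2 := cos2Dsin2 (th + ph).
exfalso; move: cph h1 h2 e1 e2; rewrite E.
set a := cos th; set b := cos (th + ph); set c := sin th; set d := sin (th + ph).
move=> h h1 h2 e1 e2.
have a3 : 3 / 4 < a by lra.
have b3 : 3 / 4 < b by lra.
have a2 := sqr_ge0 (a - 3 / 4); have b2 := sqr_ge0 (b - 3 / 4).
have cd := sqr_ge0 (d + c).
have ab : 0 < (a - 3 / 4) * (b - 3 / 4) by rewrite mulr_gt0 ?subr_gt0.
lra.
Qed.

End Trigonometry.

Section BlockDisplacement.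
Variables (R : realType) (S : schedule R).
Local Notation plane := 'rV[R]_2.
Local Notation mu := (@lebesgue_measure R).
Implicit Types (b : nat -> bool) (W : R -> plane).

Lemma axis_neq k : axis k.+1 != axis k.
Proof. by rewrite /axis /=; case: (odd k). Qed.

Lemma shear_wave_axis (c lam phi : R) k (x : plane) :
  shear_wave c lam phi (axis k) (axis k.+1) x 0 (axis k) = 0.
Proof. by rewrite shear_wave_coord /wave eq_sym (negbTE (axis_neq k)) mulr0 mul0r. Qed.

Lemma shear_on_field b k : shear_on (field S b) (axis k) (block_time R k.+1) (block_time R k).
Proof.
move=> t /(field_block S b)[c [lam [phi ->]]]; split; first by move=> x; exact: shear_wave_axis.
by move=> x x' xx'; rewrite /shear_wave xx'.
Qed.

Lemma jointly_continuous_field b : jointly_continuous (field S b).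
Proof. by move=> t0 x0 t00; exact: field_continuous. Qed.

Lemma well_posed_field b : well_posed (field S b).
Proof.
by apply: (well_posed_shears (@jointly_continuous_field b)) => k; exact: shear_on_field.
Qed.

Lemma pulse_amp_neq0 b k j t : (j < npulse S k)%N -> pulse_amp S b k j t != 0 ->
  in_pulse S k j t.
Proof.
move=> jk p0; split => //; have d0 := dur_gt0 S k.
have : 1 / 4 < (t - pulse_start S k j) / dur S k < 3 / 4.
  by apply: contraNT p0 => /negP h; rewrite pulse_amp0.
by rewrite ltr_pdivlMr// ltr_pdivrMr// => /andP[h1 h2]; apply/andP; split; lra.
Qed.

Lemma field_sum b k t (x : plane) : block_time R k.+1 <= t <= block_time R k ->
  field S b t x 0 (axis k.+1) = \sum_(j < npulse S k)
    pulse_amp S b k j t * cos (pulse_freq S k j * x 0 (axis k) + pulse_phase R j).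
Proof.
move=> /andP[t1 t2]; case: (fieldP S b t) => [[k' [j [h ->]]]|[h ->]]; last first.
  rewrite mxE big1// => j _; have [->|/pulse_amp_neq0 p0] := eqVneq (pulse_amp S b k j t) 0.
    by rewrite mul0r.
  by have := h _ _ (p0 (ltn_ord j)).
have /andP[h1 h2] := in_pulse_block h.
have kk : k' = k.
  apply/eqP; rewrite eqn_leq; apply/andP; split; rewrite leqNgt; apply/negP => /(block_time_le R) h3.
    by have := lt_le_trans h2 (le_trans h3 t1); rewrite ltxx.
  by have := le_lt_trans (le_trans t2 h3) h1; rewrite ltxx.
rewrite {}kk in h *; have [jk _] := h.
rewrite (bigD1 (Ordinal jk))//= big1 ?addr0.
  by rewrite /pulse shear_wave_coord /wave eqxx mulr1.
move=> i ij; have [->|/pulse_amp_neq0 p0] := eqVneq (pulse_amp S b k i t) 0.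
  by rewrite mul0r.
have [E] := in_pulse_unique (p0 (ltn_ord i)) h.
by case/negP: ij; apply/eqP/val_inj.
Qed.

(** The transverse coordinate, during block [k], of the solution which has value [z]
    there at the beginning of the block. *)
Definition transverse_path W k (z : R) (r : R) : R :=
  z + (W r 0 (axis k) - W (block_time R k.+1) 0 (axis k)).

(** Rate at which pulse [j], with a positive sign, drives apart along the shear two
    solutions with transverse coordinates [z] and [z'] at the start of the block. *)
Definition push W k j (z z' : R) (r : R) : R :=
  amp S k * bump ((r - pulse_start S k j) / dur S k) *
  (cos (pulse_freq S k j * transverse_path W k z r + pulse_phase R j)
   - cos (pulse_freq S k j * transverse_path W k z' r + pulse_phase R j)).

Definition step W k (z z' : R) (j : nat) : R :=
  \int[mu]_(r in `[block_time R k.+1, block_time R k]) push W k j z z' r.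

Lemma pulse_start_ge k j : block_time R k.+1 <= pulse_start S k j.
Proof. by rewrite lerDl mulr_ge0// ltW// dur_gt0. Qed.

Lemma pulse_end_le k j : (j < npulse S k)%N -> pulse_start S k j + dur S k <= block_time R k.
Proof.
move=> jk; rewrite /pulse_start [leRHS]block_timeS -addrA lerD2l.
apply: le_trans (pulses_fit S k); rewrite natSl -/(npulse S k).
by rewrite ler_pM2r ?dur_gt0// ler_nat.
Qed.

Section Path.
Variables (W : R -> plane) (k : nat).
Hypothesis cW : {within `[block_time R k.+1, block_time R k], continuous W}.

Lemma within_push j z z' : {within `[block_time R k.+1, block_time R k], continuous (push W k j z z')}.
Proof.
have cWe := (subspace_continuousP _ _).1 (within_coord (i := axis k) cW).
apply/subspace_continuousP => r sr.
have cb : bump ((q - pulse_start S k j) / dur S k) @[q --> within `[block_time R k.+1, block_time R k] (nbhs r)]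
    --> bump ((r - pulse_start S k j) / dur S k).
  apply: cvg_within_filter.
  apply: (@continuous_comp _ _ _ (fun q : R => (q - pulse_start S k j) / dur S k) (@bump R) r).
    have h : (fun q : R => q - pulse_start S k j) @ r --> r - pulse_start S k j.
      by apply: cvgB; [exact: cvg_id|exact: cvg_cst].
    exact: (cvgMr_tmp (b := (dur S k)^-1) h).
  exact: (Ck_real_continuous (Ck_real_bump R 0)).
have cc x : cos (pulse_freq S k j * transverse_path W k x q + pulse_phase R j)
    @[q --> within `[block_time R k.+1, block_time R k] (nbhs r)]
    --> cos (pulse_freq S k j * transverse_path W k x r + pulse_phase R j).
  apply: (@cvg_comp _ _ _ _ (@cos R) _ (nbhs (pulse_freq S k j * transverse_path W k x r + pulse_phase R j))); last exact: continuous_cos.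
  apply: cvgD; last exact: cvg_cst.
  apply: cvgMl_tmp; apply: cvgD; first exact: cvg_cst.
  by apply: cvgB; [exact: cWe|exact: cvg_cst].
exact: (cvgM (cvgMl_tmp (a := amp S k) cb) (cvgB (cc z) (cc z'))).
Qed.

Lemma push_out j z z' r : r <= pulse_start S k j \/ pulse_start S k j + dur S k <= r ->
  push W k j z z' r = 0.
Proof.
have d0 := dur_gt0 S k; move=> h; rewrite /push bump_out ?mulr0 ?mul0r//.
by rewrite ler_pdivrMr// ler_pdivlMr//; case: h => h; [left|right]; lra.
Qed.

Lemma step_pulse j z z' : (j < npulse S k)%N ->
  step W k z z' j =
  \int[mu]_(r in `[pulse_start S k j, pulse_start S k j + dur S k]) push W k j z z' r.
Proof.
move=> jk; have s1 := pulse_start_ge k j; have s2 := pulse_end_le jk.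
have d0 := dur_gt0 S k; have cp := @within_push j z z'.
have s12 : pulse_start S k j <= pulse_start S k j + dur S k by rewrite lerDl ltW.
rewrite /step (Rintegral_split (c := pulse_start S k j) _ cp) ?s1 ?(le_trans s12)//.
rewrite (eq_Rintegral _ (g := cst 0)) ?Rintegral_cst ?mul0r ?add0r//; last first.
  by move=> r; rewrite inE /= in_itv/= => /andP[_ h]; rewrite push_out//; left.
have cp' : {within `[pulse_start S k j, block_time R k], continuous (push W k j z z')}.
  by apply: continuous_subspaceW cp; exact: sub_itvcc.
rewrite (Rintegral_split (c := pulse_start S k j + dur S k) _ cp') ?s12//.
rewrite [X in _ + X](eq_Rintegral _ (g := cst 0)) ?Rintegral_cst ?mul0r ?addr0//.
by move=> r; rewrite inE /= in_itv/= => /andP[h _]; rewrite push_out//; right.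
Qed.

Lemma within_push_pulse j z z' : (j < npulse S k)%N ->
  {within `[pulse_start S k j, pulse_start S k j + dur S k], continuous (push W k j z z')}.
Proof.
move=> jk; apply: continuous_subspaceW (@within_push j z z').
by apply: sub_itvcc; [exact: pulse_start_ge|exact: pulse_end_le].
Qed.

Lemma Rintegral_itv_cst (a c v : R) : a <= c ->
  \int[mu]_(r in `[a, c]) (cst v r) = v * (c - a).
Proof.
move=> ac; have E : fine (@lebesgue_measure R `[a, c]%classic) = c - a.
  rewrite lebesgue_measure_itv /= lte_fin.
  by case: (ltP a c) => //= ca; apply/esym/eqP; rewrite subr_eq0 eq_le ca ac.
by rewrite -E; exact: Rintegral_cst.
Qed.

Lemma step_le j z z' : (j < npulse S k)%N -> `|step W k z z' j| <= 2 * amp S k * dur S k.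
Proof.
move=> jk; rewrite (step_pulse _ _ jk); have d0 := dur_gt0 S k.
have ip := integrable_within (@within_push_pulse j z z' jk).
apply: (le_trans (le_normr_Rintegral _ ip)) => //.
have -> : 2 * amp S k * dur S k = \int[mu]_(r in
    `[pulse_start S k j, pulse_start S k j + dur S k]) (cst (2 * amp S k) r).
  by rewrite Rintegral_itv_cst ?lerDl ?(ltW d0)// [_ + dur S k]addrC addrK.
apply: le_Rintegral => //.
- exact: integrable_norm ip.
- apply: integrable_within; apply: continuous_subspaceT => r; exact: cvg_cst.
move=> r _; rewrite /push 2!normrM (ger0_norm (amp_ge0 S k)) (ger0_norm (bump_ge0 _)).
rewrite (mulrC 2); apply: ler_pM => //.
- by rewrite mulr_ge0 ?amp_ge0 ?bump_ge0.
- by rewrite ler_piMr ?amp_ge0 ?bump_le1.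
- apply: (le_trans (ler_normB _ _)); rewrite (_ : 2 = 1 + 1)//.
  by apply: lerD; rewrite ler_norml cos_geN1 cos_le1.
Qed.

(** The bump is at least [expR (- 16)] on a quarter of its slot, and a quarter is also
    the difference of cosines in [step_ge_signed]. *)
Definition bump_mass : R := expR (- 16) / 16.

(** The push has a constant sign, so that it is enough to integrate it where the bump
    is bounded below. *)
Lemma step_ge_signed j z z' (c : R) : (j < npulse S k)%N -> c = 1 \/ c = -1 ->
  (forall r, pulse_start S k j <= r <= pulse_start S k j + dur S k ->
     1 / 4 <= c *
     (cos (pulse_freq S k j * transverse_path W k z r + pulse_phase R j)
      - cos (pulse_freq S k j * transverse_path W k z' r + pulse_phase R j))) ->
  amp S k * dur S k * bump_mass <= c * step W k z z' j.
Proof.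
move=> jk c1 hc; rewrite (step_pulse _ _ jk); have d0 := dur_gt0 S k.
set a := pulse_start S k j; set d := dur S k in d0 *.
have cp := @within_push_pulse j z z' jk; rewrite -/a -/d in cp.
have push_ge0 r : a <= r <= a + d -> 0 <= c * push W k j z z' r.
  move=> ard; rewrite /push mulrCA; apply: mulr_ge0.
    by rewrite mulr_ge0 ?amp_ge0 ?bump_ge0.
  by apply: le_trans (hc r ard); rewrite divr_ge0.
have cc (x y : R) : a <= x -> y <= a + d -> {within `[x, y], continuous (fun r => c * push W k j z z' r)}.
  move=> ax ya; have cp' := (subspace_continuousP _ _).1 cp.
  apply: (@continuous_subspaceW _ _ _ `[a, a + d]); first exact: sub_itvcc.
  by apply/subspace_continuousP => r sr; exact: (cvgMl_tmp (a := c) (cp' r sr)).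
have ad1 : a <= a + 3 / 8 * d by lra.
have ad2 : a + 3 / 8 * d <= a + 5 / 8 * d by lra.
have ad3 : a + 5 / 8 * d <= a + d by lra.
have -> : c * \int[mu]_(r in `[a, a + d]) push W k j z z' r
   = \int[mu]_(r in `[a, a + d]) (c * push W k j z z' r).
  by rewrite RintegralZl//; exact: integrable_within.
have c1' : a <= a + 3 / 8 * d <= a + d by rewrite ad1 (le_trans ad2 ad3).
have c2' : a + 3 / 8 * d <= a + 5 / 8 * d <= a + d by rewrite ad2 ad3.
rewrite (Rintegral_split c1' (cc _ _ (lexx _) (lexx _))).
rewrite (Rintegral_split c2' (cc _ _ ad1 (lexx _))).
have i1 : 0 <= \int[mu]_(r in `[a, a + 3 / 8 * d]) (c * push W k j z z' r).
  apply: Rintegral_ge0 => r; rewrite /= in_itv/= => /andP[h1 h2]; apply: push_ge0.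
  by rewrite h1 (le_trans h2)// (le_trans ad2).
have i3 : 0 <= \int[mu]_(r in `[a + 5 / 8 * d, a + d]) (c * push W k j z z' r).
  apply: Rintegral_ge0 => r; rewrite /= in_itv/= => /andP[h1 h2]; apply: push_ge0.
  by rewrite h2 andbT (le_trans _ h1)// (le_trans ad1).
have i2 : amp S k * d * bump_mass <=
    \int[mu]_(r in `[a + 3 / 8 * d, a + 5 / 8 * d]) (c * push W k j z z' r).
  have -> : amp S k * d * bump_mass = (amp S k * expR (- 16) / 4) * ((a + 5 / 8 * d) - (a + 3 / 8 * d)).
    by rewrite /bump_mass; field.
  rewrite -(Rintegral_itv_cst _ ad2); apply: le_Rintegral => //.
  - by apply: integrable_within; apply: continuous_subspaceT => r; exact: cvg_cst.
  - by apply: integrable_within; apply: cc.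
  move=> r; rewrite /= in_itv/= => /andP[h1 h2].
  have ard : a <= r <= a + d by rewrite (le_trans ad1 h1) (le_trans h2 ad3).
  rewrite /push mulrCA /cst; apply: ler_pM.
  - by rewrite mulr_ge0 ?amp_ge0 ?expR_ge0.
  - by rewrite invr_ge0.
  - rewrite ler_wpM2l ?amp_ge0//; apply: bump_ge.
    by rewrite ler_pdivlMr// ler_pdivrMr// -/a -/d; apply/andP; split; lra.
  - by have := hc r ard; rewrite div1r.
by rewrite addrC -addrA; apply: (le_trans i2); rewrite lerDl addr_ge0.
Qed.

End Path.
End BlockDisplacement.

(** * Frequencies and large steps *)

Section FrequencyChoice.
Variable R : realType.

Lemma dyadic_bracket (x : R) : 1 <= x -> exists n, 2 ^+ n <= x < 2 ^+ n.+1.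
Proof.
move=> x1; have x0 : 0 <= x by exact: le_trans x1.
have /andP[t1 t2] := truncn_itv x0.
have m0 : (0 < Num.truncn x)%N by rewrite truncn_gt0.
exists (trunc_log 2 (Num.truncn x)).
have /andP[l1 l2] := trunc_log_bounds (isT : (1 < 2)%N) m0.
rewrite -!natrX (le_trans _ t1) ?ler_nat//=.
by apply: (lt_le_trans t2); rewrite ler_nat.
Qed.

(** If the base frequency is bad at separation [h], then its phase is close to zero
    modulo a full turn, and the frequency that differs from it by the dyadic amount
    adapted to [h] has a phase away from zero ([cos_phases]).  Separations from
    [ell k] to [2] span [k^2 + 2] dyadic intervals. *)
Lemma freq_good k (h : R) : ell R k <= `|h| <= 2 ->
  exists2 i, (i < k ^ 2 + 3)%N & 1 / 2 <= 2 - 2 * cos (freq R k i * h).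
Proof.
move=> /andP[h1 h2]; have e0 := ell_gt0 R k.
pose th := `|h| / ell R k.
have th1 : 1 <= th by rewrite ler_pdivlMr// mul1r.
have [n /andP[n1 n2]] := dyadic_bracket th1.
have p0 : 0 < 2 ^+ n :> R by rewrite exprn_gt0.
have phb : pi / 2 <= pi / 2 / 2 ^+ n * th <= pi.
  have pi2 : 0 < pi / 2 :> R by rewrite divr_gt0 ?pi_gt0.
  apply/andP; split.
    by rewrite -mulrA ler_peMr ?(ltW pi2)// mulrC ler_pdivlMr// mul1r.
  rewrite -[leRHS](divfK (_ : 2 != 0 :> R))// -mulrA ler_pM2l//.
  by rewrite mulrC ler_pdivrMr// -exprS ltW.
have E i : cos (freq R k i * h) = cos (freq R k i * `|h|).
  rewrite -(cos_norm (freq R k i * h)) normrM ger0_norm//.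
  by case/andP: (freq_bounds R k i) => + _; apply: le_trans; rewrite invr_ge0 ltW.
have f0 : freq R k 0 * `|h| = th by rewrite /freq /th div1r mulrC.
have fn : freq R k n.+1 * `|h| = th + pi / 2 / 2 ^+ n * th.
  by rewrite /freq /th -mulrA (mulrC _^-1) mulrDl mul1r.
have [g|g] := cos_phases th phb.
  by exists 0%N; rewrite ?addn_gt0 ?orbT// E f0.
exists n.+1; last by rewrite E fn.
rewrite addn3 ltnS -(ltn_exp2l _ _ (isT : (1 < 2)%N)).
have : th <= 2 ^+ (k ^ 2).+1.
  by rewrite /th ler_pdivrMr// /ell exprS -mulrA divff ?mulr1// expf_neq0.
move=> /(le_trans n1); rewrite -!natrX ler_nat => /leq_ltn_trans; apply.
by rewrite ltn_exp2l.
Qed.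

End FrequencyChoice.

Section LargeSteps.
Variables (R : realType) (S : schedule R).
Local Notation plane := 'rV[R]_2.
Local Notation mu := (@lebesgue_measure R).
Variables (W : R -> plane) (k : nat).
Hypothesis cW : {within `[block_time R k.+1, block_time R k], continuous W}.

(** How the regularity of the path enters.  Frequencies are at
    most [3 / ell k], so that phases move by at most [1 / 8] during a pair of pulses. *)
Definition slow_path : Prop := forall r r', block_time R k.+1 <= r <= block_time R k ->
  block_time R k.+1 <= r' <= block_time R k -> `|r - r'| <= 2 * dur S k ->
  `|W r 0 (axis k) - W r' 0 (axis k)| <= ell R k / 24.

Definition step_size : R := amp S k * dur S k * bump_mass R.

(** A difference of cosines of at least [1 / 2] at the start of the pair keeps its sign
    and stays above [1 / 4] during the pair, each cosine moving by at most [1 / 8]. *)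
Lemma step_large (i j : nat) (z z' : R) : slow_path ->
  (i.*2.+1 < npulse S k)%N -> j = i.*2 \/ j = i.*2.+1 ->
  (let r0 := pulse_start S k i.*2 in
   1 / 2 <= `|cos (pulse_freq S k j * transverse_path W k z r0 + pulse_phase R j)
     - cos (pulse_freq S k j * transverse_path W k z' r0 + pulse_phase R j)|) ->
  step_size <= `|step S W k z z' j|.
Proof.
move=> slow ik ji; set r0 := pulse_start S k i.*2 => /= big.
have d0 := dur_gt0 S k.
have jk : (j < npulse S k)%N by case: ji => ->//; exact: ltnW.
have r0in : block_time R k.+1 <= r0 <= block_time R k.
  rewrite pulse_start_ge /= (le_trans _ (pulse_end_le (ltnW ik)))// lerDl ltW//.
have near r : pulse_start S k j <= r <= pulse_start S k j + dur S k ->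
    `|W r 0 (axis k) - W r0 0 (axis k)| <= ell R k / 24.
  move=> /andP[r1 r2]; apply: slow => //.
    by rewrite (le_trans (pulse_start_ge S k j) r1) (le_trans r2 (pulse_end_le jk)).
  have r01 : r0 <= r.
    apply: le_trans r1; rewrite lerD2l ler_pM2r// ler_nat.
    by case: ji => ->.
  rewrite ger0_norm ?subr_ge0// lerBlDl; apply: (le_trans r2).
  rewrite /r0 /pulse_start -!addrA lerD2l; case: ji => -> ; last first.
    by rewrite -natr1 mulrDl mul1r; lra.
  lra.
have lip x r : pulse_start S k j <= r <= pulse_start S k j + dur S k ->
   `|cos (pulse_freq S k j * transverse_path W k x r + pulse_phase R j)
     - cos (pulse_freq S k j * transverse_path W k x r0 + pulse_phase R j)| <= 1 / 8.
  move=> rr; apply: (le_trans (cos_lipschitz _ _)).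
  have -> : pulse_freq S k j * transverse_path W k x r + pulse_phase R j
     - (pulse_freq S k j * transverse_path W k x r0 + pulse_phase R j)
     = pulse_freq S k j * (W r 0 (axis k) - W r0 0 (axis k)).
    by rewrite /transverse_path; ring.
  have /andP[f1 f2] := freq_bounds R k (j./2 %% nfreq S k).
  have f0 : 0 <= pulse_freq S k j by apply: le_trans (pulse_freq_ge1 S k j).
  rewrite normrM (ger0_norm f0).
  apply: (le_trans (ler_pM f0 (normr_ge0 _) f2 (near r rr))).
  have e0 := ell_gt0 R k.
  by have -> : 3 / ell R k * (ell R k / 24) = 1 / 8 by field; rewrite gt_eqF.
set g := fun x r => cos (pulse_freq S k j * transverse_path W k x r + pulse_phase R j) in lip big *.
have bound (c : R) : c = 1 \/ c = -1 -> 1 / 2 <= c * (g z r0 - g z' r0) ->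
    step_size <= c * step S W k z z' j.
  move=> c1 hc; apply: step_ge_signed => // r rr.
  have := lip z r rr; have := lip z' r rr; rewrite !ler_norml => /andP[l1 l2] /andP[l3 l4].
  move: hc; rewrite /g; case: c1 => -> hc; lra.
have [s0|s0] := ger0P (g z r0 - g z' r0).
  have hb : 1 / 2 <= 1 * (g z r0 - g z' r0) by rewrite [leRHS]mul1r -(ger0_norm s0).
  by apply: (le_trans (bound 1 (or_introl erefl) hb)); rewrite mul1r ler_norm.
have hb : 1 / 2 <= -1 * (g z r0 - g z' r0) by rewrite [leRHS]mulN1r -(ltr0_norm s0).
apply: (le_trans (bound (-1) (or_intror erefl) hb)).
by rewrite mulN1r -normrN ler_norm.
Qed.

(** The squared differences of cosines and of sines add up to at least [1 / 2], so that
    one of the two differences is at least [1 / 2]. *)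
Lemma pair_large (i : nat) (z z' : R) : slow_path -> (i.*2.+1 < npulse S k)%N ->
  1 / 2 <= 2 - 2 * cos (freq R k (i %% nfreq S k) * (z - z')) ->
  (1 <= (step_size <= `|step S W k z z' i.*2|)%R
        + (step_size <= `|step S W k z z' i.*2.+1|)%R)%N.
Proof.
move=> slow ik good; set r0 := pulse_start S k i.*2.
set f := freq R k (i %% nfreq S k) in good *.
have f1 : pulse_freq S k i.*2 = f by rewrite /pulse_freq doubleK.
have f2 : pulse_freq S k i.*2.+1 = f by rewrite /pulse_freq /= uphalf_double.
have p1 : pulse_phase R i.*2 = 0 by rewrite /pulse_phase odd_double.
have p2 : pulse_phase R i.*2.+1 = - (pi / 2) by rewrite /pulse_phase /= odd_double.
set a := f * transverse_path W k z r0; set a' := f * transverse_path W k z' r0.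
have aa : a - a' = f * (z - z') by rewrite /a /a' /transverse_path; ring.
have := cos_sin_increment a a'; rewrite aa => sq.
have [hc|hc] := leP (1 / 2) `|cos a - cos a'|.
  rewrite (step_large (i := i) slow)//; first by left.
  by rewrite /= f1 p1 !addr0.
have [hs|hs] := leP (1 / 2) `|sin a - sin a'|.
  rewrite addnC (step_large (i := i) slow)//; first by right.
  by rewrite /= f2 p2 !cosBpihalf.
exfalso.
have c2 : (cos a - cos a') ^+ 2 < 1 / 4.
  rewrite -real_normK ?num_real// (_ : 1 / 4 = (1 / 2) ^+ 2); last by field.
  by rewrite ltr_pXn2r// nnegrE.
have s2 : (sin a - sin a') ^+ 2 < 1 / 4.
  rewrite -real_normK ?num_real// (_ : 1 / 4 = (1 / 2) ^+ 2); last by field.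
  by rewrite ltr_pXn2r// nnegrE.
move: sq good c2 s2; lra.
Qed.

Lemma sum_pairs (f : nat -> nat) n :
  (\sum_(j < 2 * n) f j = \sum_(i < n) (f i.*2 + f i.*2.+1))%N.
Proof.
elim: n => [|n IH]; first by rewrite !big_ord0.
by rewrite mulnS addnC addn2 !big_ord_recr /= IH -addnA mul2n.
Qed.

Lemma sum_blocks_ge (f : nat -> nat) m n i0 : (i0 < m)%N ->
  (forall i, (i < m * n)%N -> i %% m = i0 -> 1 <= f i)%N -> (n <= \sum_(i < m * n) f i)%N.
Proof.
move=> im; elim: n => [//|n IH] hf.
rewrite mulnS addnC -(big_mkord xpredT) (big_cat_nat (n := m * n)) ?leq_addr//=.
rewrite -[n.+1]addn1 leq_add//.
  by rewrite big_mkord; apply: IH => i ilt; apply: hf; rewrite mulnS ltn_addl.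
rewrite (big_cat_nat (n := m * n + i0)) ?leq_addr ?leq_add2l ?(ltnW im)//=.
rewrite [X in (_ + X)%N]big_ltn; last by rewrite ltn_add2l.
have h1 : (1 <= f (m * n + i0))%N.
  apply: hf; first by rewrite mulnS addnC ltn_add2r.
  by rewrite mulnC modnMDl modn_small.
by rewrite addnCA (leq_trans h1)// leq_addr.
Qed.

(** Frequencies are used in turn, so that each run of [nfreq k] consecutive pairs
    contains a pair with the good frequency. *)
Lemma large_steps_count (z z' : R) : slow_path -> (k ^ 2 + 3 <= nfreq S k)%N ->
  ell R k <= `|z - z'| <= 2 ->
  (2 * nrep S k <= large_steps (npulse S k) step_size (step S W k z z'))%N.
Proof.
move=> slow nf hz; have [i0 i0k good] := freq_good hz.
have i0f : (i0 < nfreq S k)%N by exact: leq_trans i0k nf.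
pose f j : nat := (step_size <= `|step S W k z z' j|)%R.
rewrite /large_steps -[X in (_ <= X)%N]/(\sum_(j < 2 * (nfreq S k * (2 * nrep S k))) f j)%N.
rewrite sum_pairs.
apply: (sum_blocks_ge (f := fun i => (f i.*2 + f i.*2.+1)%N) i0f) => i ilt im.
apply: pair_large => //.
  by rewrite /npulse /pulses -muln2; lia.
by rewrite im.
Qed.

End LargeSteps.

Section BlockFlow.
Variables (R : realType) (S : schedule R).
Local Notation plane := 'rV[R]_2.
Local Notation mu := (@lebesgue_measure R).
Implicit Types (b : nat -> bool) (W : R -> plane).

Lemma Rintegral_sum_within n (f : nat -> R -> R) (s t : R) :
  (forall j, {within `[s, t], continuous (f j)}) ->
  {within `[s, t], continuous (fun r => \sum_(j < n) f j r)} /\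
  \int[mu]_(r in `[s, t]) (\sum_(j < n) f j r) = \sum_(j < n) \int[mu]_(r in `[s, t]) f j r.
Proof.
move=> cf; elim: n => [|n [IHc IH]].
  have E : (fun r => \sum_(j < 0) f j r) = cst 0 by apply/funext => r; rewrite big_ord0.
  rewrite E big_ord0; split; first by apply: continuous_subspaceT => r; exact: cvg_cst.
  rewrite (eq_Rintegral _ (g := cst 0)) ?Rintegral_cst ?mul0r//.
have E : (fun r => \sum_(j < n.+1) f j r) = (fun r => \sum_(j < n) f j r + f n r).
  by apply/funext => r; rewrite big_ord_recr.
rewrite E big_ord_recr /= -IH; split.
  apply/subspace_continuousP => r sr.
  exact: (cvgD ((subspace_continuousP _ _).1 IHc r sr) ((subspace_continuousP _ _).1 (cf n) r sr)).
rewrite -(RintegralD _ (integrable_within IHc) (integrable_within (cf n)))//.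
Qed.

(** Both solutions are explicit and have the same drift, which cancels.  What remains is
    the integral of the difference of the velocities; at most one pulse is active at
    any time, so that the velocity is the sum of all pulses of the block. *)
Lemma flow_block_diff b W k (y y' : plane) (bl : seq bool) :
  {within `]0, 1], continuous W} ->
  (forall j, (j < npulse S k)%N -> nth false bl j = b (offset S k + j)%N) ->
  let X := flow (field S b) W (block_time R k.+1) y (block_time R k) in
  let X' := flow (field S b) W (block_time R k.+1) y' (block_time R k) in
  (X - X') 0 (axis k) = (y - y') 0 (axis k) /\
  (X - X') 0 (axis k.+1) = (y - y') 0 (axis k.+1)
    + signed_sum (npulse S k) (step S W k (y 0 (axis k)) (y' 0 (axis k))) bl.
Proof.
move=> cW hb; set s := block_time R k.+1; set t := block_time R k => /=.
have s0 : 0 < s := block_time_gt0 R k.+1.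
have st : s <= t by apply: block_time_le.
have t1 : t <= 1 by rewrite -[leRHS]invr1 -[X in X^-1](expr0 2) (block_time_le R (leq0n k)).
have cWs : {within `[s, t], continuous W}.
  apply: continuous_subspaceW cW => r /=; rewrite !in_itv/= => /andP[sr rt].
  by rewrite (lt_le_trans s0 sr) (le_trans rt).
have sh := @shear_on_field R S b k.
have wp := @well_posed_field R S b.
have fE x : flow (field S b) W s x t = shear_path (field S b) W s x t.
  by apply: (flow_shear (e := axis k)) => //; rewrite st.
have shst r : s <= r <= t -> forall x : plane, field S b r x 0 (axis k) = 0.
  by move=> rst; have [] := sh r rst.
rewrite !fE /shear_path; split.
  rewrite !mxE !(eq_Rintegral _ (g := cst 0)) ?Rintegral_cst ?mul0r ?addr0//.
  - ring.
  - by move=> r; rewrite inE /= in_itv/= => rst; rewrite shst.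
  - by move=> r; rewrite inE /= in_itv/= => rst; rewrite shst.
have cdrift x : {within `[s, t], continuous (drift W s x)}.
  move/subspace_continuousP : cWs => cWs; apply/subspace_continuousP => r sr.
  exact: (cvgD (cvg_cst x) (cvgB (cWs r sr) (cvg_cst (W s)))).
have ci x := within_field (i := axis k.+1) (@jointly_continuous_field R S b) s0 (cdrift x).
have diffE : \int[mu]_(r in `[s, t]) (field S b r (drift W s y r) 0 (axis k.+1))
  - \int[mu]_(r in `[s, t]) (field S b r (drift W s y' r) 0 (axis k.+1))
  = signed_sum (npulse S k) (step S W k (y 0 (axis k)) (y' 0 (axis k))) bl.
  rewrite -(RintegralB _ (integrable_within (ci y)) (integrable_within (ci y')))//.
  pose f j r := bit_sign R (nth false bl j) * push S W k j (y 0 (axis k)) (y' 0 (axis k)) r.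
  have cf j : {within `[s, t], continuous (f j)}.
    apply/subspace_continuousP => r sr; apply: cvgMl_tmp.
    exact: ((subspace_continuousP _ _).1 (@within_push R S W k cWs j _ _) r sr).
  transitivity (\int[mu]_(r in `[s, t]) (\sum_(j < npulse S k) f j r)).
    apply: eq_Rintegral => r; rewrite inE /= in_itv/= => rst.
    rewrite !field_sum// -sumrB; apply: eq_bigr => j _.
    rewrite /f hb// /push /pulse_amp -mulrBr /transverse_path /drift.
    by rewrite !mxE -/s; ring.
  have [_ ->] := Rintegral_sum_within (npulse S k) cf.
  apply: eq_bigr => j _; rewrite /f RintegralZl//.
  by apply: integrable_within; exact: within_push.
by rewrite -diffE !mxE; ring.
Qed.

End BlockFlow.

(** * From block to block *)

Section Recursion.
Variables (R : realType) (S : schedule R).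
Local Notation plane := 'rV[R]_2.
Implicit Types (b : nat -> bool) (W : R -> plane) (bl : seq bool).

Lemma offsetS k : offset S k.+1 = (offset S k + npulse S k)%N.
Proof. by rewrite /offset big_ord_recr. Qed.

Lemma offset_le k k' : (k <= k')%N -> (offset S k <= offset S k')%N.
Proof.
move=> /subnKC <-; elim: (k' - k)%N => [|d IH]; first by rewrite addn0.
by rewrite addnS offsetS (leq_trans IH)// leq_addr.
Qed.

Lemma block_time_le1 k : block_time R k <= 1.
Proof. by rewrite -[leRHS]invr1 -[X in X^-1](expr0 2) (block_time_le R (leq0n k)). Qed.

Lemma field_agree b b' k t : (forall i, (i < offset S k)%N -> b i = b' i) ->
  block_time R k <= t -> field S b t = field S b' t.
Proof.
move=> bb kt; case: (fieldP S b t) => [[k' [j [h ->]]]|[h ->]]; last by rewrite field0.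
rewrite (field_pulse _ h) /pulse /pulse_amp bb//.
have /andP[_ h2] := in_pulse_block h.
have kk : (k' < k)%N.
  by rewrite ltnNge; apply/negP => /(block_time_le R) h3; have := lt_le_trans h2 (le_trans h3 kt); rewrite ltxx.
apply: leq_trans (offset_le kk); rewrite offsetS ltn_add2l; by case: h.
Qed.

Lemma field_block_agree b b' k t :
  (forall j, (j < npulse S k)%N -> b (offset S k + j)%N = b' (offset S k + j)%N) ->
  block_time R k.+1 <= t <= block_time R k -> field S b t = field S b' t.
Proof.
move=> bb /andP[t1 t2]; case: (fieldP S b t) => [[k' [j [h ->]]]|[h ->]]; last by rewrite field0.
have /andP[h1 h2] := in_pulse_block h.
have kk : k' = k.
  apply/eqP; rewrite eqn_leq; apply/andP; split; rewrite leqNgt; apply/negP => /(block_time_le R) h3.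
    by have := lt_le_trans h2 (le_trans h3 t1); rewrite ltxx.
  by have := le_lt_trans (le_trans t2 h3) h1; rewrite ltxx.
rewrite {}kk in h *; rewrite (field_pulse _ h) /pulse /pulse_amp bb//; by case: h.
Qed.

Lemma eq_flow (u u' : R -> plane -> plane) W s y t :
  (forall r, s <= r <= 1 -> u r = u' r) -> flow u W s y t = flow u' W s y t.
Proof.
move=> uu; rewrite /flow; congr (xget _ _ _); apply/seteqP.
have imp (v v' : R -> plane -> plane) : (forall r, s <= r <= 1 -> v r = v' r) ->
    [set X | is_solution v W s y X] `<=` [set X | is_solution v' W s y X].
  move=> vv X [cX hX]; split => // q /andP[sq q1]; rewrite hX ?sq//.
  congr (_ + _ + _); apply/rowP => i; rewrite !mxE; apply: eq_Rintegral => r.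
  rewrite inE /= in_itv/= => /andP[sr rq]; rewrite vv// sr; exact: le_trans q1.
by split; apply: imp => // r rr; rewrite uu.
Qed.

Section Path.
Variable W : R -> plane.
Hypothesis cW : {within `]0, 1], continuous W}.

Definition field_flow b s y t : plane := flow (field S b) W s y t.

Lemma field_flow_block_agree b b' k y :
  (forall j, (j < npulse S k)%N -> b (offset S k + j)%N = b' (offset S k + j)%N) ->
  field_flow b (block_time R k.+1) y (block_time R k) = field_flow b' (block_time R k.+1) y (block_time R k).
Proof.
move=> bb; have s0 := block_time_gt0 R k.+1.
have st : block_time R k.+1 <= block_time R k by exact: block_time_le.
have E c : field_flow c (block_time R k.+1) y (block_time R k) = shear_path (field S c) W (block_time R k.+1) y (block_time R k).
  apply: (flow_shear (e := axis k)) => //; [exact: well_posed_field| |exact: shear_on_field].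
  by rewrite st block_time_le1.
rewrite !E /shear_path; congr (_ + _); apply/rowP => i; rewrite !mxE.
apply: eq_Rintegral => r; rewrite inE /= in_itv/= => rr.
by rewrite (field_block_agree bb).
Qed.

Lemma field_flow_agree b b' k y t : (forall i, (i < offset S k)%N -> b i = b' i) ->
  field_flow b (block_time R k) y t = field_flow b' (block_time R k) y t.
Proof.
by move=> bb; apply: eq_flow => r /andP[rk _]; exact: (field_agree bb).
Qed.

Lemma field_flow_trans b k n y : (n <= k)%N ->
  field_flow b (block_time R k.+1) y (block_time R n) = field_flow b (block_time R k) (field_flow b (block_time R k.+1) y (block_time R k)) (block_time R n).
Proof.
move=> nk; apply: flow_trans => //.
- exact: jointly_continuous_field.
- exact: well_posed_field.
- exact: block_time_gt0.
- exact: block_time_le.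
- by rewrite block_time_le// block_time_le1.
Qed.

Lemma field_flow_start b k y : field_flow b (block_time R k) y (block_time R k) = y.
Proof.
have wp := @well_posed_field R S b.
have k01 : 0 < block_time R k <= 1 by rewrite block_time_gt0 block_time_le1.
have := flow_solves y wp cW k01; move/solves_start; apply; exact: block_time_le1.
Qed.

(** The induction hypothesis at the start of block [k].  The lower bound concerns the
    transverse coordinate of the coming shear.  The upper bound keeps separations in
    the range where the frequencies are effective; block [k] may increase them by
    [block_time k], and [block_time k + block_time k] is [block_time (k - 1)]. *)
Definition well_separated k (h : plane) : bool :=
  (ell R k <= `|h 0 (axis k)|) && [forall i, `|h 0 i| <= 1 + block_time R k].

(** The first term is the Littlewood-Offord bound for missing the scale [ell k.-1],
    the second one Chebyshev's bound for a growth beyond [block_time k]. *)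
Definition block_failure k : R :=
  (ell R k.-1 / step_size S k + 1) / Num.sqrt (2 * nrep S k + 1)%:R
  + (npulse S k)%:R * (2 * amp S k * dur S k) ^+ 2 / block_time R k ^+ 2.

(** The bits before block [k] do not influence the flow of this block. *)
Definition block_bits k bl : nat -> bool :=
  nth false (nseq (offset S k) false ++ bl).

Lemma nth_block_bits k bl j : nth false bl j = block_bits k bl (offset S k + j)%N.
Proof. by rewrite /block_bits nth_cat size_nseq ltnNge leq_addr /= addKn. Qed.

(** The separation along the shear starts from an arbitrary value [h0].  The signed sum
    brings it below [ell k.-1] only if it falls in an interval of length
    [2 * ell k.-1], which is covered by [n] windows of twice the step size. *)
Lemma block_failureP k (y y' : plane) : (0 < k)%N -> 0 < amp S k ->
  slow_path S W k -> (k ^ 2 + 3 <= nfreq S k)%N -> well_separated k (y - y') ->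
  avg (npulse S k) (fun bl =>
    (~~ well_separated k.-1 (field_flow (block_bits k bl) (block_time R k.+1) y (block_time R k)
                    - field_flow (block_bits k bl) (block_time R k.+1) y' (block_time R k)))%:R)
  <= block_failure k.
Proof.
case: k => // k _ A0 slow nf /andP[h1 /forallP h2].
set K := k.+1 in A0 slow nf h1 h2 *.
have cWK : {within `[block_time R K.+1, block_time R K], continuous W}.
  apply: continuous_subspaceW cW => r /=; rewrite !in_itv/= => /andP[sr rt].
  by rewrite (lt_le_trans (block_time_gt0 R K.+1) sr) (le_trans rt (block_time_le1 _)).
have tmK : 0 < block_time R K := block_time_gt0 R K.
have yE i : (y - y') 0 i = y 0 i - y' 0 i by rewrite !mxE.
have big : (2 * nrep S K <= large_steps (npulse S K) (step_size S K)
    (step S W K (y 0%R (axis K)) (y' 0%R (axis K))))%N.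
  apply: large_steps_count => //; rewrite -yE h1 /=; apply: (le_trans (h2 _)).
  by rewrite (_ : 2 = 1 + 1)// lerD2l block_time_le1.
set ds := step S W K _ _ in big.
have m0 : 0 < bump_mass R by rewrite divr_gt0 ?expR_gt0.
have d0 : 0 < step_size S K by rewrite !mulr_gt0 ?dur_gt0.
set h0 := (y - y') 0 (axis K.+1).
pose n := (Num.truncn (ell R k / step_size S K)).+1.
have nE : ell R k <= n%:R * step_size S K.
  by rewrite -ler_pdivrMr// ltW// truncnS_gt.
have nle : n%:R <= ell R k / step_size S K + 1.
  rewrite -natr1 lerD2r truncn_le divr_ge0 ?(ltW d0)//; exact/ltW/ell_gt0.
apply: (@le_trans _ _ (avg (npulse S K) (fun bl =>
    (- ell R k <= h0 + signed_sum (npulse S K) ds bl < - ell R k + n%:R * (2 * step_size S K))%R%:R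
    + (block_time R K < `|signed_sum (npulse S K) ds bl|)%R%:R))).
  apply: le_avg => bl _.
  have [e1 e2] := @flow_block_diff R S (block_bits K bl) W K y y' bl cW
    (fun j _ => nth_block_bits K bl j).
  set X := field_flow _ _ y _; set X' := field_flow _ _ y' _.
  have {}e1 : (X - X') 0 (axis K) = (y - y') 0 (axis K) := e1.
  have {}e2 : (X - X') 0 (axis K.+1) = h0 + signed_sum (npulse S K) ds bl := e2.
  have [big_sum|small_sum] := ltP (block_time R K) `|signed_sum (npulse S K) ds bl|.
    by rewrite -[leLHS]add0r lerD// lern1 leq_b1.
  rewrite addr0 ler_nat; case: (boolP (well_separated _ _)) => //= bad; rewrite lt0b.
  have axk : axis k = axis K.+1 by rewrite /axis /= negbK.
  have bounded : [forall i, `|(X - X') 0 i| <= 1 + block_time R k].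
    have tk : block_time R k = block_time R K + block_time R K := block_timeS R k.
    have two (i : 'I_2) : i = axis K \/ i = axis K.+1.
      by rewrite /axis /=; case: (odd k); case: i => -[|[|//]] ?;
        [left|right|right|left]; apply: val_inj.
    apply/forallP => i; case: (two i) => ->.
      rewrite e1; apply: (le_trans (h2 _)); rewrite tk; move: tmK; lra.
    rewrite e2; apply: (le_trans (ler_normD _ _)).
    have := h2 (axis K.+1); rewrite -/h0 tk; move: small_sum; lra.
  move: bad; rewrite /well_separated bounded andbT -ltNge axk e2 ltr_norml => /andP[b1 b2].
  rewrite (ltW b1) /=; apply: (lt_le_trans b2).
  have -> : n%:R * (2 * step_size S K) = 2 * (n%:R * step_size S K) by ring.
  lra.
rewrite avgD; apply: lerD.
  apply: (le_trans (littlewood_offord_windows _ _ _ d0 big)).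
  by rewrite ler_pM2r// invr_gt0 sqrtr_gt0 ltr0n addn1.
apply: (le_trans (avg_chebyshev _ _ tmK)); rewrite ler_pM2r ?invr_gt0 ?exprn_gt0//.
rewrite mulr_natl -[X in _ *+ X]card_ord -sumr_const; apply: ler_sum => j _.
rewrite -real_normK ?num_real// ler_pXn2r ?nnegrE ?normr_ge0//.
  by apply: step_le.
by rewrite !mulr_ge0 ?amp_ge0// ltW// dur_gt0.
Qed.

Definition separated_at n b m (y y' : plane) : bool :=
  well_separated n.-1 (field_flow b (block_time R m) y (block_time R n) - field_flow b (block_time R m) y' (block_time R n)).

(** Conditioning on the bits of block [k], which acts first. *)
Lemma avg_block k n (y y' : plane) (p : R) : (n <= k)%N -> 0 <= p ->
  (forall x x', well_separated k.-1 (x - x') ->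
     avg (offset S k) (fun L => (~~ separated_at n (nth false L) k x x')%:R) <= p) ->
  avg (offset S k.+1) (fun L => (~~ separated_at n (nth false L) k.+1 y y')%:R)
  <= avg (npulse S k) (fun bl =>
    (~~ well_separated k.-1 (field_flow (block_bits k bl) (block_time R k.+1) y (block_time R k)
                    - field_flow (block_bits k bl) (block_time R k.+1) y' (block_time R k)))%:R) + p.
Proof.
move=> nk p0 IH; rewrite offsetS avg_cat avgC -[X in _ + X](avg_cst (npulse S k)) -avgD.
apply: le_avg => bl sbl.
set X := field_flow (block_bits k bl) _ y _; set X' := field_flow (block_bits k bl) _ y' _.
rewrite (eq_avg (psi := fun a => (~~ separated_at n (nth false a) k X X')%:R)); last first.
  move=> a sa; congr (~~ _)%:R; rewrite /separated_at (field_flow_trans _ y nk) (field_flow_trans _ y' nk).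
  have E x : field_flow (nth false (a ++ bl)) (block_time R k.+1) x (block_time R k)
      = field_flow (block_bits k bl) (block_time R k.+1) x (block_time R k).
    apply: field_flow_block_agree => j _; rewrite -nth_block_bits nth_cat sa.
    by rewrite ltnNge leq_addr /= addKn.
  have ag x : field_flow (nth false (a ++ bl)) (block_time R k) x (block_time R n)
      = field_flow (nth false a) (block_time R k) x (block_time R n).
    by apply: field_flow_agree => i ik; rewrite nth_cat sa ik.
  by rewrite (E y) (E y') (ag X) (ag X').
case: (boolP (well_separated k.-1 (X - X'))) => g /=; first by rewrite add0r; exact: IH.
apply: (@le_trans _ _ 1); last by rewrite lerDl.
rewrite -[leRHS](avg_cst (offset S k) 1); apply: le_avg => a _; by rewrite lern1 leq_b1.
Qed.

Variable n : nat.
Hypotheses (n0 : (0 < n)%N) (hA : forall k, (n <= k)%N -> 0 < amp S k)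
  (slow : forall k, (n <= k)%N -> slow_path S W k)
  (hf : forall k, (n <= k)%N -> (k ^ 2 + 3 <= nfreq S k)%N)
  (hp : forall k, (n <= k)%N -> block_failure k <= block_time R k).

(** The failure probabilities [block_time k] telescope, as [block_time k] is
    [2 block_time k - 2 block_time (k + 1)]. *)
Lemma avg_not_separated d (y y' : plane) : well_separated (n + d).-1 (y - y') ->
  avg (offset S (n + d)) (fun L => (~~ separated_at n (nth false L) (n + d) y y')%:R)
  <= 2 * block_time R n - 2 * block_time R (n + d).
Proof.
elim: d y y' => [|d IH] y y' g.
  rewrite addn0 in g *; rewrite subrr -[leRHS](avg_cst (offset S n) 0); apply: le_avg => L _.
  by rewrite /separated_at !field_flow_start g.
have nd : (n <= n + d)%N by exact: leq_addr.
rewrite addnS in g *.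
have p0 : 0 <= 2 * block_time R n - 2 * block_time R (n + d) by rewrite subr_ge0 ler_pM2l// block_time_le.
apply: (le_trans (avg_block y y' nd p0 IH)).
have k0 : (0 < n + d)%N by rewrite addn_gt0 n0.
apply: (le_trans (lerD (le_trans (block_failureP k0 (hA nd) (slow nd) (hf nd) g) (hp nd)) (lexx _))).
by rewrite (block_timeS R (n + d)); lra.
Qed.

Lemma avg_not_separated_le d (y y' : plane) : well_separated (n + d).-1 (y - y') ->
  avg (offset S (n + d)) (fun L => (~~ separated_at n (nth false L) (n + d) y y')%:R)
  <= 2 * block_time R n.
Proof.
by move/avg_not_separated => /le_trans; apply; rewrite gerBl mulr_ge0// ltW// block_time_gt0.
Qed.

Lemma ell_lt (e : R) : 0 < e -> exists K, forall k, (K <= k)%N -> ell R k <= e.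
Proof.
move=> e0; have [K hK] := block_time_cvg0 e0; exists K => k Kk; apply: le_trans (ltW hK).
rewrite /ell /block_time lef_pV2 ?posrE ?exprn_gt0// ler_eXn2l ?ltr1n//.
by apply: (leq_trans Kk); rewrite -mulnn; case: k {Kk} => // k; rewrite leq_pmulr.
Qed.

(** For large [m] the nonzero coordinates of the separation exceed [ell m].  If the one
    which is transverse to the first shear vanishes, this shear acts in the same way
    on both points, and the induction starts from the block that follows. *)
Lemma eventually_separated (y y' : plane) : 0 < enorm (y - y') < 1 ->
  exists M, forall m, (M <= m)%N ->
    avg (offset S m) (fun L => (~~ separated_at n (nth false L) m y y')%:R) <= 2 * block_time R n.
Proof.
move=> /andP[e0 e1].
have bounded k : [forall i, `|(y - y') 0 i| <= 1 + block_time R k].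
  apply/forallP => i; apply: (le_trans (enorm_coord _ _)); apply: (le_trans (ltW e1)).
  by rewrite lerDl ltW// block_time_gt0.
have small i : exists K, forall k, (K <= k)%N -> (y - y') 0 i != 0 -> ell R k <= `|(y - y') 0 i|.
  have [->|h] := eqVneq ((y - y') 0 i) 0; first by exists 0%N.
  have hpos : 0 < `|(y - y') 0 i| by rewrite normr_gt0.
  by have [K hK] := ell_lt hpos; exists K => k kK _; exact: hK.
have [K0 h0] := small 0; have [K1 h1] := small 1.
have two (i : 'I_2) : i = 0 \/ i = 1.
  by case: i => -[|[|k]] // h; [left|right]; apply: val_inj.
have hK i k : (maxn K0 K1 <= k)%N -> (y - y') 0 i != 0 -> ell R k <= `|(y - y') 0 i|.
  by rewrite geq_max => /andP[k0 k1]; case: (two i) => ->; [exact: h0|exact: h1].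
exists (maxn K0 K1 + n + 2)%N => m mM.
have [d mE] : exists d, m = (n + d).+1.
  by exists (m - n - 1)%N; lia.
have [hz|hz] := eqVneq ((y - y') 0 (axis m.-1)) 0; last first.
  rewrite mE -addnS; apply: avg_not_separated_le; rewrite addnS -mE /well_separated bounded andbT.
  by apply: hK => //; lia.
have hz2 : (y - y') 0 (axis (n + d).-1) != 0.
  have ax : axis (n + d).-1 = axis m.
    rewrite mE /axis /=; have : (0 < n + d)%N by rewrite addn_gt0 n0.
    by case: (n + d)%N => //= q _; rewrite !negbK.
  apply/eqP => hz3; move: e0; rewrite (_ : y - y' = 0).
    by rewrite /enorm /tnorm big1 ?sqrtr0 ?ltxx// => i _; rewrite mxE expr0n.
  apply/rowP => i; rewrite [RHS]mxE.
  suff : i = axis m.-1 \/ i = axis m by case=> ->; rewrite ?hz// -ax hz3.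
  rewrite mE /axis /=; case: (odd (n + d)) => /=; case: (two i) => ->; by [left|right].
rewrite mE; have nd : (n <= n + d)%N by exact: leq_addr.
have p0 : 0 <= 2 * block_time R n by rewrite mulr_ge0// ltW// block_time_gt0.
apply: (le_trans (avg_block y y' nd p0 (@avg_not_separated_le d))).
rewrite -[leRHS]add0r lerD2r -[leRHS](avg_cst (npulse S (n + d)) 0); apply: le_avg => bl _.
have [e1' e2'] := @flow_block_diff R S (block_bits (n + d) bl) W (n + d) y y' bl cW
    (fun j _ => nth_block_bits (n + d) bl j).
set X := field_flow _ _ y _; set X' := field_flow _ _ y' _.
have step0 j : step S W (n + d) (y 0 (axis (n + d))) (y' 0 (axis (n + d))) j = 0.
  have -> : y 0 (axis (n + d)) = y' 0 (axis (n + d)).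
    by apply/eqP; rewrite -subr_eq0; move: hz; rewrite mE /= !mxE => ->.
  rewrite /step (eq_Rintegral _ (g := cst 0)) ?Rintegral_cst ?mul0r//.
  by move=> r _; rewrite /push subrr mulr0.
have same : X - X' = y - y'.
  have {}e1' : (X - X') 0 (axis (n + d)) = (y - y') 0 (axis (n + d)) := e1'.
  have {}e2' : (X - X') 0 (axis (n + d).+1) = (y - y') 0 (axis (n + d).+1).
    apply: (etrans e2'); rewrite /signed_sum big1 ?addr0// => j _.
    by rewrite step0 mulr0.
  apply/rowP => i; suff : i = axis (n + d) \/ i = axis (n + d).+1 by case=> ->.
  rewrite /axis /=; case: (odd (n + d)) => /=; case: (two i) => ->; by [left|right].
rewrite same /well_separated bounded andbT (hK _ _ _ hz2)//; lia.
Qed.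

End Path.
End Recursion.

(** * Explosive separation *)

Section Explosive.
Variables (R : realType) (S : schedule R).
Local Notation plane := 'rV[R]_2.
Implicit Types (W : R -> plane).

Definition random_shear (w : measurableTypeR R) : R -> plane -> plane :=
  field S (fun n => digit n w).

Lemma limf_esup_le (T : choiceType) (X : filteredType T) (f : X -> \bar R)
    (F : set_system X) (V : set X) (l : \bar R) :
  F V -> (forall x, V x -> f x <= l)%E -> (limf_esup f F <= l)%E.
Proof.
move=> FV fl; rewrite limf_esupE; apply: (@le_trans _ _ (ereal_sup (f @` V))).
  by apply: ereal_inf_lbound; exists V.
by apply: ge_ereal_sup => _ [x Vx <-]; exact: fl.
Qed.

Lemma near_diagonal_proper : ~ @near_diagonal R set0.
Proof.
move=> [r /= r0 h]; apply: (h (delta_mx 0 0 *+ 0 + (r / 2) *: delta_mx 0 0, 0)) => /=.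
rewrite mulr0n add0r subr0.
have -> : enorm ((r / 2) *: delta_mx 0 0 : plane) = r / 2.
  rewrite /enorm /tnorm big_ord_recl big_ord1 !mxE !eqxx /= mulr1 mulr0 expr0n addr0.
  by rewrite sqrtr_sqr gtr0_norm// divr_gt0.
by rewrite divr_gt0//= ltr_pdivrMr// ltr_pMr// ltr1n.
Qed.

Variable W : R -> plane.
Hypothesis cW : {within `]0, 1], continuous W}.

Let event n m (delta : R) (x y : plane) : set (measurableTypeR R) :=
  [set w | enorm (flow (random_shear w) W (block_time R m) x (block_time R n)
                  - flow (random_shear w) W (block_time R m) y (block_time R n)) < delta].

(** From time [block_time m] on the flow depends on finitely many digits, and separated points
    are at distance at least [ell n.-1], which exceeds [delta]. *)
Lemma event_le n m delta x y : (n <= m)%N -> delta <= ell R n.-1 ->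
  (unif01 R (event n m delta x y) <=
   (avg (offset S m) (fun L => (~~ separated_at S W n (nth false L) m x y)%:R))%:E)%E.
Proof.
move=> nm dl.
pose Q L := enorm (field_flow S W (nth false L) (block_time R m) x (block_time R n)
                   - field_flow S W (nth false L) (block_time R m) y (block_time R n)) < delta.
rewrite (_ : event n m delta x y = [set w | Q (digits 0 (offset S m) w)]).
  apply: (le_trans (@unif01_digits_le R (offset S m) Q)); rewrite lee_fin; apply: le_avg => L _.
  rewrite ler_nat; case: (boolP (Q L)) => // QL; rewrite lt0b; apply/negP => /andP[h _].
  move: QL; rewrite /Q ltNge; apply/negP; rewrite negbK.
  by apply: (le_trans dl); apply: (le_trans h); exact: enorm_coord.
have E w z : flow (random_shear w) W (block_time R m) z (block_time R n)
    = field_flow S W (nth false (digits 0 (offset S m) w)) (block_time R m) z (block_time R n).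
  apply: field_flow_agree => i im; rewrite /digits (nth_map 0%N) ?size_iota//.
  by rewrite nth_iota.
by apply/seteqP; split => w; rewrite /event /Q /= !E.
Qed.

(** The bound [2 * block_time n] holds for [delta] below [ell n.-1], for distinct points at
    distance less than one and for all late [m], hence for the iterated upper limits. *)
Lemma explosive_of_schedule n0 :
  (forall k, (n0 <= k)%N -> [/\ 0 < amp S k, slow_path S W k,
     (k ^ 2 + 3 <= nfreq S k)%N & block_failure S k <= block_time R k]) ->
  explosive_separation (unif01 R) random_shear (block_time R) W.
Proof.
move=> hyp; rewrite /explosive_separation.
apply: (@squeeze_cvge _ _ _ _ (cst 0%E) _ (fun n => (2 * block_time R n)%:E)); last 2 first.
- exact: cvg_cst.
- apply: cvg_EFin; first by near=> n.
  rewrite -[X in _ --> X](mulr0 (2 : R)); apply: cvgMl_tmp.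
  apply/cvgrPdist_lt => e e0; have [K hK] := block_time_cvg0 e0; near=> n.
  rewrite sub0r normrN ger0_norm ?ltW ?block_time_gt0//; apply: le_lt_trans hK; apply: block_time_le.
  by near: n; exact: nbhs_infty_ge.
near=> n; apply/andP; split.
  have Fproper : ProperFilter (0^'+ : set_system R) by exact: at_right_proper_filter.
  apply: limf_esup_ge0; first exact: filter_not_empty.
  move=> delta; apply: limf_esup_ge0; first exact: near_diagonal_proper.
  move=> p; apply: limf_esup_ge0; first exact: filter_not_empty.
  by move=> m; exact: measure_ge0.
have nn0 : (n0 <= n)%N by near: n; exact: nbhs_infty_ge.
have npos : (0 < n)%N by near: n; exact: nbhs_infty_gt.
apply: (limf_esup_le (V := [set delta : R | delta <= ell R n.-1])).
  by near=> delta; near: delta; apply: nbhs_right_le; exact: ell_gt0.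
move=> delta /= dl; apply: (limf_esup_le (V := [set p | 0 < enorm (p.1 - p.2) < 1])).
  by exists 1 => //=.
move=> [x y] /= xy.
have [M hM] := @eventually_separated R S W cW n npos
  (fun k kn => let: And4 h _ _ _ := hyp k (leq_trans nn0 kn) in h)
  (fun k kn => let: And4 _ h _ _ := hyp k (leq_trans nn0 kn) in h)
  (fun k kn => let: And4 _ _ h _ := hyp k (leq_trans nn0 kn) in h)
  (fun k kn => let: And4 _ _ _ h := hyp k (leq_trans nn0 kn) in h) x y xy.
apply: (limf_esup_le (V := [set m | (maxn M n <= m)%N])).
  by near=> m; near: m; exact: nbhs_infty_ge.
move=> m /=; rewrite geq_max => /andP[Mm nm].
apply: (le_trans (event_le x y nm dl)); rewrite lee_fin; exact: hM.
Unshelve. all: by end_near. Qed.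

Lemma vanishing_block_times : vanishing_times (block_time R).
Proof.
split; first by move=> n; rewrite block_time_gt0 block_time_le1.
apply/cvgrPdist_lt => e e0; have [K hK] := block_time_cvg0 e0; near=> n.
rewrite sub0r normrN ger0_norm ?ltW ?block_time_gt0//; apply: le_lt_trans hK; apply: block_time_le.
by near: n; exact: nbhs_infty_ge.
Unshelve. all: by end_near. Qed.

End Explosive.

(** * Choice of the scales *)

Section Scales.
Variable R : realType.
Implicit Types (a sigma x y b c : R).

(** All scales are powers of two with a real exponent, quadratic in the number of the
    block. *)
Definition pow2 x : R := 2 `^ x.

Lemma pow2_gt0 x : 0 < pow2 x. Proof. exact: powR_gt0. Qed.

Lemma pow2D x y : pow2 (x + y) = pow2 x * pow2 y.
Proof. by rewrite /pow2 powRD ?pnatr_eq0 ?implybT. Qed.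

Lemma pow2N x : pow2 (- x) = (pow2 x)^-1. Proof. exact: powRN. Qed.

Lemma pow2_le x y : x <= y -> pow2 x <= pow2 y.
Proof. by move=> xy; apply: ler_powR => //; rewrite ler1n. Qed.

Lemma pow2_nat n : pow2 n%:R = 2 ^+ n. Proof. exact: powR_mulrn. Qed.

Lemma block_time_pow2 k : block_time R k = pow2 (- k%:R). Proof. by rewrite pow2N pow2_nat. Qed.

Lemma ell_pow2 k : ell R k = pow2 (- (k%:R ^+ 2)).
Proof. by rewrite pow2N -natrX pow2_nat. Qed.

(** A negative quadratic exponent beats every linear one. *)
Lemma eventually_pow2 (K b c : R) : 0 < c ->
  exists N, forall k, (N <= k)%N -> K * pow2 (b * k%:R - c * k%:R ^+ 2) <= 1.
Proof.
move=> c0; pose j := Num.truncn K; pose x := (j.+1%:R + `|b|) / c.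
exists (Num.truncn x).+1 => k Nk.
have xk : x <= k%:R.
  by apply: (le_trans (ltW (truncnS_gt x))); rewrite ler_nat.
have k1 : 1 <= k%:R :> R by rewrite ler1n (leq_trans _ Nk).
have Kj : K <= pow2 j.+1%:R.
  rewrite pow2_nat; apply: (le_trans (ltW (truncnS_gt K))).
  by rewrite -natrX ler_nat ltnW// ltn_expl.
apply: (le_trans (ler_wpM2r (ltW (pow2_gt0 _)) Kj)); rewrite -pow2D.
rewrite -[leRHS](powRr0 2); apply: pow2_le.
move: xk; rewrite ler_pdivrMr// => xk.
have e1 : (j.+1%:R + `|b|) * k%:R <= k%:R * c * k%:R by rewrite ler_wpM2r// (le_trans _ k1).
have e2 : j.+1%:R <= j.+1%:R * k%:R :> R by rewrite ler_peMr.
have e3 : b * k%:R <= `|b| * k%:R by rewrite ler_wpM2r ?ler_norm// (le_trans _ k1).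
by rewrite expr2; lra.
Qed.

(** With [2^(theta k^2)] steps of size [2^(- (a + sigma) k^2)] the standard deviation
    of their sum is [2^(- k^2)], the scale of the block. *)
Definition theta a sigma : R := 2 * sigma - 2 + 2 * a.

(** The linear exponents [10 k] and [- 12 k] below are corrections.  Their sum is
    negative enough for the pulses, with [2^(k + 3)] frequencies, to fit in the block;
    on the other hand [10 k - 6 k] exceeds by [2 k] what is needed for the standard
    deviation of the sum to reach [ell k.-1], which gives a failure probability of
    order [4^-k]. *)
Definition scaled_amp a (k : nat) : R := pow2 (- a * k%:R ^+ 2) / 8.

Definition scaled_dur sigma (k : nat) : R := pow2 (- sigma * k%:R ^+ 2 + 10 * k%:R - 6).

Definition scaled_nfreq (k : nat) : nat := (2 ^ (k + 3))%N.

Definition nrep_real a sigma (k : nat) : R :=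
  pow2 (theta a sigma * k%:R ^+ 2 - 12 * k%:R).

Definition scaled_nrep a sigma (k : nat) : nat := Num.truncn (nrep_real a sigma k).

Lemma pulses_le a sigma k :
  (pulses (scaled_nfreq k) (scaled_nrep a sigma k))%:R
  <= pow2 (theta a sigma * k%:R ^+ 2 - 11 * k%:R + 5).
Proof.
rewrite /pulses !natrM /scaled_nfreq natrX -pow2_nat.
have h : (scaled_nrep a sigma k)%:R <= nrep_real a sigma k.
  by rewrite truncn_le ltW// pow2_gt0.
have -> : pow2 (theta a sigma * k%:R ^+ 2 - 11 * k%:R + 5)
   = pow2 (k + 3)%:R * (4 * nrep_real a sigma k).
  have -> : 4 = pow2 2%:R by rewrite pow2_nat; lra.
  by rewrite /nrep_real -!pow2D natrD; congr pow2; lra.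
have -> : 2 * (pow2 (k + 3)%:R * (2 * (scaled_nrep a sigma k)%:R))
   = pow2 (k + 3)%:R * (4 * (scaled_nrep a sigma k)%:R) by ring.
by rewrite ler_pM2l ?pow2_gt0// ler_pM2l.
Qed.

Lemma scaled_pulses_fit a sigma : theta a sigma <= sigma -> forall k,
  (pulses (scaled_nfreq k) (scaled_nrep a sigma k))%:R * scaled_dur sigma k <= (2 ^+ k.+1)^-1.
Proof.
move=> ts k; rewrite -pow2_nat -pow2N.
apply: (le_trans (ler_wpM2r (ltW (pow2_gt0 _)) (pulses_le a sigma k))).
rewrite -pow2D; apply: pow2_le; rewrite -natr1.
have : theta a sigma * k%:R ^+ 2 <= sigma * k%:R ^+ 2 by rewrite ler_wpM2r// exprn_ge0.
lra.
Qed.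

Lemma scaled_amp_ge0 a k : 0 <= scaled_amp a k.
Proof. by rewrite divr_ge0// ltW// pow2_gt0. Qed.

Lemma scaled_dur_gt0 sigma k : 0 < scaled_dur sigma k. Proof. exact: pow2_gt0. Qed.

Definition scaled_schedule a sigma (ts : theta a sigma <= sigma) : schedule R :=
  Schedule (scaled_amp_ge0 a) (scaled_dur_gt0 sigma) (scaled_pulses_fit ts).

(** The amplitude cancels [lam^a] up to a factor [3] due to the spread of the
    frequencies; [1 / 8] is small enough for the constants [3] of the wave norm and of
    this spread. *)
Lemma amp_norm a k lam : a < 1 -> (ell R k)^-1 <= lam <= 3 / ell R k ->
  3 * scaled_amp a k * lam `^ a <= 2.
Proof.
move=> a1 /andP[l1 l2]; have e0 := ell_gt0 R k.
have i0 : 0 < (ell R k)^-1 by rewrite invr_gt0.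
have l0 : 0 < lam by exact: lt_le_trans l1.
have iE : (ell R k)^-1 `^ a = pow2 (a * k%:R ^+ 2).
  by rewrite ell_pow2 -pow2N opprK /pow2 -powRrM mulrC.
suff h : lam `^ a <= 3 * pow2 (a * k%:R ^+ 2).
  have : pow2 (- a * k%:R ^+ 2) * pow2 (a * k%:R ^+ 2) = 1.
    by rewrite -pow2D mulNr addNr /pow2 powRr0.
  have := pow2_gt0 (- a * k%:R ^+ 2); rewrite /scaled_amp; set u := pow2 _; set v := pow2 _ in h *.
  move=> u0 uv; apply: (@le_trans _ _ (3 * (u / 8) * (3 * v))); first by rewrite ler_pM2l// !mulr_gt0.
  have -> : 3 * (u / 8) * (3 * v) = 9 / 8 * (u * v) by field.
  by rewrite uv; lra.
have [a0|a0] := leP 0 a.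
  apply: (@le_trans _ _ ((3 / ell R k) `^ a)).
    by apply: ge0_ler_powR; rewrite ?nnegrE// ltW// mulr_gt0.
  rewrite powRM ?(ltW i0)// iE ler_pM2r ?pow2_gt0//.
  by apply: ler1_powR; rewrite ?ler1n// ltW.
apply: (@le_trans _ _ (pow2 (a * k%:R ^+ 2))); last by rewrite ler_peMl ?ler1n// ltW// pow2_gt0.
rewrite -iE -[a]opprK !(powRN _ (- a)) lef_pV2 ?posrE ?powR_gt0//.
by apply: ge0_ler_powR; rewrite ?nnegrE ?oppr_ge0// ltW.
Qed.

Lemma holder_path_continuous (W : R -> 'rV[R]_2) beta : 0 < beta -> holder_path beta W ->
  {within `]0, 1], continuous W}.
Proof.
move=> b0 [C hC]; apply/subspace_continuousP => r /=; rewrite in_itv/= => /andP[r0 r1].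
apply/cvgrPdist_le => e e0.
have C0 : 0 < `|C| + 1 by rewrite ltr_wpDl.
pose d := (e / (`|C| + 1)) `^ beta^-1.
have d0 : 0 < d by rewrite powR_gt0// divr_gt0.
have dE : d `^ beta = e / (`|C| + 1).
  by rewrite -powRrM mulVf ?gt_eqF// powRr1// ltW// divr_gt0.
have near_r : \forall t \near r, `|t - r| <= d.
  by near=> t; rewrite distrC; near: t; apply: cvgr_dist_le => //; exact: cvg_id.
apply: filterS near_r => t td /=; rewrite in_itv/= => /andP[t0 t1].
have r01 : 0 <= r <= 1 by rewrite (ltW r0).
have t01 : 0 <= t <= 1 by rewrite (ltW t0).
rewrite [leLHS]/Num.Def.normr/= mx_normrE (bigmax_le _ (ltW e0))//= => -[i j] _ /=.
rewrite (ord1 i); apply: (le_trans (enorm_coord _ _)).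
apply: (le_trans (hC t r t01 r01)).
apply: (@le_trans _ _ ((`|C| + 1) * d `^ beta)); last by rewrite dE mulrC divfK ?gt_eqF.
apply: (@le_trans _ _ ((`|C| + 1) * `|r - t| `^ beta)).
  rewrite ler_wpM2r ?powR_ge0//; apply: (le_trans (ler_norm C)); by rewrite lerDl.
rewrite ler_pM2l//; apply: ge0_ler_powR; rewrite ?nnegrE ?(ltW b0) ?(ltW d0)//.
by rewrite distrC.
Unshelve. all: by end_near. Qed.

Section Eventually.
Variables (a sigma : R).
Hypotheses (ts : theta a sigma <= sigma) (t0 : 0 < theta a sigma).
Let S := scaled_schedule ts.

Lemma nfreq_large k : (k ^ 2 + 3 <= scaled_nfreq k)%N.
Proof.
rewrite /scaled_nfreq expnD (_ : 2 ^ 3 = 8)%N//; elim: k => [//|k IH].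
have : (k.+1 <= 2 ^ k)%N by exact: ltn_expl.
by move: IH; rewrite [(2 ^ k.+1)%N]expnS; move: (2 ^ k)%N => q; rewrite -!mulnn; lia.
Qed.

Lemma step_sizeE k : step_size S k =
  pow2 (- (a + sigma) * k%:R ^+ 2 + 10 * k%:R - 6) * (bump_mass R / 8).
Proof.
rewrite /step_size /= /scaled_amp /scaled_dur.
have -> : - (a + sigma) * k%:R ^+ 2 + 10 * k%:R - 6
   = - a * k%:R ^+ 2 + (- sigma * k%:R ^+ 2 + 10 * k%:R - 6) by ring.
by rewrite [in RHS]pow2D; field.
Qed.

Lemma inv_sqrt_nrep_le k :
  (Num.sqrt (2 * scaled_nrep a sigma k + 1)%:R)^-1
  <= pow2 (- (theta a sigma / 2) * k%:R ^+ 2 + 6 * k%:R).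
Proof.
have h : pow2 (theta a sigma / 2 * k%:R ^+ 2 - 6 * k%:R) <= Num.sqrt (2 * scaled_nrep a sigma k + 1)%:R.
  rewrite -[leLHS]ger0_norm ?(ltW (pow2_gt0 _))// -sqrtr_sqr ler_wsqrtr//.
  rewrite expr2 -pow2D; apply: (@le_trans _ _ (scaled_nrep a sigma k).+1%:R).
    apply: (le_trans _ (ltW (truncnS_gt _))).
    by rewrite /nrep_real; apply: pow2_le; lra.
  by rewrite ler_nat; lia.
have s0 : 0 < Num.sqrt (2 * scaled_nrep a sigma k + 1)%:R :> R.
  by rewrite sqrtr_gt0 ltr0n addn1.
rewrite -[leRHS]invrK lef_pV2 ?posrE ?invr_gt0 ?pow2_gt0//.
rewrite -pow2N; apply: le_trans h; apply: pow2_le; lra.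
Qed.

Lemma bump_mass_gt0 : 0 < bump_mass R.
Proof. by rewrite divr_gt0 ?expR_gt0. Qed.

Lemma eventually_pow2_linear (K : R) :
  exists N, forall k : nat, (N <= k)%N -> K * pow2 (- k%:R) <= 1.
Proof.
exists (Num.truncn K).+1 => k Nk; rewrite pow2N ler_pdivrMr ?pow2_gt0// mul1r pow2_nat.
apply: (le_trans (ltW (truncnS_gt K))); rewrite -natrX ler_nat.
by apply: (leq_trans Nk); rewrite ltnW// ltn_expl.
Qed.

(** In the first term quadratic exponents cancel, and the linear ones leave [4^-k];
    the other terms are [2] to a negative quadratic power. *)
Lemma eventually_block_failure :
  exists N, forall k, (N <= k)%N -> block_failure S k <= block_time R k.
Proof.
have m0 := bump_mass_gt0.
have th2 : 0 < theta a sigma / 2 by rewrite divr_gt0.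
have [N1 h1] := eventually_pow2_linear (3 * (8 * pow2 5 / bump_mass R)).
have [N2 h2] := eventually_pow2 3 7 th2.
have [N3 h3] := eventually_pow2 (3 / 16 * pow2 (- 7)) 12 (ltr0n R 2).
exists (maxn (maxn N1 N2) N3).+1 => k; rewrite ltnNge -ltnNge => Nk.
have {}h1 := h1 k (_ : (N1 <= k)%N); have {}h2 := h2 k (_ : (N2 <= k)%N).
have {}h3 := h3 k (_ : (N3 <= k)%N).
move: h1 h2 h3 => /(_ ltac:(lia)) h1 /(_ ltac:(lia)) h2 /(_ ltac:(lia)) h3.
have k1 : (k.-1)%:R = k%:R - 1 :> R by rewrite -[in RHS](prednK (_ : 0 < k)%N) -?natr1 ?addrK//; lia.
have pk := pow2_gt0 (- k%:R).
rewrite block_time_pow2; set x := k%:R in h1 h2 h3 k1 pk *.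
have term1 : ell R k.-1 / step_size S k / Num.sqrt (2 * nrep S k + 1)%:R
    <= pow2 (- x) / 3.
  have E : ell R k.-1 / step_size S k = 8 / bump_mass R * pow2 ((a + sigma - 1) * x ^+ 2 - 8 * x + 5).
    rewrite step_sizeE ell_pow2 k1 invfM -pow2N mulrA -pow2D.
    have -> : - (x - 1) ^+ 2 - (- (a + sigma) * x ^+ 2 + 10 * x - 6)
      = (a + sigma - 1) * x ^+ 2 - 8 * x + 5 by ring.
    by field; rewrite gt_eqF.
  rewrite E; have B0 : 0 <= 8 / bump_mass R by rewrite divr_ge0// ltW.
  apply: (le_trans (ler_wpM2l _ (inv_sqrt_nrep_le k))).
    by rewrite mulr_ge0// ltW// pow2_gt0.
  rewrite -[leLHS]mulrA -pow2D -/x.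
  have -> : (a + sigma - 1) * x ^+ 2 - 8 * x + 5 + (- (theta a sigma / 2) * x ^+ 2 + 6 * x)
     = 5 + - x + - x by rewrite /theta; field.
  rewrite (pow2D (5 + - x)) (pow2D 5); have -> : 8 / bump_mass R * (pow2 5 * pow2 (- x) * pow2 (- x))
     = (3 * (8 * pow2 5 / bump_mass R) * pow2 (- x)) * (pow2 (- x) / 3) by field; rewrite gt_eqF.
  by rewrite ler_piMl// divr_ge0// ltW.
have term2 : (Num.sqrt (2 * nrep S k + 1)%:R)^-1 <= pow2 (- x) / 3.
  apply: (le_trans (inv_sqrt_nrep_le k)); rewrite -/x.
  have -> : - (theta a sigma / 2) * x ^+ 2 + 6 * x
     = (7 * x - theta a sigma / 2 * x ^+ 2) + - x by ring.
  rewrite pow2D; set u := pow2 (_ - _) in h2 *.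
  have -> : u * pow2 (- x) = (3 * u) * (pow2 (- x) / 3) by field.
  by rewrite ler_piMl// divr_ge0// ltW.
have term3 : (npulse S k)%:R * (2 * amp S k * dur S k) ^+ 2 / block_time R k ^+ 2 <= pow2 (- x) / 3.
  have E : (2 * amp S k * dur S k) ^+ 2 / block_time R k ^+ 2
      = pow2 (- (2 * (a + sigma)) * x ^+ 2 + 22 * x - 12) / 16.
    rewrite block_time_pow2 -/x /= /scaled_amp /scaled_dur -/x.
    rewrite -[(pow2 (- x)) ^+ 2]invrK -exprVn -pow2N opprK.
    set A := - a * x ^+ 2; set B := - sigma * x ^+ 2 + 10 * x - 6.
    have -> : - (2 * (a + sigma)) * x ^+ 2 + 22 * x - 12 = (A + A) + (B + B) + (x + x).
      by rewrite /A /B; ring.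
    rewrite (pow2D _ (x + x)) (pow2D (A + A)) (pow2D A A) (pow2D B B) (pow2D x x).
    by field; rewrite gt_eqF ?pow2_gt0.
  rewrite -mulrA E; apply: (le_trans (ler_wpM2r _ (pulses_le a sigma k))).
    by rewrite divr_ge0// ltW// pow2_gt0.
  rewrite -/x mulrA -pow2D.
  have -> : theta a sigma * x ^+ 2 - 11 * x + 5 + (- (2 * (a + sigma)) * x ^+ 2 + 22 * x - 12)
     = (12 * x - 2 * x ^+ 2) + - x + - 7 by rewrite /theta; ring.
  rewrite 2!pow2D; set u := pow2 (_ - _) in h3 *.
  have -> : u * pow2 (- x) * pow2 (- 7) / 16 = (3 / 16 * pow2 (- 7) * u) * (pow2 (- x) / 3) by field.
  by rewrite ler_piMl// divr_ge0// ltW.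
rewrite /block_failure mulrDl mul1r.
move: term1 term2 term3; lra.
Qed.

(** A pair of pulses lasts about [2^(- sigma k^2)], during which the path moves by
    about [2^(- sigma beta k^2)], much less than [2^(- k^2)]. *)
Lemma eventually_slow_path (W : R -> 'rV[R]_2) beta : 1 < sigma * beta -> 0 < beta ->
  holder_path beta W -> exists N, forall k, (N <= k)%N -> slow_path S W k.
Proof.
move=> sb b0 [C hC].
have sb0 : 0 < sigma * beta - 1 by rewrite subr_gt0.
have [N hN] := eventually_pow2 (24 * `|C| * pow2 (- 5 * beta)) (10 * beta) sb0.
exists N => k /hN {}hN r r' /andP[r1 r2] /andP[r1' r2'] rr.
have r01 : 0 <= r <= 1 by rewrite (le_trans (ltW (block_time_gt0 R k.+1)) r1) (le_trans r2 (block_time_le1 R k)).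
have r01' : 0 <= r' <= 1 by rewrite (le_trans (ltW (block_time_gt0 R k.+1)) r1') (le_trans r2' (block_time_le1 R k)).
apply: (@le_trans _ _ (enorm (W r - W r'))).
  by have := enorm_coord (W r - W r') (axis k); rewrite !mxE.
apply: (le_trans (hC r' r r01' r01)).
apply: (@le_trans _ _ (`|C| * (2 * dur S k) `^ beta)).
  apply: (@le_trans _ _ (`|C| * `|r - r'| `^ beta)).
    by rewrite ler_wpM2r ?powR_ge0// ler_norm.
  rewrite ler_wpM2l//; apply: ge0_ler_powR; rewrite ?nnegrE ?(ltW b0)//.
  by rewrite mulr_ge0// ltW// dur_gt0.
rewrite /= /scaled_dur; set x := k%:R in hN *.
have -> : 2 * pow2 (- sigma * x ^+ 2 + 10 * x - 6) = pow2 (- sigma * x ^+ 2 + 10 * x - 5).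
  have -> : 2 = pow2 1%:R by rewrite pow2_nat.
  by rewrite -pow2D; congr pow2; ring.
rewrite /pow2 -powRrM -/(pow2 _) ell_pow2 -/x ler_pdivlMr//.
have -> : (- sigma * x ^+ 2 + 10 * x - 5) * beta
  = - 5 * beta + (10 * beta * x - (sigma * beta - 1) * x ^+ 2) + - x ^+ 2 by ring.
rewrite 2!pow2D; set u := pow2 (_ - _) in hN *.
have -> : `|C| * (pow2 (- 5 * beta) * u * pow2 (- x ^+ 2)) * 24
  = (24 * `|C| * pow2 (- 5 * beta) * u) * pow2 (- x ^+ 2) by ring.
by rewrite ler_piMl// ltW// pow2_gt0.
Qed.

Lemma explosive_scaled_schedule (W : R -> 'rV[R]_2) beta : 1 < sigma * beta -> 0 < beta ->
  holder_path beta W -> explosive_separation (unif01 R) (random_shear S) (block_time R) W.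
Proof.
move=> sb b0 hW; have cW := holder_path_continuous b0 hW; have [N1 h1] := eventually_slow_path sb b0 hW.
have [N2 h2] := eventually_block_failure.
apply: (explosive_of_schedule cW (n0 := maxn N1 N2)) => k; rewrite geq_max => /andP[k1 k2].
split; [by rewrite divr_gt0// pow2_gt0|exact: h1|exact: nfreq_large|exact: h2].
Qed.

(** In block [k] the amplitude times the active time is about
    [2^((theta - a - sigma) k^2 - k)], with [theta - a - sigma = sigma + a - 2]. *)
Lemma L1_scaled_schedule (b : nat -> bool) : sigma + a <= 2 -> L1_C0 (field S b).
Proof.
move=> sa; apply: (@L1_C0_field R S b 1) => // k.
rewrite /= /npulse /=.
apply: (@le_trans _ _ (3 * scaled_amp a k *
    (pow2 (theta a sigma * k%:R ^+ 2 - 11 * k%:R + 5) * scaled_dur sigma k))).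
  rewrite ler_wpM2l//; first by rewrite mulr_ge0// scaled_amp_ge0.
  by rewrite ler_wpM2r ?pulses_le// ltW// scaled_dur_gt0.
rewrite /scaled_amp /scaled_dur -pow2D mul1r natrX -pow2_nat -pow2N -(natr1 k).
set x := k%:R.
have -> : 3 * (pow2 (- a * x ^+ 2) / 8) * pow2 (theta a sigma * x ^+ 2 - 11 * x + 5
     + (- sigma * x ^+ 2 + 10 * x - 6))
   = 3 / 8 * pow2 (- a * x ^+ 2 + (theta a sigma * x ^+ 2 - 11 * x + 5
     + (- sigma * x ^+ 2 + 10 * x - 6))) by rewrite [in RHS]pow2D; field.
apply: (@le_trans _ _ (1 * pow2 (- (x + 1)))); last by rewrite mul1r.
apply: ler_pM; [by rewrite divr_ge0|exact/ltW/pow2_gt0|lra|apply: pow2_le].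
rewrite /theta; have : (sigma + a) * x ^+ 2 <= 2 * x ^+ 2 by rewrite ler_wpM2r// exprn_ge0.
lra.
Qed.

Lemma Cs_norm_scaled_schedule (b : nat -> bool) t : a < 1 -> (Cs_norm a (field S b t) <= 2%:E)%E.
Proof. by move=> a1; apply: Cs_norm_field => // k lam hl; exact: amp_norm. Qed.

End Eventually.
End Scales.

(** * The theorem *)

Theorem theorem1p9 (R : realType) :
  (forall alpha : R, alpha < 1 / 2 ->
    exists (d : measure_display) (Omega : measurableType d)
           (P : probability Omega R)
           (v : Omega -> R -> 'rV[R]_2 -> 'rV[R]_2),
      [/\ random_field v,
          forall w t, 0 <= t <= 1 -> (Cs_norm alpha (v w t) <= 2%:E)%E,
          forall w, smooth_loc (v w),
          forall w, well_posed (v w)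
        & exists T : nat -> R, vanishing_times T /\
            forall (beta : R) (W : R -> 'rV[R]_2),
              1 / (2 * (1 - alpha)) < beta <= 1 -> holder_path beta W ->
              explosive_separation P v T W])
  /\
  (forall rho : R, 0 < rho < 1 / 2 ->
    exists (d : measure_display) (Omega : measurableType d)
           (P : probability Omega R)
           (u : Omega -> R -> 'rV[R]_2 -> 'rV[R]_2),
      [/\ random_field u,
          forall w t, 0 <= t <= 1 -> (Cs_norm (- rho) (u w t) <= 2%:E)%E,
          forall w, L1_C0 (u w) /\ smooth_loc (u w),
          forall w, well_posed (u w)
        & exists T : nat -> R, vanishing_times T /\
            forall W : R -> 'rV[R]_2,
              holder_path ((1 + rho / 8) / (2 + rho / 2)) W ->
              explosive_separation P u T W]).
Proof.
split.
  move=> alpha alpha12; pose sigma := 2 - 2 * alpha.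
  have ts : theta alpha sigma <= sigma by rewrite /theta /sigma; lra.
  have t0 : 0 < theta alpha sigma by rewrite /theta /sigma; lra.
  exists _, (measurableTypeR R), (unif01 R), (random_shear (scaled_schedule ts)); split.
  - exact: random_field_field.
  - by move=> w t _; apply: Cs_norm_scaled_schedule; lra.
  - by move=> w; exact: smooth_loc_field.
  - by move=> w; exact: well_posed_field.
  exists (block_time R); split; first exact: vanishing_block_times.
  move=> beta W /andP[b1 _] hW.
  have s0 : 0 < sigma by rewrite /sigma; lra.
  have sE : 2 * (1 - alpha) = sigma by rewrite /sigma; ring.
  apply: explosive_scaled_schedule hW => //.
    by move: b1; rewrite sE ltr_pdivrMr// mulrC.
  by apply: lt_trans b1; rewrite divr_gt0// sE.
move=> rho /andP[rho0 rho12]; pose sigma := 2 + rho / 2.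
have ts : theta (- rho) sigma <= sigma by rewrite /theta /sigma; lra.
have t0 : 0 < theta (- rho) sigma by rewrite /theta /sigma; lra.
exists _, (measurableTypeR R), (unif01 R), (random_shear (scaled_schedule ts)); split.
- exact: random_field_field.
- by move=> w t _; apply: Cs_norm_scaled_schedule; lra.
- move=> w; split; last exact: smooth_loc_field.
  by apply: L1_scaled_schedule; rewrite /sigma; lra.
- by move=> w; exact: well_posed_field.
exists (block_time R); split; first exact: vanishing_block_times.
move=> W hW; have s0 : 0 < 2 + rho / 2 by lra.
apply: explosive_scaled_schedule hW => //.
  by rewrite /sigma mulrC divfK ?gt_eqF//; lra.
by rewrite divr_gt0//; lra.
Qed.
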